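(* There is an algorithm that, given two binary abstract merge trees $T_1,\ell_1$ and $T_2,\ell_2$, computes the one-degree edit distance $\delta_1(T_1,T_2)$ in time $O(|T_1|^2\cdot|T_2|^2)$, where $|T_i|$ denotes the number of vertices of $T_i$; in particular in time $O(n^4)$ if $|T_1|,|T_2|\le n$.
   Context: Time is measured in elementary steps, where additions, subtractions, absolute values and comparisons of real numbers each count as one step. Rooted trees $T$ are finite directed graphs whose edges point from child to parent: $(c,p)\in E(T)$ means that $c$ is a child of $p$. $\deg_T(p)$ is the number of children of $p$. A leaf is a node without children. An abstract merge tree is an unordered rooted tree $T$ with edge labels $\ell:E(T)\to\mathbb R_{>0}$ such that $\deg_T(\mathrm{root}(T))=1$ and $\deg_T(v)\neq 1$ for all $v\neq\mathrm{root}(T)$. It is binary if every non-root node has either $0$ or $2$ children. Abstract merge trees are considered up to isomorphism of rooted edge-labeled trees. One-degree edit operations. Each transforms an abstract merge tree $T,\ell$ into another (not necessarily binary) abstract merge tree $T',\ell'$: (1) Relabel: change the label of one edge $e$ to a new value in $\mathbb R_{>0}$, at cost $|\ell(e)-\ell'(e)|$. (2) Deletion of an edge $(c,p)$, where $c$ is a leaf and $p$ is not the root: remove $c$ and $(c,p)$. If $p$ is then left with exactly one child $c'$, also remove $p$ and, with $p'$ the parent of $p$, replace $(c',p),(p,p')$ by the edge $(c',p')$ with label $\ell((c',p))+\ell((p,p'))$. All other labels are unchanged. The cost is $\ell((c,p))$. (3) Insertion: the inverse of a deletion of type (2), with the same cost. A one-degree edit sequence is a finite sequence $S$ of such operations.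 $\mathrm c(S)$ is the sum of their costs, and $T_1\xrightarrow{S}T_2$ means that $S$ transforms $T_1$ into $T_2$. Then $\delta_1(T_1,T_2)=\inf\{\mathrm c(S)\mid T_1\xrightarrow{S}T_2,\ S\text{ a one-degree edit sequence}\}$. *)

(* Defs.v *)
From HB Require Import structures.
From mathcomp Require Import all_boot all_order all_algebra.
From mathcomp Require Import all_classical all_reals all_analysis.

Set Implicit Arguments.
Unset Strict Implicit.
Unset Printing Implicit Defensive.

Import Order.TTheory GRing.Theory Num.Theory.

Local Open Scope ring_scope.

(* [E c p] is the edge from the child [c] to its parent [p]. *)
Definition children (V : finType) (E : rel V) (p : V) : {set V} :=
  [set c | E c p]%SET.

Definition deg (V : finType) (E : rel V) (p : V) : nat := #|children E p|.

Definition rooted_tree (V : finType) (E : rel V) (r : V) : Prop :=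
  [/\ forall p, ~~ E r p,
      forall c, c != r -> exists! p, E c p
    & forall c, connect E c r].

(* The label of an edge [(c, p)] is [label c p]; the values of [label] at pairs
   that are not edges are irrelevant and never inspected. *)
Record merge_tree (R : realType) := MergeTree {
  vertex :> finType;
  edge : rel vertex;
  root : vertex;
  label : vertex -> vertex -> R;
  _ : rooted_tree edge root;
  _ : forall c p, edge c p -> 0 < label c p;
  _ : deg edge root = 1%N;
  _ : forall v, v != root -> deg edge v <> 1%N
}.

Arguments edge {R} m.
Arguments root {R} m.
Arguments label {R} m.

Definition nvertices (R : realType) (T : merge_tree R) : nat := #|{: T}|.

Definition leaf (R : realType) (T : merge_tree R) (v : T) : Prop :=
  deg (edge T) v = 0%N.

Definition binary (R : realType) (T : merge_tree R) : Prop :=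
  forall v : T, v != root T -> deg (edge T) v = 0%N \/ deg (edge T) v = 2%N.

(* [T] is isomorphic, as a rooted edge-labeled graph, to the graph with vertex
   set [S], edges [E] (restricted to [S]), labels [l] and root [r]. *)
Definition isomorphic_to (R : realType) (T : merge_tree R) (V : finType)
    (S : {set V}) (E : rel V) (l : V -> V -> R) (r : V) : Prop :=
  exists f : T -> V,
    [/\ injective f,
        forall v, v \in S <-> exists x, f x = v,
        f (root T) = r,
        forall x y, edge T x y = E (f x) (f y)
      & forall x y, edge T x y -> label T x y = l (f x) (f y)].

Definition isomorphic (R : realType) (T T' : merge_tree R) : Prop :=
  isomorphic_to T' [set: T]%SET (edge T) (label T) (root T).

(* The result of an edit operation is only specified up to isomorphism. *)
Definition relabel (R : realType) (T : merge_tree R) (k : R)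
    (T' : merge_tree R) : Prop :=
  exists c p a,
    [/\ edge T c p, 0 < a, k = `|label T c p - a|
      & isomorphic_to T' [set: T]%SET (edge T)
          (fun x y => if (x == c) && (y == p) then a else label T x y)
          (root T)].

Definition deletion (R : realType) (T : merge_tree R) (k : R)
    (T' : merge_tree R) : Prop :=
  exists c p,
    [/\ edge T c p, leaf c, p != root T, k = label T c p
      & (#|children (edge T) p :\ c| <> 1%N /\
         isomorphic_to T' [set~ c]%SET (edge T) (label T) (root T))
        \/
        (exists c' p',
          [/\ children (edge T) p :\ c = [set c']%SET, edge T p p'
            & isomorphic_to T' (~: [set c; p])%SET
                (fun x y => edge T x y || (x == c') && (y == p'))
                (fun x y => if (x == c') && (y == p')
                            then label T c' p + label T p p'
                            else label T x y)
                (root T)])].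

Definition insertion (R : realType) (T : merge_tree R) (k : R)
    (T' : merge_tree R) : Prop := deletion T' k T.

Definition edit_operation (R : realType) (T : merge_tree R) (k : R)
    (T' : merge_tree R) : Prop :=
  [\/ relabel T k T', deletion T k T' | insertion T k T'].

(* [edit_sequence T k T']: some one-degree edit sequence of total cost [k]
   transforms [T] into [T']. *)
Inductive edit_sequence (R : realType) :
    merge_tree R -> R -> merge_tree R -> Prop :=
| EditNil T T' : isomorphic T T' -> edit_sequence T 0 T'
| EditCons T k T' k' T'' :
    edit_operation T k T' -> edit_sequence T' k' T'' ->
    edit_sequence T (k + k') T''.

(* The infimum is taken in the extended reals, so that no default value is
   involved. *)
Definition one_degree_distance (R : realType) (T1 T2 : merge_tree R) : \bar R :=
  ereal_inf [set k%:E | k in [set k | edit_sequence T1 k T2]]%classic.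

(* A real random access machine, presented as a while language over arrays.
   A program handles finitely many named arrays (the name is a literal of the
   program) of natural numbers, and finitely many of reals; a scalar variable is
   a one-cell array. On naturals there are constants, addition, truncated
   subtraction and comparison; on reals only addition, subtraction, absolute
   value and comparison, without any real constant and without conversion
   between naturals and reals. Every constant, memory access, arithmetic,
   logical or control operation takes one step. *)

Inductive nexpr :=
| NConst of nat
| NGet of nat & nexpr          (* array name, index *)
| NAdd of nexpr & nexpr
| NSub of nexpr & nexpr.

Inductive rexpr :=
| RGet of nat & nexpr          (* array name, index *)
| RAdd of rexpr & rexpr
| RSub of rexpr & rexpr
| RAbs of rexpr.

Inductive bexpr :=
| BNatLe of nexpr & nexpr
| BRealLe of rexpr & rexpr
| BNot of bexpr
| BAnd of bexpr & bexpr.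

Inductive program :=
| Skip
| NSet of nat & nexpr & nexpr  (* array name, index, value *)
| RSet of nat & nexpr & rexpr  (* array name, index, value *)
| Seq of program & program
| If of bexpr & program & program
| While of bexpr & program.

Record state (R : realType) := State {
  nmem : nat -> nat -> nat;
  rmem : nat -> nat -> R
}.

Fixpoint neval (R : realType) (s : state R) (e : nexpr) : nat :=
  match e with
  | NConst n => n
  | NGet a i => nmem s a (neval s i)
  | NAdd e1 e2 => (neval s e1 + neval s e2)%N
  | NSub e1 e2 => (neval s e1 - neval s e2)%N
  end.

Fixpoint reval (R : realType) (s : state R) (e : rexpr) : R :=
  match e with
  | RGet a i => rmem s a (neval s i)
  | RAdd e1 e2 => reval s e1 + reval s e2
  | RSub e1 e2 => reval s e1 - reval s e2
  | RAbs e1 => `|reval s e1|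
  end.

Fixpoint beval (R : realType) (s : state R) (b : bexpr) : bool :=
  match b with
  | BNatLe e1 e2 => (neval s e1 <= neval s e2)%N
  | BRealLe e1 e2 => reval s e1 <= reval s e2
  | BNot b1 => ~~ beval s b1
  | BAnd b1 b2 => beval s b1 && beval s b2
  end.

Fixpoint nsteps (e : nexpr) : nat :=
  match e with
  | NConst _ => 1
  | NGet _ i => (nsteps i).+1
  | NAdd e1 e2 | NSub e1 e2 => (nsteps e1 + nsteps e2).+1
  end.

Fixpoint rsteps (e : rexpr) : nat :=
  match e with
  | RGet _ i => (nsteps i).+1
  | RAdd e1 e2 | RSub e1 e2 => (rsteps e1 + rsteps e2).+1
  | RAbs e1 => (rsteps e1).+1
  end.

Fixpoint bsteps (b : bexpr) : nat :=
  match b with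
  | BNatLe e1 e2 => (nsteps e1 + nsteps e2).+1
  | BRealLe e1 e2 => (rsteps e1 + rsteps e2).+1
  | BNot b1 => (bsteps b1).+1
  | BAnd b1 b2 => (bsteps b1 + bsteps b2).+1
  end.

Definition update (A : Type) (m : nat -> nat -> A) (a i : nat) (v : A) :
    nat -> nat -> A :=
  fun b j => if (b == a) && (j == i) then v else m b j.

(* [exec P s t s']: from the state [s], the program [P] halts after exactly [t]
   steps in the state [s']. *)
Inductive exec (R : realType) : program -> state R -> nat -> state R -> Prop :=
| ExecSkip s : exec Skip s 1 s
| ExecNSet a i e s :
    exec (NSet a i e) s (nsteps i + nsteps e).+1
      (State (update (nmem s) a (neval s i) (neval s e)) (rmem s))
| ExecRSet a i e s :
    exec (RSet a i e) s (nsteps i + rsteps e).+1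
      (State (nmem s) (update (rmem s) a (neval s i) (reval s e)))
| ExecSeq P Q s t s1 t' s2 :
    exec P s t s1 -> exec Q s1 t' s2 -> exec (Seq P Q) s (t + t').+1 s2
| ExecIf b P Q s t s1 :
    exec (if beval s b then P else Q) s t s1 ->
    exec (If b P Q) s (bsteps b + t).+1 s1
| ExecWhileFalse b P s :
    ~~ beval s b -> exec (While b P) s (bsteps b).+1 s
| ExecWhileTrue b P s t s1 t' s2 :
    beval s b -> exec P s t s1 -> exec (While b P) s1 t' s2 ->
    exec (While b P) s (bsteps b + t + t').+1 s2.

(* An arbitrary numbering of the vertices: [v] has number [index v e]. *)
Definition numbering (R : realType) (T : merge_tree R) (e : seq T) : Prop :=
  uniq e /\ forall v : T, v \in e.

(* The root is encoded with itself as parent and with label [0]. *)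
Definition parent_array (R : realType) (T : merge_tree R) (e : seq T) :
    seq nat :=
  [seq index (if [pick p | edge T v p] is Some p then p else v) e | v <- e].

Definition label_array (R : realType) (T : merge_tree R) (e : seq T) : seq R :=
  [seq (if [pick p | edge T v p] is Some p then label T v p else 0) | v <- e].

(* The trees are given by their numbers of vertices, parent pointers and labels;
   all other cells hold [0]. *)
Definition input_state (R : realType) (T1 T2 : merge_tree R)
    (e1 : seq T1) (e2 : seq T2) : state R :=
  State
    (fun a i => nth 0%N (nth [::] [:: [:: nvertices T1]; [:: nvertices T2];
                                      parent_array e1; parent_array e2] a) i)
    (fun a i => nth 0 (nth [::] [:: label_array e1; label_array e2] a) i).

Definition output (R : realType) (s : state R) : R := rmem s 2 0.

(* Main.v *)
From Stdlib Require Import Permutation.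
Require Import Defs.
From mathcomp Require Import all_boot all_order all_algebra.
From mathcomp Require Import zify lra.
From mathcomp Require Import all_classical all_reals all_analysis.

(** An alignment of two trees cuts both back to subtrees containing their roots,
    suppresses the vertices with a single child and compares the labels of the
    isomorphic results; it costs the weight cut off plus the differences of labels.
    Alignments compose, and every edit operation is an alignment of the same cost,
    so an edit sequence costs at least as much as a cheapest alignment. Conversely,
    an alignment of binary trees is an edit sequence that deletes leaves, relabels,
    and inserts leaves.

    A cheapest alignment of two paths leading down to subtrees cuts off everything
    below the paths, or matches the branchings at their lower ends, or prolongs one
    of the paths into a child, cutting the sibling off. A path is given by its two
    ends, so that there are at most [|T1|^2 |T2|^2] pairs of paths; the table also
    has entries for pairs of vertices that are not the ends of a path, which are
    never used. The length of a path is the difference of the distances of its ends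
    from the root. *)

Set Implicit Arguments.
Unset Strict Implicit.
Unset Printing Implicit Defensive.

Import Order.TTheory GRing.Theory Num.Theory.

Local Open Scope ring_scope.

(** * Alignments *)

Section Alignment.

Variable R : realDomainType.

(** Even between binary trees an edit sequence may pass through vertices of any degree, so
    alignments live on trees of arbitrary degree. A tree carries the label of the edge above it; the
    root is given an edge of length [0]. The obstacle is composition: two alignments may keep
    different parts of the middle tree. A branch kept by one and cut by the other is paid for with
    its weight, and since the cost of an alignment bounds the change of weight, this payment also
    covers cutting the corresponding part of the third tree. Costs of alignments are upper bounds,
    so no cheapest one has to be exhibited: the recursion [bdist] lies below every cost of an
    alignment of two binary trees and is itself the cost of an edit sequence, whence the infimum is
    attained. The machine has neither recursion nor multiplication. Sorting the vertices by height
    replaces the former and tables of multiples the latter. All loops are bounded by the sizes of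
    the trees, so the exponents of the running time are the nesting depths of the loops, two for
    each tree. *)

Inductive rose := Rose of R & seq rose.

Fixpoint weight (t : rose) : R :=
  let: Rose l ts := t in l + foldr (fun t w => weight t + w) 0 ts.

Definition fweight (ts : seq rose) : R := foldr (fun t w => weight t + w) 0 ts.

Fixpoint rsize (t : rose) : nat :=
  let: Rose _ ts := t in (foldr (fun t n => rsize t + n) 0 ts).+1%N.

Definition fsize (ts : seq rose) : nat := foldr (fun t n => rsize t + n)%N 0%N ts.

Fixpoint nonneg_labels (t : rose) : bool :=
  let: Rose l ts := t in
  (0 <= l) && foldr (fun t b => nonneg_labels t && b) true ts.

Definition fnonneg (ts : seq rose) : bool :=
  foldr (fun t b => nonneg_labels t && b) true ts.

(** Every constructor accepts any larger [K], so weakening is built in. The two descents merge the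
    topmost edge with one edge below it, which suppresses the vertex between them, and cut off the
    siblings [rest]. [Permutation] makes the order of children irrelevant. *)
Inductive align : rose -> rose -> R -> Prop :=
| AlignMatch l ts l' ts' k K :
    falign ts ts' k -> `|l - l'| + k <= K -> align (Rose l ts) (Rose l' ts') K
| AlignDownL l ts m us rest t' k K :
    Permutation ts (Rose m us :: rest) -> align (Rose (l + m) us) t' k ->
    k + fweight rest <= K -> align (Rose l ts) t' K
| AlignDownR l ts m us rest t k K :
    Permutation ts (Rose m us :: rest) -> align t (Rose (l + m) us) k ->
    k + fweight rest <= K -> align t (Rose l ts) K
with falign : seq rose -> seq rose -> R -> Prop :=
| FalignNil ts' K : fweight ts' <= K -> falign [::] ts' K
| FalignDel t ts ts' k K :
    falign ts ts' k -> weight t + k <= K -> falign (t :: ts) ts' K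
| FalignMatch t ts ts' t' us a k K :
    Permutation ts' (t' :: us) -> align t t' a -> falign ts us k ->
    a + k <= K -> falign (t :: ts) ts' K.

Scheme align_mind := Induction for align Sort Prop
with falign_mind := Induction for falign Sort Prop.
Combined Scheme align_falign_ind from align_mind, falign_mind.

Lemma weightE l ts : weight (Rose l ts) = l + fweight ts.
Proof. by []. Qed.

Lemma fweight_perm ts us : Permutation ts us -> fweight ts = fweight us.
Proof.
elim=> //= [x s s' _ ->//|x y s|s1 s2 s3 _ -> _ -> //].
by rewrite addrCA.
Qed.

Lemma fsize_perm ts us : Permutation ts us -> fsize ts = fsize us.
Proof.
elim=> //= [x s s' _ ->//|x y s|s1 s2 s3 _ -> _ -> //].
by rewrite addnCA.
Qed.

Lemma fnonneg_perm ts us : Permutation ts us -> fnonneg ts = fnonneg us.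
Proof.
elim=> //= [x s s' _ ->//|x y s|s1 s2 s3 _ -> _ -> //].
by rewrite andbCA.
Qed.

(** Trees nest lists of trees, so trees and forests are treated together by induction on a bound for
    the size. *)
Lemma weight_fweight_ge0 n :
  (forall t, (rsize t < n)%N -> nonneg_labels t -> 0 <= weight t) /\
  (forall ts, (fsize ts < n)%N -> fnonneg ts -> 0 <= fweight ts).
Proof.
elim: n => [//|n [IHt IHf]]; split.
  case=> l ts /= sz /andP[l0 nn].
  by apply: addr_ge0 => //; apply: IHf.
suff H ts : (fsize ts < n.+1)%N ->
    (forall t, List.In t ts -> (rsize t < n.+1)%N) -> fnonneg ts -> 0 <= fweight ts.
  move=> ts sz; apply: H => // t.
  elim: ts sz => //= u us IH sz [<-|/IH]; first by lia.
  by apply; lia.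
move=> _; elim: ts => //= t ts IH sz /andP[nt nts]; apply: addr_ge0; last first.
  by apply: IH => // u uts; apply: sz; right.
case: t nt {IH} sz => l us /andP[l0 nus] sz.
have szu : (fsize us < n)%N := sz (Rose l us) (or_introl erefl).
by rewrite weightE addr_ge0 // IHf.
Qed.

Lemma fweight_ge0 ts : fnonneg ts -> 0 <= fweight ts.
Proof. by move=> nt; case: (weight_fweight_ge0 (fsize ts).+1) => _; apply. Qed.

Lemma align_weaken t s k K : align t s k -> k <= K -> align t s K.
Proof.
case=> [l ts l' ts' k1 K1 h le|l ts m us rest t' k1 K1 p h le|l ts m us rest t' k1 K1 p h le] leK.
- by apply: AlignMatch h _; apply: le_trans leK.
- by apply: AlignDownL p h _; apply: le_trans leK.
- by apply: AlignDownR p h _; apply: le_trans leK.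
Qed.

Lemma falign_weaken t s k K : falign t s k -> k <= K -> falign t s K.
Proof.
case=> [ts' k1 le|{}t ts ts' k1 K1 h le|{}t ts ts' t' us a k1 K1 p ha h le] leK.
- by apply: FalignNil; apply: le_trans leK.
- by apply: FalignDel h _; apply: le_trans leK.
- by apply: FalignMatch p ha h _; apply: le_trans leK.
Qed.

Lemma falign_permr ts us vs k :
  falign ts us k -> Permutation us vs -> falign ts vs k.
Proof.
move=> h; elim: h vs => {ts us k}
  [ts' K le|t ts ts' k K _ IH le|t ts ts' t' us a k K p ha h _ le] vs pv.
- by apply: FalignNil; rewrite -(fweight_perm pv).
- by apply: FalignDel (IH _ pv) le.
- apply: FalignMatch ha h le.
  by apply: Permutation_trans p; apply: Permutation_sym.
Qed.

Lemma falign_consP t ts us K : falign (t :: ts) us K ->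
  (exists2 k, falign ts us k & weight t + k <= K) \/
  (exists t' vs a k, [/\ Permutation us (t' :: vs), align t t' a,
     falign ts vs k & a + k <= K]).
Proof.
move e: (t :: ts) => s h; case: h e => //.
- by move=> t1 ts1 ts' k K1 h le [-> ->]; left; exists k.
- by move=> t1 ts1 ts' t' vs a k K1 p ha h le [-> ->]; right; exists t', vs, a, k.
Qed.

(** For two swapped heads the decisions to delete or to match are exchanged; if both are matched,
    their partners on the right are swapped as well. *)
Lemma falign_perml ts us vs k :
  falign ts vs k -> Permutation ts us -> falign us vs k.
Proof.
move=> h p; elim: p vs k h => {ts us}
  [//|x s s' _ IH|x y s|s1 s2 s3 _ IH1 _ IH2] vs k; last by move=> /IH1/IH2.
- case/falign_consP=> [[k1 /IH h le]|[t' [ws [a [k1 [p ha /IH h le]]]]]].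
    exact: FalignDel h le.
  exact: FalignMatch p ha h le.
- case/falign_consP=> [[k1 /falign_consP H le]|[t' [ws [a [k1 [p ha /falign_consP H le]]]]]].
    case: H => [[k2 h le2]|[u [ws [a [k2 [p ha h le2]]]]]].
      apply: (@FalignDel _ _ _ (weight y + k2)); first exact: FalignDel h _.
      by lra.
    apply: (@FalignMatch _ _ _ u ws a (weight y + k2)) => //; last by lra.
    exact: FalignDel h _.
  case: H => [[k2 h le2]|[u [ws2 [a2 [k2 [p2 ha2 h le2]]]]]].
    apply: (@FalignDel _ _ _ (a + k2)); first exact: FalignMatch p ha h _.
    by lra.
  apply: (@FalignMatch _ _ _ u (t' :: ws2) a2 (a + k2)) => //; last by lra.
    apply: Permutation_trans p _.
    apply: Permutation_trans (perm_skip t' p2) _.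
    exact: perm_swap.
  exact: (@FalignMatch _ _ _ t' ws2 a k2).
Qed.

Lemma falign_ins ts us t k : falign ts us k -> falign ts (t :: us) (weight t + k).
Proof.
move=> h; elim: h => {ts us k}
  [us K le|s ts us k K _ IH le|s ts ts' t' us a k K p ha h IH le].
- by apply: FalignNil => /=; rewrite lerD2l.
- by apply: FalignDel IH _; lra.
- apply: FalignMatch ha IH _; last by lra.
  by apply: Permutation_trans (perm_swap _ _ _); apply: perm_skip.
Qed.

(** Forest alignments recurse on the left list only. Deletion on the right, the mirror image of
    [FalignDel], is supplied by [falign_ins]. *)
Lemma align_falign_sym :
  (forall t s k, align t s k -> align s t k) /\
  (forall ts us k, falign ts us k -> falign us ts k).
Proof.
suff H : (forall t s k, align t s k -> align s t k) /\
         (forall ts us k, falign ts us k -> falign us ts k) by [].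
apply: (align_falign_ind (P := fun t s k _ => align s t k)
                         (P0 := fun ts us k _ => falign us ts k)).
- by move=> l ts l' ts' k K _ IH le; apply: AlignMatch IH _; rewrite distrC.
- by move=> l ts m us rest t' k K p _ IH le; apply: AlignDownR p IH le.
- by move=> l ts m us rest t' k K p _ IH le; apply: AlignDownL p IH le.
- move=> ts' K; elim: ts' K => [|t ts IH] K /= le; first exact: FalignNil.
  by apply: FalignDel le; apply: IH.
- by move=> t ts ts' k K _ IH le; apply: falign_weaken (falign_ins t IH) le.
- move=> t ts ts' t' us a k K p _ ha _ h le.
  apply: falign_perml (Permutation_sym p).
  by apply: FalignMatch ha h le.
Qed.

Lemma align_sym t s k : align t s k -> align s t k.
Proof. by case: align_falign_sym => H _; apply: H. Qed.

Lemma falign_sym ts us k : falign ts us k -> falign us ts k.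
Proof. by case: align_falign_sym => _; apply. Qed.

(** Descents only lengthen the topmost edges, so the added lengths [x] and [y] survive until these
    edges are matched, and the triangle inequality is needed only there. *)
Lemma align_shift l ts l' us k x y : align (Rose l ts) (Rose l' us) k ->
  align (Rose (x + l) ts) (Rose (y + l') us) (`|x - y| + k).
Proof.
move et : (Rose l ts) => t; move eu : (Rose l' us) => u h.
elim: h l ts l' us x y et eu => {t u k}
  [l ts l' us k K h le|l ts m us rest t' k K p _ IH le|l ts m us rest t' k K p _ IH le]
  l1 ts1 l1' us1 x y.
- case=> -> -> [-> ->]; apply: AlignMatch h _.
  have -> : x + l - (y + l') = (x - y) + (l - l') by lra.
  by have := ler_normD (x - y) (l - l'); lra.
- case=> -> -> eu; apply: AlignDownL p _ _.
    by rewrite -addrA; apply: (IH _ _ _ _ x y erefl eu).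
  by lra.
- move=> et [-> ->]; apply: AlignDownR p _ _.
    by rewrite -addrA; apply: (IH _ _ _ _ x y et erefl).
  by lra.
Qed.

(** * Weights, cuts and composition of alignments *)

Lemma nonneg_down l ts m us rest : Permutation ts (Rose m us :: rest) ->
  nonneg_labels (Rose l ts) ->
  [/\ 0 <= l, 0 <= m, nonneg_labels (Rose (l + m) us) & fnonneg rest].
Proof.
move=> p /= /andP[l0]; rewrite -/(fnonneg ts) (fnonneg_perm p) /=.
by move=> /andP[/andP[m0 us0] rest0]; split=> //; rewrite addr_ge0.
Qed.

(** What is kept changes by its differences of labels, and what is cut is paid for with its
    weight. *)
Lemma align_falign_weight :
  (forall t s k, align t s k -> nonneg_labels s -> weight t <= weight s + k) /\
  (forall ts us k, falign ts us k -> fnonneg us -> fweight ts <= fweight us + k).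
Proof.
apply: (align_falign_ind
  (P := fun t s k _ => nonneg_labels s -> weight t <= weight s + k)
  (P0 := fun ts us k _ => fnonneg us -> fweight ts <= fweight us + k)).
- move=> l ts l' ts' k K _ IH le /= /andP[l0 nn].
  have := IH nn; rewrite -!/(fweight _); have := ler_norm (l - l'); lra.
- move=> l ts m us rest t' k K p _ IH le nn.
  by have := IH nn; rewrite !weightE (fweight_perm p) /= -/(fweight us); lra.
- move=> l ts m us rest t k K p _ IH le nn.
  have [l0 m0 nus nrest] := nonneg_down p nn.
  have := IH nus; rewrite !weightE (fweight_perm p) /= -/(fweight us).
  by have := fweight_ge0 nrest; lra.
- by move=> ts' K le nn; have := fweight_ge0 nn; rewrite /=; lra.
- by move=> t ts ts' k K _ IH le nn; have := IH nn; rewrite /=; lra.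
- move=> t ts ts' t' us a k K p _ IHt _ IH le.
  rewrite (fnonneg_perm p) (fweight_perm p) /= => /andP[/IHt w1 /IH w2]; lra.
Qed.

Lemma align_weight t s k :
  align t s k -> nonneg_labels s -> weight t <= weight s + k.
Proof. by case: align_falign_weight => H _; apply: H. Qed.

Lemma falign_weight ts us k :
  falign ts us k -> fnonneg us -> fweight ts <= fweight us + k.
Proof. by case: align_falign_weight => _; apply. Qed.

Lemma falign_del_all ts : falign ts [::] (fweight ts).
Proof. by apply: falign_sym; apply: FalignNil. Qed.

(** Cuts the right tree back to its topmost edge. If the alignment follows a path into a child with
    edge [m], the path is shortened again at cost [m], which is part of the weight being cut off. If
    it matches the topmost edges, the forest on the left is deleted, and its weight is bounded by
    [falign_weight]. *)
Lemma align_cut t l us k : align t (Rose l us) k ->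
  nonneg_labels (Rose l us) -> align t (Rose l [::]) (k + fweight us).
Proof.
move es : (Rose l us) => s h.
elim: h l us es => {t s k}
  [l ts l' us k K h le|l ts m us rest t' k K p _ IH le|l ts m us rest t k K p h IH le]
  l1 us1.
- case=> -> -> /andP[l0 nn]; apply: AlignMatch (falign_del_all ts) _.
  by have := falign_weight h nn; lra.
- move=> es nn; apply: AlignDownL p (IH _ _ es nn) _; lra.
- case=> -> -> nn; have [l0 m0 nus nrest] := nonneg_down p nn.
  have := IH _ _ erefl nus.
  case: t {h IH} => a ts1 /(align_shift 0 (- m)).
  rewrite add0r (_ : - m + (l + m) = l); last by lra.
  move=> h; apply: align_weaken h _.
  rewrite sub0r opprK ger0_norm // (fweight_perm p) /= -/(fweight us).
  by have := fweight_ge0 nrest; lra.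
Qed.

Lemma falign_nilP us K : falign [::] us K -> fweight us <= K.
Proof. by move e: [::] => s h; case: h e. Qed.

(** A tree whose partner in the middle forest is deleted by the second alignment is deleted at once:
    its weight is at most that of the partner plus the cost of their alignment. *)
Lemma falign_trans_aux n :
  (forall t s u k k', (rsize t + rsize s + rsize u < n)%N -> nonneg_labels t ->
     nonneg_labels s -> nonneg_labels u ->
     align t s k -> align s u k' -> align t u (k + k')) ->
  forall ts ss us k k', (fsize ts + fsize ss + fsize us < n)%N ->
     fnonneg ts -> fnonneg ss -> fnonneg us ->
     falign ts ss k -> falign ss us k' -> falign ts us (k + k').
Proof.
move=> IHn; elim=> [|t ts IH] ss us k k' sz nts nss nus.
  move/falign_nilP => h1 /falign_sym h2; apply: FalignNil.
  by have := falign_weight h2 nss; lra.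
case/andP: nts => nt nts.
case/falign_consP=> [[k1 h1 le1]|[s [ss' [a [k1 [p ha h1 le1]]]]]] h2.
  have h := IH _ _ _ _ _ nts nss nus h1 h2.
  apply: FalignDel (h _) _; last by lra.
  by move: sz => /=; lia.
move: sz nss; rewrite (fsize_perm p) (fnonneg_perm p) /= => sz /andP[ns nss'].
have := falign_perml h2 p.
case/falign_consP=> [[k2 h3 le2]|[u [us' [b [k2 [q hb h3 le2]]]]]].
  apply: FalignDel (IH _ _ _ _ _ nts nss' nus h1 h3) _; first by lia.
  by have := align_weight ha ns; lra.
move: nus sz; rewrite (fnonneg_perm q) (fsize_perm q) /= => /andP[nu nus'] sz.
apply: FalignMatch q (IHn _ _ _ _ _ _ nt ns nu ha hb) (IH _ _ _ _ _ nts nss' nus' h1 h3) _.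
- by lia.
- by lia.
- by lra.
Qed.

Lemma permutation_cons2 (x y : rose) s s' : Permutation (x :: s) (y :: s') ->
  (x = y /\ Permutation s s') \/
  exists s'', Permutation s (y :: s'') /\ Permutation s' (x :: s'').
Proof.
move=> p; have : List.In y (x :: s).
  by apply: (Permutation_in _ (Permutation_sym p)); left.
case=> [exy|ys].
  by left; split=> //; move: p; rewrite exy; apply: Permutation_cons_inv.
right; have [s1 [s2 es]] := List.in_split _ _ ys; exists (s1 ++ s2).
have ps : Permutation s (y :: (s1 ++ s2)).
  by rewrite es; apply: Permutation_sym; apply: Permutation_middle.
split=> //.
apply: (Permutation_cons_inv (a := y)).
apply: Permutation_trans (Permutation_sym p) _.
apply: Permutation_trans (perm_skip x ps) _.
exact: perm_swap.
Qed.

Lemma fsize_down l ts m us rest : Permutation ts (Rose m us :: rest) ->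
  (rsize (Rose (l + m) us) < rsize (Rose l ts))%N.
Proof. by move=> p /=; rewrite -!/(fsize _) (fsize_perm p) /= -!/(fsize _); lia. Qed.


Lemma alignP l ts l' us K : align (Rose l ts) (Rose l' us) K ->
  [\/ exists2 k, falign ts us k & `|l - l'| + k <= K,
      exists m vs rest k, [/\ Permutation ts (Rose m vs :: rest),
        align (Rose (l + m) vs) (Rose l' us) k & k + fweight rest <= K]
    | exists m vs rest k, [/\ Permutation us (Rose m vs :: rest),
        align (Rose l ts) (Rose (l' + m) vs) k & k + fweight rest <= K]].
Proof.
move et : (Rose l ts) => t; move eu : (Rose l' us) => u h.
case: h et eu => {t u K}.
- by move=> l1 ts1 l1' ts1' k K h le [-> ->] [-> ->]; constructor 1; exists k.
- move=> l1 ts1 m vs rest t1 k K p h le [el et] eu; subst.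
  by constructor 2; exists m, vs, rest, k.
- move=> l1 ts1 m vs rest t1 k K p h le et [el eu]; subst.
  by constructor 3; exists m, vs, rest, k.
Qed.

Definition align_trans_upto n := forall t s u k k',
  (rsize t + rsize s + rsize u < n)%N -> nonneg_labels t ->
  nonneg_labels s -> nonneg_labels u ->
  align t s k -> align s u k' -> align t u (k + k').

(* If the two alignments descend into different children of the middle tree, both
   sides are compared with its topmost edge. *)
Lemma align_trans_cut n t u l us vs k k' : align_trans_upto n ->
  (rsize t + 1 + rsize u < n)%N -> nonneg_labels t -> nonneg_labels u ->
  nonneg_labels (Rose l us) -> nonneg_labels (Rose l vs) ->
  align t (Rose l us) k -> align (Rose l vs) u k' ->
  align t u ((k + fweight us) + (k' + fweight vs)).
Proof.
move=> IHn sz nt nu n1 n2 a1 a2.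
apply: (IHn t (Rose l [::]) u) => //.
- by case/andP: n1 => /= ->.
- exact: align_cut a1 n1.
- by apply: align_sym; apply: align_cut n2; apply: align_sym.
Qed.

(** The left alignment follows a path into a child of the middle tree, while the right one matches
    the topmost edge above it. If that child has a partner on the right, the path continues into the
    partner. If the child is deleted, the weight paid for it suffices to cut back to the topmost
    edge on the left; inserting all of [us] afterwards is paid for by the siblings [rest] and their
    alignment. *)
Lemma align_trans_down_match n t l' ts' l'' us m vs rest k k' : align_trans_upto n ->
  (rsize t + rsize (Rose l' ts') + rsize (Rose l'' us) <= n)%N ->
  nonneg_labels t -> nonneg_labels (Rose l' ts') -> nonneg_labels (Rose l'' us) ->
  Permutation ts' (Rose m vs :: rest) -> align t (Rose (l' + m) vs) k ->
  falign ts' us k' ->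
  align t (Rose l'' us) (k + fweight rest + (`|l' - l''| + k')).
Proof.
move=> IHn sz nt ns nu p h1 h2.
have [l0 m0 nvs nrest] := nonneg_down p ns.
have := falign_perml h2 p.
case/falign_consP=> [[k1 h3 le1]|[[m' us'] [us'' [a [k1 [q ha h3 le1]]]]]].
- have hcut : align t (Rose l' [::]) (k + weight (Rose m vs)).
    have := align_cut h1 nvs.
    case: t {h1 sz nt} => lt ts /(align_shift 0 (- m)).
    rewrite add0r (_ : - m + (l' + m) = l'); last by lra.
    move=> h; apply: align_weaken h _.
    by rewrite sub0r opprK ger0_norm // weightE; lra.
  have h4 : align (Rose l' [::]) (Rose l'' us) (`|l' - l''| + fweight us).
    by apply: (@AlignMatch _ _ _ _ (fweight us)) => //; apply: FalignNil.
  apply: align_weaken (IHn _ _ _ _ _ _ nt _ nu hcut h4) _.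
  + by move: sz => /=; rewrite -!/(fsize _) (fsize_perm p) /=; lia.
  + by rewrite /= l0.
  + case/andP: nu => _ nus; have := falign_weight (falign_sym h3) nrest.
    by lra.
- have [_ m'0 nus' nus''] := nonneg_down q nu.
  have ha' := align_shift l' l'' ha.
  apply: (AlignDownR q (IHn _ _ _ _ _ _ nt nvs nus' h1 ha')).
  + by move: (fsize_down l' p) (fsize_down l'' q) sz; clear; lia.
  + by have := falign_weight (falign_sym h3) nrest; lra.
Qed.

(** Induction on the total size. A descent in an outer tree does not concern the middle tree and is
    passed to the induction hypothesis; the other cases combine matching and descending in the
    middle tree. *)
Lemma align_trans_size n : align_trans_upto n.
Proof.
elim: n => [//|n IHn] [l ts] [l' ts'] [l'' us] k k' sz nt ns nu h1 h2.
case: (alignP h1) => [[k1 f1 le1]|[m [vs [rest [k1 [p a1 le1]]]]]|[m [vs [rest [k1 [p a1 le1]]]]]].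
- case: (alignP h2) => [[k2 f2 le2]|[m' [vs' [rest' [k2 [q a2 le2]]]]]|[m' [vs' [rest' [k2 [q a2 le2]]]]]].
  + case/andP: nt => l0 nts; case/andP: ns => l'0 nts'; case/andP: nu => l''0 nus.
    apply: AlignMatch (falign_trans_aux IHn _ nts nts' nus f1 f2) _.
      by move: sz => /=; rewrite -!/(fsize _); lia.
    have -> : l - l'' = (l - l') + (l' - l'') by lra.
    by have := ler_normD (l - l') (l' - l''); lra.
  + apply: align_sym.
    have := align_trans_down_match IHn _ nu ns nt q (align_sym a2) (falign_sym f1).
    move=> h; apply: align_weaken (h _) _; first by lia.
    by rewrite distrC; lra.
  + have [_ _ nvs' _] := nonneg_down q nu.
    apply: (AlignDownR q (IHn _ _ _ _ _ _ nt ns nvs' h1 a2)); last by lra.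
    by move: (fsize_down l'' q) sz; clear; lia.
- have [_ _ nvs _] := nonneg_down p nt.
  apply: (AlignDownL p (IHn _ _ _ _ _ _ nvs ns nu a1 h2)); last by lra.
  by move: (fsize_down l p) sz; clear; lia.
case: (alignP h2) => [[k2 f2 le2]|[m' [vs' [rest' [k2 [q a2 le2]]]]]|[m' [vs' [rest' [k2 [q a2 le2]]]]]].
- apply: align_weaken (align_trans_down_match IHn _ nt ns nu p a1 f2) _; first by lia.
  by lra.
- have [l'0 m0 nvs nrest] := nonneg_down p ns.
  have [_ m'0 nvs' nrest'] := nonneg_down q ns.
  have := Permutation_trans (Permutation_sym p) q.
  case/permutation_cons2 => [[[em evs] pr]|[r [pr pr']]].
    rewrite -em -evs in a2.
    apply: align_weaken (IHn _ _ _ _ _ _ nt nvs nu a1 a2) _.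
      by move: (fsize_down l' p) sz; clear; lia.
    by have := fweight_ge0 nrest; have := fweight_ge0 nrest'; lra.
  (* The paths enter different children: both are drawn back to the topmost edge of the middle tree,
     at costs [m] and [m']. Both branches are then cut, and each has been paid for among the
     siblings cut by the other alignment. *)
  have b1 : align (Rose l ts) (Rose l' vs) (k1 + m).
    have := align_shift 0 (- m) a1.
    rewrite add0r (_ : - m + (l' + m) = l'); last by lra.
    by rewrite sub0r opprK ger0_norm // addrC.
  have b2 : align (Rose l' vs') (Rose l'' us) (k2 + m').
    have := align_shift (- m') 0 a2.
    rewrite add0r (_ : - m' + (l' + m') = l'); last by lra.
    by rewrite subr0 normrN ger0_norm // addrC.
  have nr : fnonneg r by move: nrest; rewrite (fnonneg_perm pr) => /andP[].
  apply: align_weaken (align_trans_cut IHn _ nt nu _ _ b1 b2) _.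
  + by move: sz => /=; rewrite -!/(fsize _) (fsize_perm p) /=; clear; lia.
  + by rewrite /= l'0; case/andP: nvs.
  + by rewrite /= l'0; case/andP: nvs'.
  + move: le1 le2; rewrite (fweight_perm pr) (fweight_perm pr') /= -!/(fweight _).
    by have := fweight_ge0 nr; lra.
- have [_ _ nvs' _] := nonneg_down q nu.
  apply: (AlignDownR q (IHn _ _ _ _ _ _ nt ns nvs' h1 a2)); last by lra.
  by move: (fsize_down l'' q) sz; clear; lia.
Qed.

Lemma align_trans s t u k k' : nonneg_labels t -> nonneg_labels s ->
  nonneg_labels u -> align t s k -> align s u k' -> align t u (k + k').
Proof. exact: (align_trans_size (ltnSn _)). Qed.

End Alignment.

(** * Binary trees *)

Section BinaryTrees.

Variable R : realDomainType.

(** The numbers name the vertices for the sake of edit operations; weights, alignments and [bdist]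
    ignore them. The real is the length of the edge above the vertex. *)
Inductive btree :=
| Lf of nat & R
| Br of nat & R & btree & btree.

Definition top_id (b : btree) : nat :=
  match b with Lf i _ => i | Br i _ _ _ => i end.

Definition top_len (b : btree) : R :=
  match b with Lf _ l => l | Br _ l _ _ => l end.

Definition set_len (l : R) (b : btree) : btree :=
  match b with Lf i _ => Lf i l | Br i _ a c => Br i l a c end.

Fixpoint bweight (b : btree) : R :=
  match b with
  | Lf _ l => l
  | Br _ l a c => l + (bweight a + bweight c)
  end.

Definition below (b : btree) : R :=
  match b with Lf _ _ => 0 | Br _ _ a c => bweight a + bweight c end.

Fixpoint rose_of (b : btree) : rose R :=
  match b with
  | Lf _ l => Rose l [::]
  | Br _ l a c => Rose l [:: rose_of a; rose_of c]
  end.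

Definition kids (b : btree) : seq (rose R) :=
  match b with Lf _ _ => [::] | Br _ _ a c => [:: rose_of a; rose_of c] end.

Fixpoint positive (b : btree) : bool :=
  match b with
  | Lf _ l => 0 < l
  | Br _ l a c => [&& 0 < l, positive a & positive c]
  end.

Lemma bweightE b : bweight b = top_len b + below b.
Proof. by case: b => //= i l; rewrite addr0. Qed.

Lemma rose_ofE b : rose_of b = Rose (top_len b) (kids b).
Proof. by case: b. Qed.

Lemma weight_rose_of b : weight (rose_of b) = bweight b.
Proof. by elim: b => [i l|i l a IHa c IHc] /=; rewrite ?addr0 ?IHa ?IHc. Qed.

Lemma fweight_kids b : fweight (kids b) = below b.
Proof. by case: b => //= i l a c; rewrite !weight_rose_of addr0. Qed.

(* The topmost edges of [a] and [b] are given the lengths [la] and [lb] in place of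
   their own; [bdist_step] is one unfolding of the recursion. *)
Fixpoint bdist (a : btree) : btree -> R -> R -> R :=
  fix bdist_a (b : btree) : R -> R -> R := fun la lb =>
  let c0 := `|la - lb| + (below a + below b) in
  let c1 :=
    match a with
    | Lf _ _ => c0
    | Br _ _ a0 a1 =>
      Num.min (bdist a1 b (la + top_len a1) lb + bweight a0)
        (Num.min (bdist a0 b (la + top_len a0) lb + bweight a1) c0)
    end in
  let c2 :=
    match b with
    | Lf _ _ => c1
    | Br _ _ b0 b1 =>
      Num.min (bdist_a b1 la (lb + top_len b1) + bweight b0)
        (Num.min (bdist_a b0 la (lb + top_len b0) + bweight b1) c1)
    end in
  match a, b with
  | Br _ _ a0 a1, Br _ _ b0 b1 =>
    Num.min (`|la - lb| + (bdist a0 b1 (top_len a0) (top_len b1) +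
                           bdist a1 b0 (top_len a1) (top_len b0)))
      (Num.min (`|la - lb| + (bdist a0 b0 (top_len a0) (top_len b0) +
                              bdist a1 b1 (top_len a1) (top_len b1))) c2)
  | _, _ => c2
  end.

Definition bdist_step (rec : btree -> btree -> R -> R -> R) (a b : btree) (la lb : R) :=
  let c0 := `|la - lb| + (below a + below b) in
  let c1 :=
    match a with
    | Lf _ _ => c0
    | Br _ _ a0 a1 =>
      Num.min (rec a1 b (la + top_len a1) lb + bweight a0)
        (Num.min (rec a0 b (la + top_len a0) lb + bweight a1) c0)
    end in
  let c2 :=
    match b with
    | Lf _ _ => c1
    | Br _ _ b0 b1 =>
      Num.min (rec a b1 la (lb + top_len b1) + bweight b0)
        (Num.min (rec a b0 la (lb + top_len b0) + bweight b1) c1)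
    end in
  match a, b with
  | Br _ _ a0 a1, Br _ _ b0 b1 =>
    Num.min (`|la - lb| + (rec a0 b1 (top_len a0) (top_len b1) +
                           rec a1 b0 (top_len a1) (top_len b0)))
      (Num.min (`|la - lb| + (rec a0 b0 (top_len a0) (top_len b0) +
                              rec a1 b1 (top_len a1) (top_len b1))) c2)
  | _, _ => c2
  end.

Lemma bdistE a b la lb : bdist a b la lb = bdist_step bdist a b la lb.
Proof. by case: a b => [? ?|? ? ? ?] [? ?|? ? ? ?]. Qed.

Arguments bdist : simpl never.

Lemma bdist_base a b la lb : bdist a b la lb <= `|la - lb| + (below a + below b).
Proof.
by rewrite bdistE; case: a b => [? ?|? ? ? ?] [? ?|? ? ? ?] //=;
  rewrite !ge_min lexx !orbT.
Qed.

Lemma bdist_downl i l a0 a1 b la lb :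
  bdist (Br i l a0 a1) b la lb <= bdist a0 b (la + top_len a0) lb + bweight a1 /\
  bdist (Br i l a0 a1) b la lb <= bdist a1 b (la + top_len a1) lb + bweight a0.
Proof.
by split; rewrite bdistE; case: b => [? ?|? ? ? ?] /=;
  rewrite !ge_min lexx ?orbT.
Qed.

Lemma bdist_downr i l b0 b1 a la lb :
  bdist a (Br i l b0 b1) la lb <= bdist a b0 la (lb + top_len b0) + bweight b1 /\
  bdist a (Br i l b0 b1) la lb <= bdist a b1 la (lb + top_len b1) + bweight b0.
Proof.
by split; rewrite bdistE; case: a => [? ?|? ? ? ?] /=;
  rewrite !ge_min lexx ?orbT.
Qed.

Lemma bdist_match i l a0 a1 j l' b0 b1 la lb :
  bdist (Br i l a0 a1) (Br j l' b0 b1) la lb <=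
    `|la - lb| + (bdist a0 b0 (top_len a0) (top_len b0) +
                  bdist a1 b1 (top_len a1) (top_len b1)) /\
  bdist (Br i l a0 a1) (Br j l' b0 b1) la lb <=
    `|la - lb| + (bdist a0 b1 (top_len a0) (top_len b1) +
                  bdist a1 b0 (top_len a1) (top_len b0)).
Proof. by split; rewrite bdistE /= !ge_min lexx ?orbT. Qed.

Lemma permutation_pair (x y z : rose R) rest : Permutation [:: x; y] (z :: rest) ->
  (z = x /\ rest = [:: y]) \/ (z = y /\ rest = [:: x]).
Proof.
by move=> p; case: (Permutation_length_2_inv p) => [[-> ->]|[-> ->]]; [left|right].
Qed.

Lemma permutation_single (x z : rose R) rest : Permutation [:: x] (z :: rest) ->
  z = x /\ rest = [::].
Proof. by move=> p; case: (Permutation_length_1_inv p) => -> ->. Qed.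

Lemma permutation_none (z : rose R) rest : ~ Permutation [::] (z :: rest).
Proof. by move=> p; apply: (Permutation_nil_cons p). Qed.

(** Descents are candidates of the minimum, and so is a matching in which both pairs of children are
    kept. If it keeps no pair, [bdist_base] applies. If it keeps a single pair, the matched vertices
    have one child left each, and prolonging both paths into these children costs no more by
    [align_shift]. *)
Lemma bdist_le_align a b la lb k :
  align (Rose la (kids a)) (Rose lb (kids b)) k -> bdist a b la lb <= k.
Proof.
elim: a b la lb k => [i l|i l a0 IH0 a1 IH1].
  elim=> [j l'|j l' b0 IHb0 b1 IHb1] la lb k h.
    apply: le_trans (bdist_base _ _ _ _) _ => /=.
    case: (alignP h) => [[k1 /falign_nilP /= f le]|[m [vs [rest [k1 []]]]]|[m [vs [rest [k1 []]]]]].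
    - lra.
    - by move/permutation_none.
    - by move/permutation_none.
  case: (alignP h) => [[k1 /falign_nilP f le]|[m [vs [rest [k1 []]]]]|[m [vs [rest [k1 []]]]]].
  - apply: le_trans (bdist_base _ _ _ _) _.
    by rewrite -!fweight_kids; move: f => /=; lra.
  - by move/permutation_none.
  - have [H0 H1] := bdist_downr j l' b0 b1 (Lf i l) la lb.
    move/permutation_pair => [] [e ->]; rewrite rose_ofE in e;
      case: e => -> -> /=; rewrite weight_rose_of addr0.
    + by move=> /IHb0; lra.
    + by move=> /IHb1; lra.
elim=> [j l'|j l' b0 IHb0 b1 IHb1] la lb k h.
  have [H0 H1] := bdist_downl i l a0 a1 (Lf j l') la lb.
  case: (alignP h) => [[k1 /falign_sym/falign_nilP f le]|[m [vs [rest [k1 []]]]]|[m [vs [rest [k1 []]]]]].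
  - apply: le_trans (bdist_base _ _ _ _) _.
    by rewrite -!fweight_kids; move: f => /=; lra.
  - move/permutation_pair => [] [e ->]; rewrite rose_ofE in e;
      case: e => -> -> /=; rewrite weight_rose_of addr0.
    + by move=> /(IH0 (Lf j l')); lra.
    + by move=> /(IH1 (Lf j l')); lra.
  - by move/permutation_none.
have [H0 H1] := bdist_downl i l a0 a1 (Br j l' b0 b1) la lb.
case: (alignP h) => [[k1 f le]|[m [vs [rest [k1 []]]]]|[m [vs [rest [k1 []]]]]].
- have [G0 G1] := bdist_match i l a0 a1 j l' b0 b1 la lb.
  have single a b x : (forall la lb k, align (Rose la (kids a)) (Rose lb (kids b)) k ->
      bdist a b la lb <= k) -> align (rose_of a) (rose_of b) x ->
      bdist a b (la + top_len a) (lb + top_len b) <= `|la - lb| + x.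
    by move=> IH; rewrite !rose_ofE => /(align_shift la lb)/IH.
  have nested a b x : (forall la lb k, align (Rose la (kids a)) (Rose lb (kids b)) k ->
      bdist a b la lb <= k) -> align (rose_of a) (rose_of b) x ->
      bdist a b (top_len a) (top_len b) <= x.
    by move=> IH; rewrite !rose_ofE => /IH.
  case/falign_consP: f => [[k2 f le2]|[t' [us [a [k2 [p ha f le2]]]]]].
    case/falign_consP: f => [[k3 /falign_nilP f le3]|[t' [us [a [k3 [p ha /falign_nilP f le3]]]]]].
      apply: le_trans (bdist_base _ _ _ _) _.
      by move: f le3 le2; rewrite /= !weight_rose_of; lra.
    have [D0 D1] := bdist_downr j l' b0 b1 a1 (la + top_len a1) lb.
    move/permutation_pair: p => [] [e1 e2]; subst t' us; move: f le2 le3;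
      rewrite /= !weight_rose_of.
    + by have := single _ _ _ (IH1 b0) ha; lra.
    + by have := single _ _ _ (IH1 b1) ha; lra.
  case/falign_consP: f => [[k3 /falign_nilP f le3]|[t'' [us' [a' [k3 [p' ha' /falign_nilP f le3]]]]]].
    have [D0 D1] := bdist_downr j l' b0 b1 a0 (la + top_len a0) lb.
    move/permutation_pair: p => [] [e1 e2]; subst t' us; move: f le2 le3;
      rewrite /= !weight_rose_of.
    + by have := single _ _ _ (IH0 b0) ha; lra.
    + by have := single _ _ _ (IH0 b1) ha; lra.
  move/permutation_pair: p => [] [e1 e2]; subst t' us;
    move/permutation_single: p' => [e1 e2]; subst t'' us'; move: f le2 le3 => /=.
  + have := nested _ _ _ (IH0 b0) ha; have := nested _ _ _ (IH1 b1) ha'; lra.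
  + have := nested _ _ _ (IH0 b1) ha; have := nested _ _ _ (IH1 b0) ha'; lra.
- move/permutation_pair => [] [e ->]; rewrite rose_ofE in e;
    case: e => -> -> /=; rewrite weight_rose_of addr0.
  + by move=> /(IH0 (Br j l' b0 b1)); lra.
  + by move=> /(IH1 (Br j l' b0 b1)); lra.
- have [D0 D1] := bdist_downr j l' b0 b1 (Br i l a0 a1) la lb.
  move/permutation_pair => [] [e ->]; rewrite rose_ofE in e;
    case: e => -> -> /=; rewrite weight_rose_of addr0.
  + by move=> /IHb0; lra.
  + by move=> /IHb1; lra.
Qed.

End BinaryTrees.

(** * Pruning and relabelling of binary trees *)

Section Reductions.

Variable R : realDomainType.
Implicit Types a b c : btree R.

(** Only topmost edges are relabelled and only left leaves pruned, as free swaps and descents into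
    left children reach every other place. Pruning a leaf also suppresses the vertex above it, so
    trees stay binary. *)
Inductive step : btree R -> btree R -> R -> Prop :=
| StepRelabel b x : 0 < x -> step b (set_len x b) `|top_len b - x|
| StepSwap i l a c : step (Br i l a c) (Br i l c a) 0
| StepPrune i l j m c :
    step (Br i l (Lf j m) c) (set_len (top_len c + l) c) m
| StepLeft i l a a' c k : step a a' k -> step (Br i l a c) (Br i l a' c) k.

Inductive red : btree R -> btree R -> R -> Prop :=
| RedRefl b : red b b 0
| RedStep b b1 b2 k k1 : step b b1 k -> red b1 b2 k1 -> red b b2 (k + k1).

Lemma step_red b b' k : step b b' k -> red b b' k.
Proof. by rewrite -[k in red _ _ k]addr0 => h; apply: RedStep h (RedRefl _). Qed.

Lemma red_trans b1 b2 b3 k k' : red b1 b2 k -> red b2 b3 k' -> red b1 b3 (k + k').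
Proof.
move=> h; elim: h b3 k' => [b|b b2' b3' k0 k1 s _ IH] b3 k'; first by rewrite add0r.
by move=> /IH h; rewrite -addrA; apply: RedStep s h.
Qed.

Lemma red_left i l a a' c k : red a a' k -> red (Br i l a c) (Br i l a' c) k.
Proof.
elim=> [b|b b1 b2 k0 k1 s _ IH]; first exact: RedRefl.
by apply: RedStep IH; apply: StepLeft.
Qed.

Lemma red_swap i l a c : red (Br i l a c) (Br i l c a) 0.
Proof. by apply: step_red; apply: StepSwap. Qed.

Lemma red_right i l a c c' k : red c c' k -> red (Br i l a c) (Br i l a c') k.
Proof.
move=> h; rewrite -[k]addr0 -[k]add0r -addrA.
apply: red_trans (red_swap _ _ _ _) _.
by apply: red_trans (red_left _ _ _ h) (red_swap _ _ _ _).
Qed.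

Lemma top_len_gt0 b : positive b -> 0 < top_len b.
Proof. by case: b => //= i l a c /andP[]. Qed.

(** Once both children are leaves, pruning one merges the edge of the other into the topmost edge;
    relabelling that edge back to its own length pays for the merged part. Every edge below is thus
    paid for exactly once. *)
Lemma red_leaf b : positive b -> exists j, red b (Lf j (top_len b)) (below b).
Proof.
elim: b => [i l|i l a IHa c IHc] /=; first by exists i; apply: RedRefl.
case/and3P=> l0 pa pc; have [ja ha] := IHa pa; have [jc hc] := IHc pc; exists jc.
have mc := top_len_gt0 pc.
rewrite (bweightE a) (bweightE c).
have -> : top_len a + below a + (top_len c + below c) =
          below a + (below c + (top_len a + top_len c)) by lra.
apply: red_trans (red_left _ _ _ ha) _.
apply: red_trans (red_right _ _ _ hc) _.
apply: red_trans (step_red (StepPrune _ _ _ _ _)) _.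
by have := step_red (StepRelabel (Lf jc (top_len c + l)) l0); rewrite /= addrK gtr0_norm.
Qed.

Lemma red_prune_left i l a c : positive a ->
  red (Br i l a c) (set_len (top_len c + l) c) (bweight a).
Proof.
move=> pa; have [j h] := red_leaf pa; rewrite bweightE [top_len a + _]addrC.
apply: red_trans (red_left _ _ _ h) _.
exact: step_red (StepPrune _ _ _ _ _).
Qed.

Lemma red_prune_right i l a c : positive c ->
  red (Br i l a c) (set_len (top_len a + l) a) (bweight c).
Proof.
move=> pc; rewrite -[bweight c]add0r.
exact: red_trans (red_swap _ _ _ _) (red_prune_left _ _ _ pc).
Qed.

Fixpoint same_shape a b : Prop :=
  match a, b with
  | Lf _ l, Lf _ l' => l = l'
  | Br _ l a0 a1, Br _ l' b0 b1 => [/\ l = l', same_shape a0 b0 & same_shape a1 b1]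
  | _, _ => False
  end.

(** Only deletions and relabellings are needed on either side: the reduction of [b] is later run
    backwards, which turns its deletions into insertions. *)
Definition joinable a b (k : R) : Prop := exists s1 s2 k1 k2,
  [/\ red a s1 k1, red b s2 k2, same_shape s1 s2 & k1 + k2 = k].

Lemma joinable_redl a a' b k k' : red a a' k' -> joinable a' b k -> joinable a b (k + k').
Proof.
move=> h [s1 [s2 [k1 [k2 [h1 h2 sh <-]]]]]; exists s1, s2, (k' + k1), k2.
by split=> //; [apply: red_trans h h1 | lra].
Qed.

Lemma joinable_redr a b b' k k' : red b b' k' -> joinable a b' k -> joinable a b (k + k').
Proof.
move=> h [s1 [s2 [k1 [k2 [h1 h2 sh <-]]]]]; exists s1, s2, k1, (k' + k2).
by split=> //; [apply: red_trans h h2 | lra].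
Qed.

Lemma joinable_min a b k k' : joinable a b k -> joinable a b k' -> joinable a b (Num.min k k').
Proof. by rewrite minElt; case: ifP. Qed.

Lemma joinable_nodes i j la lb a0 a1 b0 b1 k0 k1 : 0 < lb ->
  joinable a0 b0 k0 -> joinable a1 b1 k1 ->
  joinable (Br i la a0 a1) (Br j lb b0 b1) (`|la - lb| + (k0 + k1)).
Proof.
move=> l0 [s1 [s2 [ka [kb [h1 h2 sh <-]]]]] [t1 [t2 [ka' [kb' [h1' h2' sh' <-]]]]].
exists (Br i lb s1 t1), (Br j lb s2 t2), (`|la - lb| + (ka + ka')), (kb + kb').
split=> //; last by lra.
  apply: red_trans (step_red (StepRelabel _ l0)) _ => /=.
  exact: red_trans (red_left _ _ _ h1) (red_right _ _ _ h1').
exact: red_trans (red_left _ _ _ h2) (red_right _ _ _ h2').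
Qed.

Lemma set_len_top b : set_len (top_len b) b = b.
Proof. by case: b. Qed.

Lemma set_len_positive x b : 0 < x -> positive b -> positive (set_len x b).
Proof. by case: b => [? ?|? ? ? ?] //= -> /and3P[_ -> ->]. Qed.

Lemma top_len_set x b : top_len (set_len x b) = x.
Proof. by case: b. Qed.

Lemma below_set x b : below (set_len x b) = below b.
Proof. by case: b. Qed.

Lemma joinable_base a b la lb : 0 < la -> 0 < lb -> positive a -> positive b ->
  joinable (set_len la a) (set_len lb b) (`|la - lb| + (below a + below b)).
Proof.
move=> la0 lb0 pa pb.
have [ja ha] := red_leaf (set_len_positive la0 pa).
have [jb hb] := red_leaf (set_len_positive lb0 pb).
rewrite !top_len_set !below_set in ha hb.
exists (Lf ja lb), (Lf jb lb), (below a + `|la - lb|), (below b); split=> //; last by lra.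
exact: red_trans ha (step_red (StepRelabel (Lf ja la) lb0)).
Qed.

(** Each candidate of the minimum is the total cost of a pair of reductions, hence so is the
    minimum. The lengths passed down the recursion stay positive, as labels must. *)
Lemma bdist_joinable a b la lb : 0 < la -> 0 < lb -> positive a -> positive b ->
  joinable (set_len la a) (set_len lb b) (bdist a b la lb).
Proof.
have downl i l a0 a1 c x k : 0 < l -> positive a0 -> positive a1 ->
    joinable (set_len (l + top_len a0) a0) c k ->
    joinable (set_len (l + top_len a1) a1) c x ->
    joinable (Br i l a0 a1) c (k + bweight a1) /\ joinable (Br i l a0 a1) c (x + bweight a0).
  move=> l0 p0 p1 h0 h1; split.
    by apply: joinable_redl h0; rewrite addrC; apply: red_prune_right.
  by apply: joinable_redl h1; rewrite addrC; apply: red_prune_left.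
have downr i l a0 a1 c x k : 0 < l -> positive a0 -> positive a1 ->
    joinable c (set_len (l + top_len a0) a0) k ->
    joinable c (set_len (l + top_len a1) a1) x ->
    joinable c (Br i l a0 a1) (k + bweight a1) /\ joinable c (Br i l a0 a1) (x + bweight a0).
  move=> l0 p0 p1 h0 h1; split.
    by apply: joinable_redr h0; rewrite addrC; apply: red_prune_right.
  by apply: joinable_redr h1; rewrite addrC; apply: red_prune_left.
elim: a b la lb => [i l|i l a0 IH0 a1 IH1].
  elim=> [j l'|j l' b0 IHb0 b1 IHb1] la lb la0 lb0 pa pb.
    by rewrite bdistE; apply: joinable_base.
  have base := joinable_base la0 lb0 pa pb.
  rewrite bdistE /bdist_step; case/and3P: pb => _ p0 p1.
  have [] := downr j lb b0 b1 _ _ _ lb0 p0 p1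
    (IHb0 _ _ la0 (addr_gt0 lb0 (top_len_gt0 p0)) pa p0)
    (IHb1 _ _ la0 (addr_gt0 lb0 (top_len_gt0 p1)) pa p1).
  by move=> d0 d1; do !apply: joinable_min.
elim=> [j l'|j l' b0 IHb0 b1 IHb1] la lb la0 lb0 pa pb.
  have base := joinable_base la0 lb0 pa pb.
  rewrite bdistE /bdist_step; case/and3P: pa => _ p0 p1.
  have [] := downl i la a0 a1 _ _ _ la0 p0 p1
    (IH0 _ _ _ (addr_gt0 la0 (top_len_gt0 p0)) lb0 p0 pb)
    (IH1 _ _ _ (addr_gt0 la0 (top_len_gt0 p1)) lb0 p1 pb).
  by move=> d0 d1; do !apply: joinable_min.
have base := joinable_base la0 lb0 pa pb.
have pa' := pa; have pb' := pb.
rewrite bdistE /bdist_step; case/and3P: pa => _ p0 p1; case/and3P: pb => _ q0 q1.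
have [] := downl i la a0 a1 _ _ _ la0 p0 p1
  (IH0 _ _ _ (addr_gt0 la0 (top_len_gt0 p0)) lb0 p0 pb')
  (IH1 _ _ _ (addr_gt0 la0 (top_len_gt0 p1)) lb0 p1 pb').
have [] := downr j lb b0 b1 _ _ _ lb0 q0 q1
  (IHb0 _ _ la0 (addr_gt0 lb0 (top_len_gt0 q0)) pa' q0)
  (IHb1 _ _ la0 (addr_gt0 lb0 (top_len_gt0 q1)) pa' q1).
move=> d0 d1 e0 e1.
have g a b : (forall b la lb, 0 < la -> 0 < lb -> positive a -> positive b ->
    joinable (set_len la a) (set_len lb b) (bdist a b la lb)) ->
    positive a -> positive b -> joinable a b (bdist a b (top_len a) (top_len b)).
  move=> IH pa pb; have := IH b _ _ (top_len_gt0 pa) (top_len_gt0 pb) pa pb.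
  by rewrite !set_len_top.
apply: joinable_min.
  (* The crossed matching swaps the children of the second tree beforehand, at cost [0]. *)
  rewrite -[X in joinable _ _ X]addr0.
  apply: joinable_redr (red_swap _ _ _ _) _.
  by apply: joinable_nodes => //; apply: g.
apply: joinable_min.
  by apply: joinable_nodes => //; apply: g.
by do !apply: joinable_min.
Qed.

End Reductions.

(** * Reductions as edit operations *)

Section Realization.

Variable R : realType.
Implicit Type b : btree R.

Fixpoint ids b : seq nat :=
  match b with
  | Lf i _ => [:: i]
  | Br i _ a c => i :: ids a ++ ids c
  end.

(* The edges (child, parent, label) of [b] hanging below the vertex [q]. *)
Fixpoint bedges (q : nat) b : seq (nat * nat * R) :=
  match b with
  | Lf i l => [:: (i, q, l)]
  | Br i l a c => (i, q, l) :: bedges i a ++ bedges i c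
  end.

Definition etail b : seq (nat * nat * R) :=
  match b with
  | Lf i l => [::]
  | Br i l a c => bedges i a ++ bedges i c
  end.

(** [q] names the root, which lies above the topmost edge and is not part of [b]. *)
Definition well_formed (q : nat) b := uniq (q :: ids b) && positive b.

Lemma bedgesE q b : bedges q b = (top_id b, q, top_len b) :: etail b.
Proof. by case: b. Qed.

Lemma etail_set x b : etail (set_len x b) = etail b.
Proof. by case: b. Qed.

Lemma top_id_set x b : top_id (set_len x b) = top_id b.
Proof. by case: b. Qed.

Lemma bedges_child q b : [seq e.1.1 | e <- bedges q b] = ids b.
Proof. by elim: b q => //= i l a IHa c IHc q; rewrite map_cat IHa IHc. Qed.

Lemma mem_ids q b v : v \in ids b -> exists p l, (v, p, l) \in bedges q b.
Proof.
rewrite -(bedges_child q) => /mapP [[[v' p] l] h /= ->]; by exists p, l.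
Qed.

Lemma bedges_parent q b e : e \in bedges q b -> e.1.2 \in q :: ids b.
Proof.
elim: b q => [i l|i l a IHa c IHc] q /=; first by rewrite !inE => /eqP ->; rewrite eqxx.
rewrite !inE => /orP[/eqP ->|]; first by rewrite eqxx.
rewrite !mem_cat => /orP[/IHa|/IHc]; rewrite inE => /orP[-> //|->]; rewrite ?orbT //.
Qed.

Lemma bedges_positive q b e : positive b -> e \in bedges q b -> 0 < e.2.
Proof.
elim: b q => [i l|i l a IHa c IHc] q /=; first by rewrite !inE => l0 /eqP ->.
case/and3P=> l0 pa pc; rewrite !inE mem_cat => /or3P[/eqP -> //|/(IHa _ pa) //|/(IHc _ pc) //].
Qed.

Lemma bedges_rec (P : nat -> Prop) q b : P q ->
  (forall (v p : nat) l, (v, p, l) \in bedges q b -> P p -> P v) ->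
  forall x, x \in ids b -> P x.
Proof.
elim: b q => [i l|i l a IHa c IHc] q Pq H x /=.
  by rewrite !inE => /eqP ->; apply: H Pq; rewrite !inE.
have Pi : P i by apply: (H i q l) Pq; rewrite !inE eqxx.
rewrite !inE mem_cat => /or3P[/eqP -> //|xa|xc].
  by apply: IHa xa => [|c' p l' h]; [exact: Pi | apply: (H c' p l'); rewrite inE mem_cat h orbT].
by apply: IHc xc => [|c' p l' h]; [exact: Pi | apply: (H c' p l'); rewrite inE mem_cat h !orbT].
Qed.

Definition outdeg (L : seq (nat * nat * R)) v := count (fun e => e.1.2 == v) L.

Lemma outdeg_notin q b v : v \notin q :: ids b -> outdeg (bedges q b) v = 0%N.
Proof.
move=> h; apply/eqP; rewrite /outdeg eqn0Ngt -has_count; apply/hasPn => e /bedges_parent pe.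
by apply: contra h => /eqP <-.
Qed.

Lemma outdeg_bedges q b : uniq (q :: ids b) ->
  outdeg (bedges q b) q = 1%N /\
  forall v, v \in ids b -> outdeg (bedges q b) v = 0%N \/ outdeg (bedges q b) v = 2%N.
Proof.
have odc q1 i l a c v : outdeg (bedges q1 (Br i l a c)) v =
    ((q1 == v) + (outdeg (bedges i a) v + outdeg (bedges i c) v))%N.
  by rewrite /outdeg /= count_cat.
elim: b q => [i l|i l a IHa c IHc] q.
  rewrite /= inE andbT => qi; rewrite /outdeg /= eqxx; split=> // v.
  by rewrite inE => /eqP ->; left; rewrite (negbTE qi).
move=> u; have : [/\ uniq (i :: ids a), uniq (i :: ids c), q != i,
    q \notin ids a & q \notin ids c] /\ forall v, v \in ids a -> v \notin ids c.
  move: u; rewrite /= inE mem_cat !negb_or cat_uniq mem_cat negb_or.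
  case/andP=> /and3P[-> -> ->] /andP[/andP[-> ->]] /and3P[-> /hasPn h ->].
  by do ?split=> //; move=> v va; apply/negP => /h; rewrite va.
case=> -[/[dup] ua /andP[ia _] /[dup] uc /andP[ic _] qi qa qc] dis.
have [ai av] := IHa i ua; have [ci cv] := IHc i uc.
split=> [|v]; rewrite odc.
  by rewrite eqxx !outdeg_notin // inE negb_or ?qi ?qa ?qc.
rewrite /= inE mem_cat => /or3P[/eqP ->|va|vc].
- by rewrite (negbTE qi) ai ci; right.
- have -> : (q == v) = false by apply: contraNF qa => /eqP ->.
  rewrite (@outdeg_notin i c); first by rewrite addn0; apply: av.
  by rewrite inE negb_or dis // andbT; apply: contraNneq ia => <-.
- have -> : (q == v) = false by apply: contraNF qc => /eqP ->.
  rewrite (@outdeg_notin i a); first by apply: cv.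
  rewrite inE negb_or; apply/andP; split; first by apply: contraNneq ic => <-.
  by apply: contraTN vc => /dis.
Qed.

Definition links (L : seq (nat * nat * R)) : seq (nat * nat) := [seq e.1 | e <- L].

(** The default [0] is returned only for pairs that are not linked. *)
Definition lab (L : seq (nat * nat * R)) (c p : nat) : R :=
  head 0 [seq e.2 | e <- L & e.1 == (c, p)].

Lemma labE L c p l : uniq [seq e.1.1 | e <- L] -> (c, p, l) \in L -> lab L c p = l.
Proof.
rewrite /lab; elim: L => //= -[[c' p'] l'] L IH /= /andP[c'L uL].
rewrite inE => /orP[/eqP [-> -> ->]|cL]; first by rewrite eqxx.
case: eqP => [[e1 e2]|_]; last exact: IH.
by case/negP: c'L; rewrite e1; apply/mapP; exists (c, p, l).
Qed.

Lemma linksP (L : seq (nat * nat * R)) c p :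
  reflect (exists l, (c, p, l) \in L) ((c, p) \in links L).
Proof.
apply: (iffP mapP) => [[[[c' p'] l] h [-> ->]]|[l h]]; first by exists l.
by exists (c, p, l).
Qed.

Lemma links_uniq (L : seq (nat * nat * R)) c p p' : uniq [seq e.1.1 | e <- L] ->
  (c, p) \in links L -> (c, p') \in links L -> p = p'.
Proof.
elim: L => //= -[[c1 p1] l] L IH /= /andP[c1L uL]; rewrite !inE.
have nc x : (c1, x) \in links L -> False.
  by move=> /linksP [y h]; case/negP: c1L; apply/mapP; exists (c1, x, y).
case/orP=> [/eqP [-> ->]|h1] /orP[/eqP|h2].
- by case.
- by case: (nc _ h2).
- by case=> ec _; rewrite ec in h1; case: (nc _ h1).
- exact: IH.
Qed.

Lemma card_seq_sub_set (s t : seq nat) : uniq s -> {subset s <= t} ->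
  #|[set c : seq_sub t | val c \in s]%SET| = size s.
Proof.
move=> us sub; rewrite cardE -(size_map val); apply: perm_size; apply: uniq_perm => //.
  by rewrite map_inj_uniq ?enum_uniq //; apply: val_inj.
move=> x; apply/mapP/idP => [[y]|xs]; first by rewrite mem_enum inE => h ->.
by exists (SeqSub (sub _ xs)); rewrite // mem_enum inE.
Qed.

Section Realize.

Variables (q : nat) (b : btree R).
Hypothesis wf : well_formed q b.

Let V := seq_sub (q :: ids b).
Let L := bedges q b.
Let E : rel V := fun x y => (val x, val y) \in links L.
Let r : V := SeqSub (mem_head q (ids b)).
Let lb (x y : V) : R := lab L (val x) (val y).

Let uniq_child : uniq [seq e.1.1 | e <- L].
Proof. by rewrite bedges_child; case/andP: wf => /= /andP[]. Qed.

Lemma deg_realization (v : V) : deg E v = outdeg L (val v).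
Proof.
rewrite /deg /children.
have -> : [set c | E c v]%SET =
    [set c : V | val c \in [seq e.1.1 | e <- L & e.1.2 == val v]]%SET.
  apply/setP => c; rewrite !inE; apply/linksP/mapP => [[l h]|[[[c' p'] l]]].
    by exists (val c, val v, l); rewrite // mem_filter eqxx.
  by rewrite mem_filter /= => /andP[/eqP -> h ->]; exists l.
rewrite card_seq_sub_set ?size_map ?size_filter //.
  by apply: subseq_uniq uniq_child; apply: map_subseq; apply: filter_subseq.
move=> x /mapP [e]; rewrite mem_filter => /andP[_ h] ->.
rewrite inE -(bedges_child q); apply/orP; right.
by apply/mapP; exists e.
Qed.

Lemma realization_rooted : rooted_tree E r.
Proof.
have [uq _] := andP wf; have [qb ub] := andP uq.
split=> [p|c cr|c].
- apply/linksP => -[l h]; case/negP: qb; rewrite -(bedges_child q).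
  by apply/mapP; exists (q, val p, l).
- have : val c \in ids b.
    have := ssvalP c; rewrite inE => /orP[/eqP e|//].
    by case/eqP: cr; apply: val_inj.
  case/(mem_ids q)=> p [l h].
  have hp := bedges_parent h; exists (SeqSub hp); split.
    by apply/linksP; exists l.
  move=> p' h'; apply: val_inj; apply: (links_uniq uniq_child) h'.
  by apply/linksP; exists l.
- have H : forall x, x \in ids b -> forall h : x \in q :: ids b, connect E (SeqSub h) r.
    apply: (@bedges_rec (fun x => forall h : x \in q :: ids b, connect E (SeqSub h) r) q).
      by move=> h; apply: eq_connect0; apply: val_inj.
    move=> v p l h IH hv; have hp := bedges_parent h.
    by apply: connect_trans (IH hp); apply: connect1; apply/linksP; exists l.
  case: c => x hx; case/orP: (hx) => [/eqP e|h]; last exact: H.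
  by apply: eq_connect0; apply: val_inj.
Qed.

Lemma realization_positive c p : E c p -> 0 < lb c p.
Proof.
case/linksP=> l h; rewrite /lb (labE uniq_child h).
by case/andP: wf => _ /bedges_positive /(_ h).
Qed.

Lemma realization_deg_root : deg E r = 1%N.
Proof. by rewrite deg_realization; have [] := outdeg_bedges (proj1 (andP wf)). Qed.

Lemma realization_deg v : v != r -> deg E v <> 1%N.
Proof.
move=> vr; rewrite deg_realization; have [_ H] := outdeg_bedges (proj1 (andP wf)).
have : val v \in ids b.
  have := ssvalP v; rewrite inE => /orP[/eqP e|//].
  by case/eqP: vr; apply: val_inj.
by move/H => [] ->.
Qed.

(** The vertices are the names themselves, so that the trees before and after an operation can be
    compared by inclusion of their sets of names. *)
Definition realization : merge_tree R :=
  MergeTree realization_rooted realization_positive realization_deg_root realization_deg.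

End Realize.

End Realization.

(** * Steps of a reduction as single edit operations *)

Section Operations.

Variable R : realType.
Implicit Type b : btree R.

Section Pair.

Variables (q : nat) (b b' : btree R).
Hypothesis wf : well_formed q b.
Hypothesis wf' : well_formed q b'.

Let uc : uniq [seq e.1.1 | e <- bedges q b].
Proof. by rewrite bedges_child; case/andP: wf => /= /andP[]. Qed.

Let uc' : uniq [seq e.1.1 | e <- bedges q b'].
Proof. by rewrite bedges_child; case/andP: wf' => /= /andP[]. Qed.

Lemma perm_ids L : perm_eq (bedges q b) L -> perm_eq (ids b) [seq e.1.1 | e <- L].
Proof. by rewrite -(bedges_child q); apply: perm_map. Qed.

Lemma mem_vertex b1 v p l : (v, p, l) \in bedges q b1 -> v \in q :: ids b1.
Proof.
move=> h; rewrite inE -(bedges_child q); apply/orP; right.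
by apply/mapP; exists (v, p, l).
Qed.

(** Both trees have the same names and links, so the isomorphism is the identity on names. *)
Lemma relabel_realization v p (l l' : R) rest :
  perm_eq (bedges q b) ((v, p, l) :: rest) ->
  perm_eq (bedges q b') ((v, p, l') :: rest) ->
  relabel (realization wf) `|l - l'| (realization wf').
Proof.
move=> pb pb'.
have h : (v, p, l) \in bedges q b by rewrite (perm_mem pb) mem_head.
have h' : (v, p, l') \in bedges q b' by rewrite (perm_mem pb') mem_head.
have pid : perm_eq (ids b) (ids b').
  rewrite -!(bedges_child q); apply: perm_trans (perm_map _ pb) _.
  by rewrite perm_sym; apply: perm_trans (perm_map _ pb') _.
have sub x : (x \in q :: ids b') = (x \in q :: ids b).
  by rewrite !inE (perm_mem pid).
have sub' x : x \in q :: ids b' -> x \in q :: ids b by rewrite sub.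
have elinks : links (bedges q b) =i links (bedges q b').
  move=> e; rewrite (perm_mem (perm_map _ pb)) /=.
  by rewrite (perm_mem (perm_map _ pb')).
exists (SeqSub (mem_vertex h) : realization wf), (SeqSub (bedges_parent h)), l'; split.
- by apply/linksP; exists l.
- by case/andP: wf' => _ /bedges_positive /(_ h').
- by rewrite /= (labE uc h).
exists (fun x : realization wf' => SeqSub (sub' _ (ssvalP x))); split.
- by move=> x y /(congr1 val) /= e; apply: val_inj.
- move=> x; rewrite inE; split=> // _.
  have hx : val x \in q :: ids b' by rewrite sub; apply: ssvalP.
  by exists (SeqSub hx); apply: val_inj.
- exact: val_inj.
- by move=> x y; rewrite /= elinks.
move=> x y /linksP[l0 h0] /=; rewrite (labE uc' h0).
rewrite -!val_eqE /=; move: (h0); rewrite (perm_mem pb') inE => /orP[/eqP[-> -> ->]|hr].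
  by rewrite !eqxx.
have hb : (val x, val y, l0) \in bedges q b by rewrite (perm_mem pb) inE hr orbT.
case: ifP => [/andP[/eqP ex /eqP ey]|_]; last by rewrite (labE uc hb).
have h1 : (v, p, l0) \in bedges q b' by rewrite -ex -ey.
by rewrite -(labE uc' h1) (labE uc' h').
Qed.

(** [j] is the deleted leaf, [i] its parent, [v] its sibling and [p] the vertex above [i]. The
    smaller tree loses exactly the names [j] and [i], and the isomorphism is the inclusion of names.
    Edge lists up to permutation suffice, wherever in the tree the deletion takes place. *)
Lemma deletion_realization j i v p (m m' l : R) rest :
  perm_eq (bedges q b) [:: (j, i, m), (v, i, m'), (i, p, l) & rest] ->
  perm_eq (bedges q b') ((v, p, m' + l) :: rest) ->
  deletion (realization wf) m (realization wf').
Proof.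
move=> pb pb'.
have [uq _] := andP wf.
have eids : perm_eq (ids b) [:: j, v, i & [seq e.1.1 | e <- rest]].
  exact: perm_ids pb.
have eids' : perm_eq (ids b') (v :: [seq e.1.1 | e <- rest]).
  by rewrite -(bedges_child q); apply: perm_map pb'.
have uall : uniq [:: q, j, v, i & [seq e.1.1 | e <- rest]].
  have : perm_eq (q :: ids b) [:: q, j, v, i & [seq e.1.1 | e <- rest]] by rewrite perm_cons.
  by move/perm_uniq <-.
have [jv ji vi] : [/\ j != v, j != i & v != i].
  move: uall; rewrite /= !inE !negb_or -!andbA.
  by case/and5P=> _ _ _ _ /and5P[-> -> _ -> _].
have nj : j \notin q :: ids b'.
  rewrite inE (perm_mem eids') inE !negb_or jv.
  move: uall; rewrite /= !inE !negb_or -!andbA.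
  by case/and5P=> [q1 _ _ _ /and5P[_ _ -> _ _]]; rewrite eq_sym q1.
have ni : i \notin q :: ids b'.
  rewrite inE (perm_mem eids') inE !negb_or [i == v]eq_sym vi.
  move: uall; rewrite /= !inE !negb_or -!andbA.
  by case/and5P=> [_ _ q1 _ /and5P[_ _ _ _ /and3P[_ -> _]]]; rewrite eq_sym q1.
have mem' x : (x \in q :: ids b') = [&& x \in q :: ids b, x != j & x != i].
  rewrite !inE (perm_mem eids) (perm_mem eids') !inE.
  case: (x =P j) => [->|_].
    by move: nj; rewrite inE (perm_mem eids') inE => /negbTE ->; rewrite andbF.
  case: (x =P i) => [->|_].
    by move: ni; rewrite inE (perm_mem eids') inE => /negbTE ->; rewrite !andbF.
  by rewrite !andbT.
have pn x y l0 : (x, y, l0) \in rest -> y \in q :: ids b'.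
  by move=> h; apply: (@bedges_parent _ q b' (x, y, l0)); rewrite (perm_mem pb') inE h orbT.
have pp : p \in q :: ids b'.
  by apply: (@bedges_parent _ q b' (v, p, m' + l)); rewrite (perm_mem pb') mem_head.
have hj : (j, i, m) \in bedges q b by rewrite (perm_mem pb) mem_head.
have hv : (v, i, m') \in bedges q b by rewrite (perm_mem pb) !inE eqxx orbT.
have hi : (i, p, l) \in bedges q b by rewrite (perm_mem pb) !inE eqxx !orbT.
have hr x y l0 : (x, y, l0) \in rest -> (x, y, l0) \in bedges q b.
  by rewrite (perm_mem pb) !inE => ->; rewrite !orbT.
have hv' : (v, p, m' + l) \in bedges q b' by rewrite (perm_mem pb') mem_head.
have hr' x y l0 : (x, y, l0) \in rest -> (x, y, l0) \in bedges q b'.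
  by rewrite (perm_mem pb') !inE => ->; rewrite !orbT.
have el x y : ((x, y) \in links (bedges q b)) =
    [|| (x, y) == (j, i), (x, y) == (v, i), (x, y) == (i, p) | (x, y) \in links rest].
  by rewrite (perm_mem (perm_map _ pb)) !inE.
have el' x y : ((x, y) \in links (bedges q b')) = ((x, y) == (v, p)) || ((x, y) \in links rest).
  by rewrite (perm_mem (perm_map _ pb')) !inE.
have sub x : x \in q :: ids b' -> x \in q :: ids b by rewrite mem' => /andP[].
have qi : i != q by apply: contraNneq ni => ->; rewrite mem_head.
have dj : outdeg (bedges q b) j = 0%N.
  rewrite /outdeg (permP pb) /= ![i == j]eq_sym (negbTE ji) (_ : (p == j) = false); last first.
    by apply/negbTE; apply: contraNneq nj => <-.
  apply/eqP; rewrite !add0n eqn0Ngt -has_count; apply/hasPn => -[[x y] l0] h /=.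
  by apply: contraNneq nj => <-; apply: pn h.
exists (SeqSub (mem_vertex hj) : realization wf), (SeqSub (bedges_parent hj)); split.
- by apply/linksP; exists m.
- by rewrite /leaf deg_realization.
- by rewrite -val_eqE.
- by rewrite /= (labE uc hj).
right.
exists (SeqSub (mem_vertex hv)), (SeqSub (bedges_parent hi)); split.
- apply/setP => x; rewrite !inE -!val_eqE /= el !xpair_eqE !eqxx !andbT.
  rewrite [i == p]eq_sym (_ : (p == i) = false); last first.
    by apply/negbTE; apply: contraNneq ni => <-.
  rewrite (_ : ((val x, i) \in links rest) = false); last first.
    by apply/negbTE/linksP => -[l0 /pn]; apply/negP.
  rewrite andbF !orbF; case: (val x =P j) => [->|_] //=.
  by rewrite (negbTE jv).
- by apply/linksP; exists l.
exists (fun x : realization wf' => SeqSub (sub _ (ssvalP x))); split.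
- by move=> x y /(congr1 val) /= e; apply: val_inj.
- move=> x; rewrite !inE -!val_eqE /= negb_or; split=> [hx|[y <-]].
    have hx' : val x \in q :: ids b' by rewrite mem' (ssvalP x).
    by exists (SeqSub hx'); apply: val_inj.
  by have := ssvalP y; rewrite mem' => /and3P[_ -> ->].
- exact: val_inj.
- move=> x y; rewrite /= el el' -!val_eqE !xpair_eqE /=.
  have := ssvalP x; rewrite mem' => /and3P[_ /negbTE -> /negbTE ->] /=.
  have := ssvalP y; rewrite mem' => /and3P[_ _ /negbTE ->] /=.
  by rewrite andbF /= orbC.
move=> x y; rewrite /= el' -!val_eqE /=.
case: ifP => [/andP[/eqP -> /eqP ->] _|nvp].
  by rewrite (labE uc hv) (labE uc hi) (labE uc' hv').
rewrite xpair_eqE nvp /= => /linksP [l0 h].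
by rewrite (labE uc (hr _ _ _ h)) (labE uc' (hr' _ _ _ h)).
Qed.

End Pair.

Lemma step_positive b b' k : step b b' k -> positive b -> positive b'.
Proof.
elim=> {b b' k} [b x x0|i l a c|i l j m c|i l a a' c k _ IH].
- exact: set_len_positive.
- by rewrite /= => /and3P[-> -> ->].
- move=> /= /and3P[l0 m0 pc]; apply: set_len_positive => //.
  by rewrite addr_gt0 // top_len_gt0.
- by rewrite /= => /and3P[-> /IH -> ->].
Qed.

Lemma step_bedges b b' k : step b b' k -> forall q,
  (exists v p l l' rest, [/\ perm_eq (bedges q b) ((v, p, l) :: rest),
     perm_eq (bedges q b') ((v, p, l') :: rest) & k = `|l - l'|]) \/
  (exists j i v p m' l rest,
     perm_eq (bedges q b) [:: (j, i, k), (v, i, m'), (i, p, l) & rest] /\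
     perm_eq (bedges q b') ((v, p, m' + l) :: rest)).
Proof.
elim=> {b b' k} [b x x0|i l a c|i l j m c|i l a a' c k _ IH] q.
- left; exists (top_id b), q, (top_len b), x, (etail b); split=> //.
    by rewrite bedgesE.
  by rewrite bedgesE top_id_set top_len_set etail_set.
(* A swap merely permutes the edge list; it counts as relabelling the topmost edge to its own
   value. *)
- left; exists i, q, l, l, (bedges i a ++ bedges i c); split=> //.
    by rewrite /= perm_cons perm_catC.
  by rewrite subrr normr0.
- right; exists j, i, (top_id c), q, (top_len c), l, (etail c); split; last first.
    by rewrite bedgesE top_id_set top_len_set etail_set.
  rewrite /= bedgesE; apply/permP => P /=; lia.
- case: (IH i) => [[v [p [l1 [l2 [rest [h1 h2 ->]]]]]]|[j [i' [v [p [m' [l1 [rest [h1 h2]]]]]]]]].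
    left; exists v, p, l1, l2, ((i, q, l) :: rest ++ bedges i c); split=> //.
      by apply/permP => P; have := permP h1 P; rewrite /= !count_cat /=; lia.
    by apply/permP => P; have := permP h2 P; rewrite /= !count_cat /=; lia.
  right; exists j, i', v, p, m', l1, ((i, q, l) :: rest ++ bedges i c); split=> //.
    by apply/permP => P; have := permP h1 P; rewrite /= !count_cat /=; lia.
  by apply/permP => P; have := permP h2 P; rewrite /= !count_cat /=; lia.
Qed.

Lemma step_well_formed q b b' k : step b b' k -> well_formed q b -> well_formed q b'.
Proof.
move=> h /andP[u pb]; rewrite /well_formed (step_positive h pb) andbT.
case: (step_bedges h q) => [[v [p [l1 [l2 [rest [h1 h2 _]]]]]]|[j [i' [v [p [m' [l1 [rest [h1 h2]]]]]]]]].
  have /perm_uniq : perm_eq (q :: ids b) (q :: ids b'); last by rewrite u.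
  rewrite perm_cons -!(bedges_child q).
  by apply: perm_trans (perm_map _ h1) _; rewrite perm_sym; apply: perm_map h2.
have /perm_uniq : perm_eq (q :: ids b) [:: q, j, v, i' & [seq e.1.1 | e <- rest]].
  by rewrite perm_cons; apply: (perm_ids h1).
have /perm_uniq -> : perm_eq (q :: ids b') [:: q, v & [seq e.1.1 | e <- rest]].
  by rewrite perm_cons; apply: (perm_ids h2).
rewrite u => /esym; rewrite /= !inE !negb_or -!andbA.
by case/and5P=> _ -> _ -> /and5P[_ _ _ _ /and3P[-> _ ->]].
Qed.

Lemma step_edit_operation q b b' k (wf : well_formed q b) (wf' : well_formed q b') :
  step b b' k -> edit_operation (realization wf) k (realization wf') /\
                 edit_operation (realization wf') k (realization wf).
Proof.
move=> h.
case: (step_bedges h q) => [[v [p [l1 [l2 [rest [h1 h2 ->]]]]]]|[j [i' [v [p [m' [l1 [rest [h1 h2]]]]]]]]].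
  split; first by constructor 1; apply: relabel_realization h1 h2.
  by rewrite distrC; constructor 1; apply: relabel_realization h2 h1.
have := deletion_realization wf wf' h1 h2.
by split; [constructor 2|constructor 3].
Qed.

End Operations.

(** * Renaming of vertices and concatenation of edit sequences *)

Section Transport.

Variable R : realType.
Implicit Type b : btree R.

Fixpoint rename (g : nat -> nat) b : btree R :=
  match b with
  | Lf i l => Lf (g i) l
  | Br i l a c => Br (g i) l (rename g a) (rename g c)
  end.

Lemma ids_rename g b : ids (rename g b) = [seq g i | i <- ids b].
Proof. by elim: b => //= i l a -> c ->; rewrite map_cat. Qed.

Lemma bedges_rename g q b :
  bedges (g q) (rename g b) = [seq (g e.1.1, g e.1.2, e.2) | e <- bedges q b].
Proof. by elim: b q => //= i l a IHa c IHc q; rewrite IHa IHc map_cat. Qed.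

Lemma rename_ext g g' b : {in ids b, g =1 g'} -> rename g b = rename g' b.
Proof.
elim: b => [i l|i l a IHa c IHc] /= e; first by rewrite e ?mem_head.
rewrite e ?mem_head // IHa ?IHc // => x h; apply: e;
  by rewrite inE mem_cat h /= ?orbT /= ?orbT.
Qed.

Lemma rename_exists b b' : same_shape b' b -> uniq (ids b) -> exists g, rename g b = b'.
Proof.
elim: b b' => [i l|i l a IHa c IHc] [j l'|j l' a' c'] //=.
  by move=> -> _; exists (fun=> j).
case=> -> /IHa{}IHa /IHc{}IHc; rewrite mem_cat negb_or cat_uniq.
case/andP=> /andP[ia ic] /and3P[ua /hasPn dis uc].
have [ga <-] := IHa ua; have [gc <-] := IHc uc.
exists (fun x => if x == i then j else if x \in ids a then ga x else gc x).
rewrite eqxx; congr (Br _ _ _ _); apply: rename_ext => x h.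
  by rewrite h; case: eqP => // e; rewrite e (negbTE ia) in h.
rewrite (negbTE (dis _ h)); case: eqP => // e; by rewrite e (negbTE ic) in h.
Qed.

Lemma uniq_map_inj (s : seq nat) (g : nat -> nat) :
  uniq [seq g i | i <- s] -> {in s &, injective g}.
Proof.
elim: s => //= x s IH /andP[gx us] y z; rewrite !inE => /orP[/eqP->|ys] /orP[/eqP->|zs] //.
- by move=> e; case/negP: gx; rewrite e map_f.
- by move=> e; case/negP: gx; rewrite -e map_f.
- exact: IH.
Qed.

Lemma same_shape_isomorphic q q' b b' (wf : well_formed q b) (wf' : well_formed q' b') :
  same_shape b b' -> isomorphic (realization wf) (realization wf').
Proof.
move=> sh; have [uq _] := andP wf; have [uq' _] := andP wf'.
have [g0 eg0] := rename_exists sh (proj2 (andP uq')).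
(* [g0] is controlled only on the names of [b'], so it has to be corrected at the root. *)
pose g x := if x == q' then q else g0 x.
have gq : g q' = q by rewrite /g eqxx.
have eg : rename g b' = b.
  rewrite -eg0; apply: rename_ext => x h; rewrite /g; case: eqP => // e.
  by case/andP: uq'; rewrite -e h.
have emap : q :: ids b = [seq g i | i <- q' :: ids b'] by rewrite /= gq -eg ids_rename.
have ginj : {in q' :: ids b' &, injective g}.
  by apply: uniq_map_inj; rewrite -emap.
have sub x : x \in q' :: ids b' -> g x \in q :: ids b.
  by move=> h; rewrite emap map_f.
have eL : bedges q b = [seq (g e.1.1, g e.1.2, e.2) | e <- bedges q' b'].
  by rewrite -bedges_rename gq eg.
have uc : uniq [seq e.1.1 | e <- bedges q b].
  by rewrite bedges_child; case/andP: uq.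
have uc' : uniq [seq e.1.1 | e <- bedges q' b'].
  by rewrite bedges_child; case/andP: uq'.
exists (fun x : realization wf' => SeqSub (sub _ (ssvalP x))); split.
- by move=> x y /(congr1 val) /= e; apply: val_inj; apply: ginj e; apply: ssvalP.
- move=> x; rewrite inE; split=> // _.
  have := ssvalP x; rewrite {2}emap => /mapP [y hy e].
  by exists (SeqSub hy); apply: val_inj; rewrite /= e.
- by apply: val_inj => /=; rewrite gq.
- move=> x y; rewrite /= eL; apply/linksP/linksP => -[l h].
    by exists l; apply/mapP; exists (ssval x, ssval y, l).
  case/mapP: h => -[[x' y'] l'] h /= [ex ey el]; exists l'.
  have hx' := mem_vertex h; have hy' := bedges_parent h.
  by rewrite (ginj _ _ (ssvalP x) hx' ex) (ginj _ _ (ssvalP y) hy' ey).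
- move=> x y /linksP[l h] /=; rewrite (labE uc' h); symmetry; apply: labE => //.
  by rewrite eL; apply/mapP; exists (val x, val y, l).
Qed.

Lemma isomorphic_refl (T : merge_tree R) : isomorphic T T.
Proof. by exists id; split=> // x; rewrite inE; split=> // _; exists x. Qed.

Lemma root_edge (T : merge_tree R) : exists c, edge T c (Defs.root T).
Proof.
case: T => V E r l h1 h2 h3 h4 /=.
have : (0 < deg E r)%N by rewrite h3.
by case/card_gt0P => c; rewrite inE; exists c.
Qed.

Lemma edge_label_gt0 (T : merge_tree R) c p : edge T c p -> 0 < label T c p.
Proof. by case: T c p => V E r l h1 h2 h3 h4 /=; apply: h2. Qed.

(** The edge at the root is relabelled to its own value. An empty sequence can thus be absorbed into
    a concatenation without composing isomorphisms. *)
Lemma isomorphic_relabel (T T' : merge_tree R) : isomorphic T T' -> relabel T 0 T'.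
Proof.
move=> [f [f1 f2 f3 f4 f5]]; have [c hc] := root_edge T.
exists c, (Defs.root T), (label T c (Defs.root T)); split=> //.
- exact: edge_label_gt0.
- by rewrite subrr normr0.
exists f; split=> // x y h; rewrite f5 //.
by case: ifP => // /andP[/eqP -> /eqP ->].
Qed.

Lemma edit_sequence_cat (T1 T2 T3 : merge_tree R) k k' :
  edit_sequence T1 k T2 -> edit_sequence T2 k' T3 -> edit_sequence T1 (k + k') T3.
Proof.
move=> h; elim: h T3 k' => {T1 T2 k} [T T' i|T k T' k1 T'' o _ IH] T3 k' h.
  by apply: EditCons h; constructor 1; apply: isomorphic_relabel.
by rewrite -addrA; apply: EditCons o (IH _ _ h).
Qed.

Lemma edit_operation_sequence (T T' : merge_tree R) k :
  edit_operation T k T' -> edit_sequence T k T'.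
Proof.
by rewrite -{2}[k]addr0 => o; apply: EditCons o (EditNil (isomorphic_refl _)).
Qed.

Lemma red_edit_sequence q b s k (wf : well_formed q b) : red b s k ->
  exists wfs : well_formed q s, edit_sequence (realization wf) k (realization wfs) /\
                                edit_sequence (realization wfs) k (realization wf).
Proof.
move=> h; elim: h wf => {b s k} [b|b b1 b2 k k1 s _ IH] wf.
  by exists wf; split; apply: EditNil; apply: isomorphic_refl.
have wf1 := step_well_formed s wf; have [wf2 [h1 h2]] := IH wf1; exists wf2.
have [s1 s2] := step_edit_operation wf wf1 s; split.
  exact: EditCons s1 h1.
by rewrite addrC; apply: edit_sequence_cat h2 (edit_operation_sequence s2).
Qed.

Lemma joinable_edit_sequence (T1 T2 : merge_tree R) q q' b b' k
    (wf : well_formed q b) (wf' : well_formed q' b') :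
  isomorphic T1 (realization wf) -> isomorphic (realization wf') T2 ->
  joinable b b' k -> edit_sequence T1 k T2.
Proof.
move=> i1 i2 [s1 [s2 [k1 [k2 [h1 h2 sh <-]]]]].
have [ws1 [e1 _]] := red_edit_sequence wf h1.
have [ws2 [_ e2]] := red_edit_sequence wf' h2.
rewrite -[k1]add0r -[k2]addr0 -addrA.
apply: edit_sequence_cat (EditNil i1) _.
apply: edit_sequence_cat e1 _.
rewrite -[k2]add0r -addrA; apply: edit_sequence_cat (EditNil (same_shape_isomorphic ws1 ws2 sh)) _.
exact: edit_sequence_cat e2 (EditNil i2).
Qed.

End Transport.

(** * Edit operations as alignments *)

Section TreeFacts.

Variables (R : realType) (T : merge_tree R).
Implicit Types v c p : T.

Definition parent v : T := if [pick p | edge T v p] is Some p then p else v.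

Lemma merge_treeP : rooted_tree (edge T) (Defs.root T).
Proof. by case: T. Qed.

Lemma root_no_parent p : edge T (Defs.root T) p = false.
Proof. by case: merge_treeP => h _ _; apply: negbTE. Qed.

Lemma edge_fun c p p' : edge T c p -> edge T c p' -> p = p'.
Proof.
case: merge_treeP => _ h _ e e'.
have cr : c != Defs.root T by apply: contraTneq e => ->; rewrite root_no_parent.
by have [p0 [_ u]] := h c cr; rewrite -(u _ e) (u _ e').
Qed.

Lemma parentE c p : edge T c p -> parent c = p.
Proof.
rewrite /parent => e; case: pickP => [p' e'|/(_ p)]; last by rewrite e.
exact: edge_fun e' e.
Qed.

Lemma parent_root : parent (Defs.root T) = Defs.root T.
Proof. by rewrite /parent; case: pickP => // p; rewrite root_no_parent. Qed.

Lemma edge_parent v : v != Defs.root T -> edge T v (parent v).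
Proof.
by case: merge_treeP => _ h _ /h [p [e _]]; rewrite (parentE e).
Qed.

Lemma edge_root v p : edge T v p -> v != Defs.root T.
Proof. by move=> e; apply: contraTneq e => ->; rewrite root_no_parent. Qed.

Lemma path_iter v s : path (edge T) v s -> last v s = iter (size s) parent v.
Proof.
elim: s v => //= p s IH v /andP[e /IH ->].
by rewrite -(parentE e) -iterSr.
Qed.

Lemma reach_root v : exists2 k, (k < #|T|)%N & iter k parent v = Defs.root T.
Proof.
case: merge_treeP => _ _ /(_ v) /connectP [s ps ->].
case/shortenP: ps => s' ps' us' _; exists (size s'); last by rewrite path_iter.
by rewrite -ltnS -[(size s').+1]/(size (v :: s')) -(card_uniqP us') ltnS max_card.
Qed.

Lemma edge_neq c p : edge T c p -> c != p.
Proof.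
move=> e; apply/eqP => ecp; rewrite -{}ecp in e.
have [k _] := reach_root c; have : iter k parent c = c.
  by elim: k => //= k ->; apply: parentE.
by move=> -> ec; move: e; rewrite ec root_no_parent.
Qed.

Definition depth v := find (fun k => iter k parent v == Defs.root T) (iota 0 #|T|).

Lemma depth_has v : has (fun k => iter k parent v == Defs.root T) (iota 0 #|T|).
Proof.
have [k kT e] := reach_root v; apply/hasP; exists k; last exact/eqP.
by rewrite mem_iota.
Qed.

Lemma depth_lt v : (depth v < #|T|)%N.
Proof. by have := depth_has v; rewrite has_find size_iota. Qed.

Lemma iter_depth v : iter (depth v) parent v = Defs.root T.
Proof.
have := nth_find 0%N (depth_has v); rewrite nth_iota ?add0n => [/eqP //|].
exact: depth_lt.
Qed.

Lemma depth_min v k : iter k parent v = Defs.root T -> (depth v <= k)%N.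
Proof.
move=> e; rewrite leqNgt; apply/negP => lt.
have := before_find 0%N lt; rewrite nth_iota ?add0n ?e ?eqxx //.
exact: ltn_trans lt (depth_lt v).
Qed.

Lemma depth_root : depth (Defs.root T) = 0%N.
Proof. by apply/eqP; rewrite -leqn0; apply: depth_min. Qed.

Lemma depth_edge c p : edge T c p -> depth c = (depth p).+1.
Proof.
move=> e; apply/eqP; rewrite eqn_leq; apply/andP; split.
  by apply: depth_min; rewrite iterSr (parentE e) iter_depth.
have := iter_depth c; case: (depth c) => [/= ec|d].
  by move: e; rewrite ec root_no_parent.
by rewrite iterSr (parentE e) ltnS => /depth_min.
Qed.

Lemma tree_ind_up (P : T -> Prop) :
  (forall v, (forall c, edge T c v -> P c) -> P v) -> forall v, P v.
Proof.
move=> H v; move: {2}(#|T| - depth v)%N (leqnn (#|T| - depth v)%N) => n.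
elim: n v => [|n IH] v le; first by have := depth_lt v; lia.
apply: H => c e; apply: IH; have := depth_edge e; have := depth_lt c; lia.
Qed.

Lemma connect_iter c v : connect (edge T) c v -> exists k, iter k parent c = v.
Proof. by case/connectP => s ps ->; exists (size s); rewrite path_iter. Qed.

Lemma depth_iter k v : depth (iter k parent v) = (depth v - k)%N.
Proof.
elim: k v => [|k IH] v; first by rewrite subn0.
rewrite iterSr IH; case: (v =P Defs.root T) => [->|/eqP /edge_parent e].
  by rewrite parent_root depth_root.
by rewrite (depth_edge e) subSS.
Qed.

Lemma depth_connect c v : connect (edge T) c v -> (depth v <= depth c)%N.
Proof. by case/connect_iter => k <-; rewrite depth_iter leq_subr. Qed.

(** Both are the ancestor of [c] at one and the same depth. *)
Lemma sibling_eq c v y y' : edge T y v -> edge T y' v ->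
  connect (edge T) c y -> connect (edge T) c y' -> y = y'.
Proof.
move=> e e' /connect_iter [k ek] /connect_iter [k' ek'].
have d := depth_edge e; have d' := depth_edge e'.
rewrite -ek depth_iter in d; rewrite -ek' depth_iter in d'.
by rewrite -ek -ek'; congr (iter _ _ _); lia.
Qed.

(** A cost [k] arising at [c] is charged to the subtrees containing [c]. As [c] lies below at most
    one child of [v], the charges of the children together never exceed that of [v]. *)
Lemma child_sum c v (k : R) (s : seq T) : 0 <= k -> uniq s ->
  (forall y, y \in s -> edge T y v) ->
  \sum_(y <- s) k *+ connect (edge T) c y <= k *+ (connect (edge T) c v && (c != v)).
Proof.
move=> k0 us es; case: (boolP (has (connect (edge T) c) s)) => [/hasP [y ys cy]|/hasPn h].
  rewrite (bigD1_seq y) //= cy big_seq_cond big1 => [|z /andP[zs zy]].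
    rewrite addr0 (connect_trans cy (connect1 (es _ ys))) /=.
    suff -> : c != v by [].
    apply: contraTneq cy => ->; apply/negP => /depth_connect.
    by rewrite (depth_edge (es _ ys)) ltnn.
  case cz : (connect (edge T) c z) => //.
  by case/eqP: zy; apply: sibling_eq (es _ zs) (es _ ys) cz cy.
rewrite big_seq_cond big1 ?mulrn_wge0 // => y; rewrite andbT => /h /negbTE -> //.
Qed.

Definition children_listing (ch : T -> seq T) :=
  forall v, uniq (ch v) /\ forall c, (c \in ch v) = edge T c v.

(** The order of the children is left open, to be chosen where it matters. The length [l] replaces
    the label above [v], so that a subtree can hang on a merged edge and the root on an edge of
    length [0]. *)
Definition subtrees (S : T -> R -> rose R) := exists2 ch, children_listing ch &
  forall v l, S v l = Rose l [seq S c (label T c v) | c <- ch v].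

Lemma subtrees_exist : exists S, subtrees S.
Proof.
pose ch v := enum [set c | edge T c v]%SET.
pose subf := fix subf n v l := Rose l
  (if n is n'.+1 then [seq subf n' c (label T c v) | c <- ch v] else [::]).
(* Depths are smaller than the number of vertices and grow by one at each child, so the fuel is
   positive at every vertex. *)
exists (fun v l => subf (#|T| - depth v)%N v l); exists ch.
  by move=> v; split=> [|c]; rewrite ?enum_uniq // mem_enum inE.
move=> v l; have := depth_lt v; case e: (#|T| - depth v)%N => [|n]; first by lia.
move=> _ /=; congr Rose; apply/eq_in_map => c; rewrite mem_enum inE => ec.
by congr (subf _ c _); rewrite (depth_edge ec) subnS e.
Qed.

Lemma subtrees_nonneg S v l : subtrees S -> 0 <= l -> nonneg_labels (S v l).
Proof.
case=> ch hch eS; elim/tree_ind_up: v l => v IH l l0; rewrite eS /= l0.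
have : forall c, c \in ch v -> edge T c v by move=> c; rewrite (proj2 (hch v)).
elim: (ch v) => //= c s IHs H; rewrite IHs => [|c' h]; last by apply: H; rewrite inE h orbT.
have e : edge T c v by apply: H; rewrite mem_head.
by rewrite IH // ltW // edge_label_gt0.
Qed.

End TreeFacts.

Lemma perm_eq_Permutation (A : eqType) (s t : seq A) : perm_eq s t -> Permutation s t.
Proof.
elim: s t => [|x s IH] t; first by move/perm_size/esym/size0nil ->.
move=> h; have xt : x \in t by rewrite -(perm_mem h) mem_head.
case/splitPr: xt h => t1 t2 h; apply: Permutation_cons_app; apply: IH.
by rewrite -(perm_cons x); apply: perm_trans h _; rewrite -cat1s perm_catCA.
Qed.

(** * The alignment given by a single operation *)

Section OperationAlign.

Variable R : realType.

(** Matches the children along [f]. The total cost is a sum over the children on the left, the form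
    to which [child_sum] applies. *)
Lemma falign_maps (A B : eqType) (f : B -> A) (F : A -> rose R) (G : B -> rose R)
    (h : A -> R) (s : seq A) (s' : seq B) : perm_eq s (map f s') ->
  (forall y, y \in s' -> align (F (f y)) (G y) (h (f y))) ->
  falign (map F s) (map G s') (\sum_(z <- s) h z).
Proof.
move=> p H; rewrite (perm_big _ p) /=.
apply: falign_perml (Permutation_sym (Permutation_map F (perm_eq_Permutation p))).
elim: s' {p} H => [|y s' IH] H /=; first by rewrite big_nil; apply: FalignNil.
rewrite big_cons; apply: FalignMatch (Permutation_refl _) (H _ (mem_head _ _)) _ _ => //.
by apply: IH => z h'; apply: H; rewrite inE h' orbT.
Qed.

Variables (T T' : merge_tree R) (S : T -> R -> rose R) (S' : T' -> R -> rose R).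
Hypotheses (hS : subtrees S) (hS' : subtrees S').

Lemma relabel_align c p (a : R) : edge T c p ->
  isomorphic_to T' [set: T]%SET (edge T)
    (fun x y => if (x == c) && (y == p) then a else label T x y) (Defs.root T) ->
  align (S (Defs.root T) 0) (S' (Defs.root T') 0) `|label T c p - a|.
Proof.
move=> ecp [f [fi fs fr fe fl]].
case: hS => ch hch eS; case: hS' => ch' hch' eS'.
set k := `| _ |; have k0 : 0 <= k := normr_ge0 _.
(* A subtree costs the difference of its top lengths, plus [k] if [c] lies strictly below its top
   vertex. When the top vertex is [c] itself, the relabelled edge is the topmost one and is
   accounted for by that difference. *)
suff H x l l' : align (S (f x) l) (S' x l')
    (`|l - l'| + k *+ (connect (edge T) c (f x) && (c != f x))).
  apply: align_weaken (_ : align _ _ (`|0 - 0| + k *+ (connect (edge T) c (f (Defs.root T')) &&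
      (c != f (Defs.root T'))))) _.
    by rewrite -{1}fr; apply: H.
  by rewrite subr0 normr0 add0r; case: (_ && _) => //=.
elim/tree_ind_up: x l l' => x IH l l'; rewrite eS eS'.
have [uch mch] := hch (f x); have [uch' mch'] := hch' x.
have pch : perm_eq (ch (f x)) (map f (ch' x)).
  apply: uniq_perm => //; first by rewrite (map_inj_uniq fi).
  move=> z; rewrite mch; apply/idP/mapP => [e|[y]]; last by rewrite mch' fe => ? ->.
  have [y ey] := (fs z).1 (finset.in_setT _).
  by exists y; rewrite // mch' fe ey.
apply: AlignMatch; last first.
  by apply: lerD (lexx _) _; apply: child_sum uch _ => // y; rewrite mch.
apply: (falign_maps (h := fun z => k *+ connect (edge T) c z) pch) => y.
rewrite mch' => ey; have := IH y ey (label T (f y) (f x)) (label T' y x).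
move/align_weaken; apply; rewrite fl //.
have eyx : edge T (f y) (f x) by rewrite -fe.
case: (f y =P c) => [ey'|/eqP ny] /=.
  rewrite -ey' in ecp *; rewrite (edge_fun ecp eyx) eqxx /= eqxx andbF addr0 connect0.
  by rewrite /k -ey' (edge_fun ecp eyx).
by rewrite subrr normr0 add0r eq_sym ny andbT.
Qed.


Lemma leaf_subtree c l : leaf c -> S c l = Rose l [::].
Proof.
case: hS => ch hch -> lf; have [_ mch] := hch c.
case e : (ch c) => [//|y s]; have : edge T y c by rewrite -mch e mem_head.
move/eqP: lf; rewrite /deg cards_eq0 => /eqP h ey.
have : y \in children (edge T) c by rewrite inE.
by rewrite h inE.
Qed.

(** The label of the removed edge is charged to the subtrees containing [c], including the one at
    [c] itself for [ccost] and excluding it for [cost]. Only at [p], or at [p'] if [p] is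
    suppressed, do the children of the two trees fail to correspond by [f]. *)
Lemma deletion_align k : deletion T k T' ->
  align (S (Defs.root T) 0) (S' (Defs.root T') 0) k.
Proof.
move=> [c [p [ecp lf pr -> del]]]; set k0 := label T c p.
have k0_ge : 0 <= k0 by apply/ltW/edge_label_gt0.
case: hS => ch hch eS; case: hS' => ch' hch' eS'.
pose cost v := k0 *+ (connect (edge T) c v && (c != v)).
pose ccost v := k0 *+ connect (edge T) c v.
have cost_le v : cost v <= ccost v.
  by rewrite /cost /ccost; case: connect => //=; case: (c != v).
suff [f fr H] : exists2 f : T' -> T, f (Defs.root T') = Defs.root T &
    forall x l, align (S (f x) l) (S' x l) (cost (f x)).
  rewrite -fr; apply: align_weaken (H _ _) _; rewrite /cost.
  by case: (_ && _).
have sum_le v : \sum_(y <- ch v) ccost y <= cost v.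
  have [uch mch] := hch v.
  by apply: child_sum => // y; rewrite mch.
have node x l f : injective f -> perm_eq (ch (f x)) (map f (ch' x)) ->
    (forall y, y \in ch' x -> label T' y x = label T (f y) (f x)) ->
    (forall y, edge T' y x -> forall l, align (S (f y) l) (S' y l) (cost (f y))) ->
    align (S (f x) l) (S' x l) (cost (f x)).
  move=> fi pch lE IH; rewrite eS eS'; apply: AlignMatch; last first.
    by rewrite subrr normr0 add0r; apply: (sum_le (f x)).
  apply: (falign_maps (h := ccost) pch) => y hy; rewrite lE //.
  by apply: align_weaken (cost_le _); apply: IH; rewrite -(proj2 (hch' x)).
case: del => [[_ [f [fi fs fr fe fl]]]|[c' [p' [hc' epp' [f [fi fs fr fe fl]]]]]].
  exists f => // x; elim/tree_ind_up: x => x IH l.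
  have fc y : f y != c.
    by have : f y \in [set~ c]%SET; [apply/fs; exists y | rewrite !inE].
  have [uch mch] := hch (f x); have [uch' mch'] := hch' x.
  have mimg z : z \in map f (ch' x) = edge T z (f x) && (z != c).
    apply/mapP/andP => [[y]|[e zc]]; first by rewrite mch' fe => e ->; rewrite fc.
    have [y ey] : exists y, f y = z by apply/fs; rewrite !inE.
    by exists y; rewrite // mch' fe ey.
  have uimg : uniq (map f (ch' x)) by rewrite map_inj_uniq.
  have [fxp|fxp] := eqVneq (f x) p.
    have pch : perm_eq (ch (f x)) (c :: map f (ch' x)).
      apply: uniq_perm => //; first by rewrite /= uimg mimg eqxx andbF.
      move=> z; rewrite mch inE mimg; case: eqP => [->|_]; last by rewrite andbT.
      by rewrite fxp ecp.
    have := sum_le (f x); rewrite (perm_big _ pch) big_cons => sle.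
    rewrite eS eS'; apply: AlignMatch; last first.
      by rewrite subrr normr0 add0r; apply: sle.
    apply: falign_perml (Permutation_sym (Permutation_map _ (perm_eq_Permutation pch))) => /=.
    apply: FalignDel.
      apply: (falign_maps (h := ccost) (perm_refl _)) => y hy.
      rewrite fl -?mch' //.
      by apply: align_weaken (cost_le _); apply: IH; rewrite -mch'.
    by rewrite lerD2r leaf_subtree //= addr0 fxp /ccost connect0.
  apply: node => //.
  - apply: uniq_perm => // z; rewrite mch mimg; case: (z =P c) => [->|_]; last by rewrite andbT.
    by rewrite andbF; apply: contraNF fxp => e; rewrite (edge_fun e ecp).
  - by move=> y; rewrite mch' => /fl.
exists f => // x; elim/tree_ind_up: x => x IH l.
have hc'2 z : z \in children (edge T) p :\ c = (z == c') by rewrite hc' inE.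
have [c'c ec'p] : c' != c /\ edge T c' p.
  by have := hc'2 c'; rewrite !inE eqxx => /andP[].
have im z : (z != c) && (z != p) <-> exists y, f y = z.
  by rewrite -fs !inE negb_or.
have fcp y : (f y != c) && (f y != p) by apply/im; exists y.
have pc : p != c by rewrite eq_sym; apply: edge_neq.
have [uch mch] := hch (f x); have [uch' mch'] := hch' x.
have [fxp|fxp] := eqVneq (f x) p'; last first.
  apply: node => //.
  - apply: uniq_perm; rewrite ?map_inj_uniq // => z; rewrite mch.
    apply/idP/mapP => [e|[y]]; last by rewrite mch' fe (negbTE fxp) andbF orbF => ? ->.
    have [y ey] : exists y, f y = z.
      apply/im; apply/andP; split; apply: contraNneq fxp => ez; rewrite ez in e.
        by have := fcp x; rewrite (edge_fun e ecp) eqxx andbF.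
      by rewrite (edge_fun e epp').
    by exists y; rewrite // mch' fe ey e.
  - by move=> y; rewrite mch' => /fl ->; rewrite (negbTE fxp) andbF.
(* The child [x'] of [x] stands for [c'] on its merged edge. On the left, the path through [p] is
   prolonged into [c'] and the leaf [c] is cut off as its sibling. *)
have [x' ex'] : exists y, f y = c'.
  apply/im; rewrite c'c; apply: contraTneq ec'p => ->.
  by apply/negP => /edge_neq; rewrite eqxx.
have ex'x : edge T' x' x by rewrite fe ex' fxp !eqxx orbT.
have pch' : perm_eq (ch' x) (x' :: rem x' (ch' x)).
  by apply: perm_to_rem; rewrite mch'.
have mrem y : y \in rem x' (ch' x) = (y != x') && edge T' y x.
  by rewrite mem_rem_uniq // inE mch'.
have pch : perm_eq (ch (f x)) (p :: map f (rem x' (ch' x))).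
  apply: uniq_perm => //.
    rewrite /= map_inj_uniq // rem_uniq // andbT; apply/mapP => -[y _ ey].
    by have := fcp y; rewrite -ey eqxx andbF.
  move=> z; rewrite mch inE; case: (z =P p) => [->|/eqP zp]; first by rewrite fxp.
  apply/idP/mapP => [e|[y]].
    have zc : z != c.
      apply: contraNneq (proj2 (andP (fcp x))) => ez; rewrite ez in e.
      by rewrite (edge_fun e ecp).
    have [y ey] : exists y, f y = z by apply/im; rewrite zc.
    exists y; rewrite // mrem fe ey e andbT; apply: contraTneq e => yx'.
    rewrite -ey yx' ex' fxp; apply/negP => /(edge_fun ec'p) pp'.
    by move: epp'; rewrite pp' => /edge_neq; rewrite eqxx.
  rewrite mrem fe => /andP[yx'] /orP[e -> //|/andP[/eqP e _]].
  by case/eqP: yx'; apply: fi; rewrite e ex'.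
have := sum_le (f x); rewrite (perm_big _ pch) big_cons => sle.
rewrite eS eS'; apply: AlignMatch; last first.
  by rewrite subrr normr0 add0r; apply: sle.
apply: falign_perml (Permutation_sym (Permutation_map _ (perm_eq_Permutation pch))) => /=.
apply: (falign_permr (us := map (fun y => S' y (label T' y x)) (x' :: rem x' (ch' x)))); last first.
  exact: (Permutation_sym (Permutation_map _ (perm_eq_Permutation pch'))).
apply: FalignMatch; first exact: Permutation_refl; last exact: lexx.
- have [uchp mchp] := hch p.
  have pchp : perm_eq (ch p) [:: c'; c].
    apply: uniq_perm => //; first by rewrite /= inE c'c.
    move=> z; rewrite mchp !inE; have := hc'2 z; rewrite !inE.
    by case: (z =P c) => [->|_] /=; rewrite ?ecp ?orbT // orbF.
  have -> : label T' x' x = label T p p' + label T c' p.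
    by rewrite fl // ex' fxp !eqxx addrC.
  have := IH x' ex'x (label T p p' + label T c' p); rewrite ex' eS fxp.
  rewrite (_ : cost c' = 0); last first.
    rewrite /cost; case cc : (connect _ c c') => //=.
    by case/eqP: c'c; apply: sibling_eq ec'p ecp cc (connect0 _ _).
  rewrite [S p _]eS => h; apply: AlignDownL h _.
    apply: Permutation_trans (Permutation_map _ (perm_eq_Permutation pchp)) _.
    by rewrite /= [S c' _]eS; apply: Permutation_refl.
  by rewrite leaf_subtree //= !addr0 add0r /ccost connect1.
- apply: (falign_maps (h := ccost) (perm_refl _)) => y; rewrite mrem => /andP[yx' ey].
  have fyc : f y != c' by apply: contraNneq yx' => e; apply/eqP/fi; rewrite e ex'.
  rewrite fl // (negbTE fyc) /=.
  by apply: align_weaken (cost_le _); apply: IH.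
Qed.

End OperationAlign.

Section SequenceAlign.

Variable R : realType.

Lemma edit_operation_align (T T' : merge_tree R) k S S' :
  subtrees (T := T) S -> subtrees (T := T') S' -> edit_operation T k T' ->
  align (S (Defs.root T) 0) (S' (Defs.root T') 0) k.
Proof.
move=> hS hS' [[c [p [a [e _ -> i]]]]|d|d].
- exact: relabel_align i.
- exact: deletion_align d.
- by apply: align_sym; apply: deletion_align d.
Qed.

Lemma edit_sequence_align (T T' : merge_tree R) k : edit_sequence T k T' ->
  forall S S', subtrees (T := T) S -> subtrees (T := T') S' ->
  align (S (Defs.root T) 0) (S' (Defs.root T') 0) k.
Proof.
elim=> {T T' k} [T T' /isomorphic_relabel r|T k T1 k' T2 o _ IH] S S' hS hS'.
  by apply: edit_operation_align hS hS' _; constructor 1.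
have [S1 hS1] := subtrees_exist T1.
apply: align_trans (edit_operation_align hS hS1 o) (IH _ _ hS1 hS');
  exact: subtrees_nonneg.
Qed.

End SequenceAlign.

(** * Parent arrays *)

Section ParentArray.

Variable R : realType.

(** The interface between trees and programs: what the two input arrays of one tree say about it.
    The depths [dep] serve as fuel and as a measure for induction; the program does not compute
    them. *)
Record parent_tree (N : nat) (par : nat -> nat) (lb : nat -> R) (r : nat)
    (dep : nat -> nat) : Prop := ParentTree {
  pt_root_lt : (r < N)%N;
  pt_par_root : par r = r;
  pt_lab_root : lb r = 0;
  pt_par_lt : forall v, (v < N)%N -> (par v < N)%N;
  pt_lab_gt0 : forall v, (v < N)%N -> v != r -> 0 < lb v;
  pt_dep_lt : forall v, (v < N)%N -> (dep v < N)%N;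
  pt_dep_root : dep r = 0%N;
  pt_dep_par : forall v, (v < N)%N -> v != r -> dep v = (dep (par v)).+1;
  pt_root_child : exists c, [/\ (c < N)%N, c != r, par c = r &
    forall u, (u < N)%N -> u != r -> par u = r -> u = c];
  pt_sibling : forall v, (v < N)%N -> v != r -> par v != r ->
    exists w, [/\ (w < N)%N, w != r, w != v, par w = par v &
      forall u, (u < N)%N -> u != r -> par u = par v -> u = v \/ u = w]
}.

(* [c0 v] is one more than the number of a child of [v], and [0] if there is none. *)
Record child_arrays (N : nat) (par : nat -> nat) (r : nat) (c0 c1 : nat -> nat) : Prop :=
    ChildArrays {
  ca_inner : forall v, (v < N)%N -> v != r -> c0 (par v) != 0%N;
  ca_fst : forall v, (v < N)%N -> c0 v != 0%N ->
    [/\ ((c0 v).-1 < N)%N, (c0 v).-1 != r & par (c0 v).-1 = v];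
  ca_snd : forall v, (v < N)%N -> v != r -> c0 v != 0%N ->
    [/\ (c1 v < N)%N, c1 v != r, par (c1 v) = v & c1 v != (c0 v).-1]
}.

Section Tree.

Variables (N : nat) (par : nat -> nat) (lb : nat -> R) (r : nat) (dep : nat -> nat).
Hypothesis pt : parent_tree N par lb r dep.
Variables (c0 c1 : nat -> nat).
Hypothesis ca : child_arrays N par r c0 c1.

Fixpoint btree_fuel (n v : nat) : btree R :=
  if n is n'.+1 then
    if c0 v == 0%N then Lf v (lb v)
    else Br v (lb v) (btree_fuel n' (c0 v).-1) (btree_fuel n' (c1 v))
  else Lf v (lb v).

(** As depths stay below [N], the fuel never runs out at a vertex. *)
Definition btree_at v := btree_fuel (N - dep v) v.

Lemma btree_atE v : (v < N)%N -> v != r ->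
  btree_at v = if c0 v == 0%N then Lf v (lb v)
               else Br v (lb v) (btree_at (c0 v).-1) (btree_at (c1 v)).
Proof.
move=> vN vr; have := pt_dep_lt pt vN; rewrite /btree_at.
case e : (N - dep v)%N => [|n]; first by rewrite -subn_gt0 e.
move=> _ /=; case: eqP => // /eqP n0.
have [fN fr fp] := ca_fst ca vN n0; have [sN sr sp _] := ca_snd ca vN vr n0.
by rewrite (pt_dep_par pt fN fr) (pt_dep_par pt sN sr) fp sp !subnS e.
Qed.

Lemma children_pair v u : (v < N)%N -> v != r -> (u < N)%N -> u != r -> par u = v ->
  u = (c0 v).-1 \/ u = c1 v.
Proof.
move=> vN vr uN ur pu.
have n0 : c0 v != 0%N by rewrite -pu; apply: (ca_inner ca).
have [fN fr fp] := ca_fst ca vN n0; have [sN sr sp sf] := ca_snd ca vN vr n0.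
have pfr : par (c0 v).-1 != r by rewrite fp.
have [w [wN wr wf pw H]] := pt_sibling pt fN fr pfr.
have [e|ew] := H u uN ur (etrans pu (esym fp)); first by left.
have [e|e] := H _ sN sr (etrans sp (esym fp)); first by case/eqP: sf.
by right; rewrite ew e.
Qed.

Lemma parent_tree_ind (P : nat -> Prop) :
  (forall v, (v < N)%N -> v != r ->
     (forall c, (c < N)%N -> c != r -> par c = v -> P c) -> P v) ->
  forall v, (v < N)%N -> v != r -> P v.
Proof.
move=> H v; move: {2}(N - dep v)%N (leqnn (N - dep v)%N) => n.
elim: n v => [|n IH] v le vN vr; first by have := pt_dep_lt pt vN; lia.
apply: H => // c cN cr pc; apply: IH => //.
have := pt_dep_par pt cN cr; rewrite pc; have := pt_dep_lt pt cN; lia.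
Qed.

Lemma btree_at_ind (P : nat -> btree R -> Prop) :
  (forall v, (v < N)%N -> v != r -> c0 v = 0%N -> P v (Lf v (lb v))) ->
  (forall v a b, (v < N)%N -> v != r -> c0 v != 0%N ->
     [/\ ((c0 v).-1 < N)%N, (c0 v).-1 != r & par (c0 v).-1 = v] ->
     [/\ (c1 v < N)%N, c1 v != r, par (c1 v) = v & c1 v != (c0 v).-1] ->
     a = btree_at (c0 v).-1 -> b = btree_at (c1 v) ->
     P (c0 v).-1 a -> P (c1 v) b -> P v (Br v (lb v) a b)) ->
  forall v, (v < N)%N -> v != r -> P v (btree_at v).
Proof.
move=> H0 H1; apply: parent_tree_ind => v vN vr IH; rewrite btree_atE //.
case: eqP => [e|/eqP n0]; first exact: H0.
have f := ca_fst ca vN n0; have s := ca_snd ca vN vr n0.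
by apply: H1 => //; apply: IH; by case: f => // *; case: s.
Qed.

Lemma top_len_at v : (v < N)%N -> v != r -> top_len (btree_at v) = lb v.
Proof. by move=> vN vr; rewrite btree_atE //; case: ifP. Qed.

Lemma positive_at v : (v < N)%N -> v != r -> positive (btree_at v).
Proof.
move: v; apply: (btree_at_ind (P := fun _ b => positive b))
  => [v vN vr _|v a b vN vr _ _ _ _ _ /= -> ->] /=.
  exact: (pt_lab_gt0 pt).
by rewrite (pt_lab_gt0 pt).
Qed.

(** Recovering [v] from any vertex below it by climbing shows that the subtrees of siblings are
    disjoint, hence that names do not repeat. *)
Lemma ids_at v : (v < N)%N -> v != r -> forall x, x \in ids (btree_at v) ->
  [/\ (x < N)%N, x != r, (dep v <= dep x)%N & iter (dep x - dep v)%N par x = v].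
Proof.
move: v; apply: (btree_at_ind (P := fun v b => forall x, x \in ids b ->
  [/\ (x < N)%N, x != r, (dep v <= dep x)%N & iter (dep x - dep v)%N par x = v]))
  => [v vN vr _|v a b vN vr _ [fN fr fp] [sN sr sp _] _ _ IHa IHb] x /=.
  by rewrite inE => /eqP ->; rewrite subnn.
have df := pt_dep_par pt fN fr; have ds := pt_dep_par pt sN sr.
rewrite fp in df; rewrite sp in ds.
rewrite inE mem_cat => /or3P[/eqP ->|/IHa|/IHb]; first by rewrite subnn.
  case=> xN xr; rewrite df => le e; split=> //; first by apply: ltnW.
  by rewrite (_ : dep x - dep v = (dep x - (dep v).+1).+1)%N ?iterS ?e //; lia.
case=> xN xr; rewrite ds => le e; split=> //; first by apply: ltnW.
by rewrite (_ : dep x - dep v = (dep x - (dep v).+1).+1)%N ?iterS ?e //; lia.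
Qed.

Lemma uniq_ids_at v : (v < N)%N -> v != r -> uniq (ids (btree_at v)).
Proof.
move: v; apply: (btree_at_ind (P := fun _ b => uniq (ids b)))
  => [//|v a b vN vr _ [fN fr fp] [sN sr sp sf] ea eb IHa IHb] /=.
have df := pt_dep_par pt fN fr; have ds := pt_dep_par pt sN sr.
rewrite fp in df; rewrite sp in ds.
rewrite mem_cat negb_or cat_uniq IHa IHb andbT /=.
apply/andP; split; last first.
  apply/hasPn => x; rewrite eb => /(ids_at sN sr) [_ _ _ e1].
  apply/negP; rewrite ea => /(ids_at fN fr) [_ _ _ e2].
  by case/eqP: sf; rewrite -e1 -e2 df ds.
apply/andP; split; apply/negP.
  by rewrite ea => /(ids_at fN fr) [_ _]; rewrite df ltnn.
by rewrite eb => /(ids_at sN sr) [_ _]; rewrite ds ltnn.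
Qed.

Lemma bedges_at v : (v < N)%N -> v != r ->
  bedges (par v) (btree_at v) = [seq (x, par x, lb x) | x <- ids (btree_at v)].
Proof.
move: v; apply: (btree_at_ind (P := fun v b => bedges (par v) b = [seq (x, par x, lb x) | x <- ids b]))
  => [//|v a b vN vr _ [fN fr fp] [sN sr sp sf] ea eb IHa IHb] /=.
by rewrite map_cat -IHa -IHb fp sp.
Qed.

Lemma self_in_ids v : (v < N)%N -> v != r -> v \in ids (btree_at v).
Proof. by move=> vN vr; rewrite btree_atE //; case: ifP; rewrite /= inE eqxx. Qed.

Lemma child_in_ids v : (v < N)%N -> v != r -> forall c p, p \in ids (btree_at v) ->
  (c < N)%N -> c != r -> par c = p -> c \in ids (btree_at v).
Proof.
move: v; apply: (btree_at_ind (P := fun v b => forall c p, p \in ids b ->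
  (c < N)%N -> c != r -> par c = p -> c \in ids b))
  => [v vN vr e0|v a b vN vr n0 [fN fr fp] [sN sr sp sf] ea eb IHa IHb] c p /=.
  rewrite inE => /eqP -> cN cr pc.
  by have := ca_inner ca cN cr; rewrite pc e0.
rewrite !inE !mem_cat => /or3P[/eqP ->|pa|pb] cN cr pc.
- have [->|->] := children_pair vN vr cN cr pc.
    by rewrite ea (self_in_ids fN fr) orbT.
  by rewrite eb (self_in_ids sN sr) !orbT.
- by rewrite (IHa _ _ pa) // orbT.
- by rewrite (IHb _ _ pb) // !orbT.
Qed.

Lemma all_ids c : (c < N)%N -> c != r -> par c = r ->
  (forall u, (u < N)%N -> u != r -> par u = r -> u = c) ->
  forall v, (v < N)%N -> v != r -> v \in ids (btree_at c).
Proof.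
move=> cN cr pc uc v; move: {2}(dep v) (leqnn (dep v)) => n.
elim: n v => [|n IH] v le vN vr; have dv := pt_dep_par pt vN vr; first by lia.
have [pr|pr] := eqVneq (par v) r.
  by rewrite (uc v) // (self_in_ids cN cr).
apply: (child_in_ids cN cr (p := par v)) => //.
by apply: IH; rewrite ?(pt_par_lt pt) //; lia.
Qed.

Lemma well_formed_at c : (c < N)%N -> c != r -> well_formed r (btree_at c).
Proof.
move=> cN cr; rewrite /well_formed /= uniq_ids_at // positive_at // !andbT.
by apply/negP => /(ids_at cN cr) [_]; rewrite eqxx.
Qed.

End Tree.

End ParentArray.

(** * Numbered merge trees as parent arrays *)

Section Numbered.

Variables (R : realType) (T : merge_tree R) (e : seq T).
Hypothesis bin : binary T.
Hypothesis num : numbering e.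

Let N := nvertices T.
Let par n := nth 0%N (parent_array e) n.
Let lb n := nth 0 (label_array e) n.
Let vert n := nth (Defs.root T) e n.
Let idx (v : T) := index v e.
Let r := idx (Defs.root T).
Let dep n := depth (vert n).

Lemma size_numbering : size e = N.
Proof.
have [ue me] := num; rewrite -(card_uniqP ue) /N /nvertices.
by apply: eq_card => v; rewrite !inE me.
Qed.

Lemma idx_lt v : (idx v < N)%N.
Proof. by have [_ me] := num; rewrite -size_numbering index_mem. Qed.

Lemma vertK n : (n < N)%N -> idx (vert n) = n.
Proof. by have [ue _] := num; move=> h; rewrite /idx index_uniq ?size_numbering. Qed.

Lemma idxK v : vert (idx v) = v.
Proof. by have [_ me] := num; rewrite /vert nth_index. Qed.

Lemma idx_inj : injective idx.
Proof. exact: can_inj idxK. Qed.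

Lemma vert_root n : (n < N)%N -> (vert n == Defs.root T) = (n == r).
Proof.
by move=> h; apply/eqP/eqP => [en|->]; [rewrite -(vertK h) en | rewrite idxK].
Qed.

Lemma par_idx v : par (idx v) = idx (parent v).
Proof.
rewrite /par /parent_array (nth_map (Defs.root T)) ?size_numbering ?idx_lt //.
by rewrite -/(vert _) idxK.
Qed.

Lemma parE n : (n < N)%N -> par n = idx (parent (vert n)).
Proof. by move=> h; rewrite -{1}(vertK h) par_idx. Qed.

Lemma edgeE c p : edge T c p = (c != Defs.root T) && (parent c == p).
Proof.
apply/idP/andP => [h|[cr /eqP <-]]; last exact: edge_parent.
by rewrite (edge_root h) (parentE h).
Qed.

Lemma lb_idx c : c != Defs.root T -> lb (idx c) = label T c (parent c).
Proof.
move=> cr; rewrite /lb /label_array (nth_map (Defs.root T)) ?size_numbering ?idx_lt //.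
rewrite -/(vert _) idxK; have := edge_parent cr; rewrite /parent.
by case: pickP => // h; rewrite h.
Qed.

Lemma merge_tree_deg v : deg (edge T) v = (if v == Defs.root T then 1%N else deg (edge T) v).
Proof. by case: eqP => // ->; case: T. Qed.

Lemma numbered_parent_tree : parent_tree N par lb r dep.
Proof.
have vr n : (n < N)%N -> n != r -> vert n != Defs.root T by move=> h; rewrite vert_root.
have ev n : (n < N)%N -> n != r -> edge T (vert n) (parent (vert n)).
  by move=> nN nr; apply: edge_parent; apply: vr.
split.
- exact: idx_lt.
- by rewrite par_idx parent_root.
- rewrite /lb /label_array (nth_map (Defs.root T)) ?size_numbering ?idx_lt //.
  by rewrite -/(vert _) idxK; case: pickP => // p; rewrite root_no_parent.
- by move=> n h; rewrite parE // idx_lt.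
- move=> n nN nr; rewrite -(vertK nN) lb_idx ?vr //.
  by apply: edge_label_gt0; apply: ev.
- by move=> n _; apply: depth_lt.
- by rewrite /dep idxK depth_root.
- by move=> n nN nr; rewrite /dep parE // idxK (depth_edge (ev n nN nr)).
- have /eqP/cards1P [c hc] : deg (edge T) (Defs.root T) = 1%N by rewrite merge_tree_deg eqxx.
  have ec : edge T c (Defs.root T) by have := set11 c; rewrite -hc inE.
  exists (idx c); split.
  + exact: idx_lt.
  + by rewrite (inj_eq idx_inj) (edge_root ec).
  + by rewrite par_idx (parentE ec).
  + move=> u uN ur; rewrite parE // => /idx_inj pu.
    rewrite -(vertK uN); congr idx; apply/set1P; rewrite -hc inE -pu.
    exact: ev.
- move=> n nN nr; rewrite parE // => pr.
  have pr' : parent (vert n) != Defs.root T by rewrite -(inj_eq idx_inj).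
  have d2 : deg (edge T) (parent (vert n)) = 2.
    case: (bin pr') => // /eqP; rewrite cards_eq0 => /eqP h0.
    have : vert n \in children (edge T) (parent (vert n)) by rewrite inE ev.
    by rewrite h0 inE.
  have mn : vert n \in children (edge T) (parent (vert n)) by rewrite inE ev.
  have /cards1P [w hw] : #|children (edge T) (parent (vert n)) :\ vert n| == 1%N.
    by move: d2; rewrite /deg (cardsD1 (vert n)) mn add1n => -[->].
  have := set11 w; rewrite -hw !inE => /andP[wn ew].
  exists (idx w); split.
  + exact: idx_lt.
  + by rewrite (inj_eq idx_inj) (edge_root ew).
  + by rewrite -(vertK nN) (inj_eq idx_inj).
  + by rewrite par_idx (parentE ew).
  + move=> u uN ur; rewrite parE // => /idx_inj pu.
    have [->|un] := eqVneq u n; first by left.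
    right; rewrite -(vertK uN); congr idx; apply/set1P; rewrite -hw !inE -pu ev // andbT.
    by rewrite -(inj_eq idx_inj) !vertK.
Qed.

Variables (c0 c1 : nat -> nat).
Hypothesis ca : child_arrays N par r c0 c1.

Let bt := btree_at N lb dep c0 c1.

Variable c : nat.
Hypotheses (cN : (c < N)%N) (cr : c != r) (pc : par c = r)
  (uc : forall u, (u < N)%N -> u != r -> par u = r -> u = c).

Let pt := numbered_parent_tree.

Let wf : well_formed r (bt c) := well_formed_at pt ca cN cr.

Lemma mem_all_ids n : (n < N)%N -> n \in r :: ids (bt c).
Proof.
move=> nN; rewrite inE; case: (n =P r) => //= /eqP nr.
exact: (all_ids pt ca cN cr pc uc).
Qed.

Lemma ids_lt n : n \in r :: ids (bt c) -> (n < N)%N.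
Proof.
rewrite inE => /orP[/eqP ->|/(ids_at pt ca cN cr)[] //]; exact: idx_lt.
Qed.

Lemma bedges_numbered : bedges r (bt c) = [seq (x, par x, lb x) | x <- ids (bt c)].
Proof. by rewrite -pc; apply: (bedges_at pt ca cN cr). Qed.

Lemma edge_numbered x y : edge T x y = ((idx x, idx y) \in links (bedges r (bt c))).
Proof.
rewrite edgeE bedges_numbered; apply/andP/linksP => [[xr /eqP <-]|[l /mapP [z hz [ex ey _]]]].
  exists (lb (idx x)); apply/mapP; exists (idx x); last by rewrite par_idx.
  have := mem_all_ids (idx_lt x); rewrite inE => /orP[/eqP/idx_inj ex|//].
  by rewrite ex eqxx in xr.
have [zN zr _ _] := ids_at pt ca cN cr hz.
split; first by rewrite -(inj_eq idx_inj) ex.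
by apply/eqP/idx_inj; rewrite -par_idx ex ey.
Qed.

Lemma label_numbered x y : edge T x y -> label T x y = Defs.label (realization wf)
  (SeqSub (mem_all_ids (idx_lt x))) (SeqSub (mem_all_ids (idx_lt y))).
Proof.
move=> h /=; have := h; rewrite edge_numbered => /linksP [l hl].
have uq : uniq [seq e.1.1 | e <- bedges r (bt c)].
  by rewrite bedges_child; case/andP: wf => /= /andP[].
rewrite (labE uq hl); move: hl; rewrite bedges_numbered => /mapP [z _ [<- _ ->]].
by rewrite lb_idx ?(edge_root h) // (parentE h).
Qed.

Lemma numbered_isomorphic_from : isomorphic (realization wf) T.
Proof.
exists (fun x => SeqSub (mem_all_ids (idx_lt x)) : realization wf); split.
- by move=> x y /(congr1 val) /= /idx_inj.
- move=> x; rewrite inE; split=> // _; have xN := ids_lt (ssvalP x).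
  by exists (vert (ssval x)); apply: val_inj; rewrite /= vertK.
- exact: val_inj.
- by move=> x y; rewrite edge_numbered.
- exact: label_numbered.
Qed.

Lemma numbered_isomorphic_to : isomorphic T (realization wf).
Proof.
have H (x : realization wf) : idx (vert (val x)) = val x by apply/vertK/ids_lt/ssvalP.
exists (fun x : realization wf => vert (val x)); split.
- by move=> x y /(congr1 idx); rewrite !H => /val_inj.
- move=> v; rewrite inE; split=> // _.
  by exists (SeqSub (mem_all_ids (idx_lt v))); rewrite /= idxK.
- by rewrite /= idxK.
- by move=> x y; rewrite edge_numbered !H.
- move=> x y h; have h' : edge T (vert (val x)) (vert (val y)) by rewrite edge_numbered !H.
  rewrite (label_numbered h'); by congr (Defs.label _ _ _); apply: val_inj; symmetry; apply: H.
Qed.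

(** Lists the children in the order of [c0] and [c1], so that the trees aligned for the lower bound
    are literally those on which the recursion works, up to the extra edge of length [0] at the
    root. *)
Lemma numbered_subtrees : exists2 S, subtrees (T := T) S &
  S (Defs.root T) 0 = Rose 0 [:: rose_of (bt c)].
Proof.
pose ch v := if v == Defs.root T then [:: vert c] else
  if c0 (idx v) == 0%N then [::] else [:: vert (c0 (idx v)).-1; vert (c1 (idx v))].
exists (fun v l => if v == Defs.root T then Rose l [:: rose_of (bt c)]
                   else rose_of (set_len l (bt (idx v)))); last by rewrite eqxx.
have ce u v : edge T u v = (idx u != r) && (par (idx u) == idx v).
  by rewrite edgeE par_idx !(inj_eq idx_inj).
have vx n v : (n < N)%N -> (v == vert n) = (idx v == n).
  by move=> nN; rewrite -(inj_eq idx_inj) vertK.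
exists ch => v.
  rewrite /ch; have [->|vr] := eqVneq v (Defs.root T).
    split=> // u; rewrite inE vx // ce; apply/eqP/andP => [->|[ur /eqP]]; first by rewrite cr pc.
    by move/uc => ->; rewrite // idx_lt.
  have ir : idx v != r by rewrite (inj_eq idx_inj).
  case: eqP => [e0|/eqP n0].
    split=> // u; rewrite in_nil ce; apply/esym/negP => /andP[ur /eqP pu].
    by have := ca_inner ca (idx_lt u) ur; rewrite pu e0.
  have [fN fr fp] := ca_fst ca (idx_lt v) n0.
  have [sN sr sp sf] := ca_snd ca (idx_lt v) ir n0.
  split=> [|u]; first by rewrite /= inE -(inj_eq idx_inj) !vertK // eq_sym sf.
  rewrite !inE !vx // ce; apply/orP/andP => [[] /eqP ->|[ur /eqP pu]].
  - by rewrite fr fp.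
  - by rewrite sr sp.
  - by case: (children_pair pt ca (idx_lt v) ir (idx_lt u) ur pu) => ->; [left|right]; apply: eqxx.
move=> l; rewrite /ch; have [->|vr] := eqVneq v (Defs.root T).
  rewrite /= vert_root // (negbTE cr) vertK //; congr (Rose _ [:: rose_of _]).
  have ec : edge T (vert c) (Defs.root T) by rewrite ce vertK // cr pc /=.
  rewrite -(parentE ec) -lb_idx ?vert_root // vertK //.
  by rewrite -(top_len_at pt ca cN cr) set_len_top.
have ir : idx v != r by rewrite (inj_eq idx_inj).
rewrite /bt (btree_atE pt ca (idx_lt v) ir); case: eqP => [//|/eqP n0].
have [fN fr fp] := ca_fst ca (idx_lt v) n0.
have [sN sr sp sf] := ca_snd ca (idx_lt v) ir n0.
have H n : (n < N)%N -> n != r -> par n = idx v ->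
    (if vert n == Defs.root T then Rose (label T (vert n) v) [:: rose_of (btree_at N lb dep c0 c1 c)]
     else rose_of (set_len (label T (vert n) v) (btree_at N lb dep c0 c1 (idx (vert n))))) =
    rose_of (btree_at N lb dep c0 c1 n).
  move=> nN nr pn; rewrite vert_root // (negbTE nr) vertK //.
  have ec : edge T (vert n) v by rewrite ce vertK // nr pn /=.
  rewrite -(parentE ec) -lb_idx ?vert_root // vertK //.
  by rewrite -(top_len_at pt ca nN nr) set_len_top.
by rewrite /= !H.
Qed.

End Numbered.

(** * The distance as the value of the recursion *)

Section Distance.

Variable R : realType.

Lemma falign_refl n (ts : seq (rose R)) : (fsize ts < n)%N -> falign ts ts 0.
Proof.
elim: n ts => // n IH [|[l us] ts] sz; first exact: FalignNil.
apply: (@FalignMatch _ _ _ _ _ _ 0 0 _ (Permutation_refl _)); last by rewrite addr0.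
  apply: (@AlignMatch _ _ _ _ _ 0); last by rewrite subrr normr0 addr0.
  by apply: IH; move: sz => /=; rewrite -!/(fsize _); lia.
by apply: IH; move: sz => /=; rewrite -!/(fsize _); lia.
Qed.

(** The path through the edge of length [0] is prolonged into its only child, with nothing to cut
    off; this removes the artificial edge at the root. *)
Lemma align_single (t : rose R) : align t (Rose 0 [:: t]) 0.
Proof.
case: t => m us; apply: (AlignDownR (Permutation_refl _) (k := 0)); last by rewrite addr0.
rewrite add0r; apply: (@AlignMatch _ _ _ _ _ 0); last by rewrite subrr normr0 addr0.
exact: falign_refl (ltnSn _).
Qed.

Lemma rose_of_nonneg (b : btree R) : positive b -> nonneg_labels (rose_of b).
Proof.
elim: b => [i l|i l a IHa c IHc] /=; first by move=> /ltW ->.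
by move=> /and3P[/ltW -> /IHa -> /IHc ->].
Qed.

Section Numbered.

Variables (T1 T2 : merge_tree R) (e1 : seq T1) (e2 : seq T2).
Hypotheses (bin1 : binary T1) (bin2 : binary T2) (num1 : numbering e1) (num2 : numbering e2).

Let par1 n := nth 0%N (parent_array e1) n.
Let par2 n := nth 0%N (parent_array e2) n.
Let lb1 n := nth 0 (label_array e1) n.
Let lb2 n := nth 0 (label_array e2) n.
Let dep1 n := depth (nth (Defs.root T1) e1 n).
Let dep2 n := depth (nth (Defs.root T2) e2 n).
Let r1 := index (Defs.root T1) e1.
Let r2 := index (Defs.root T2) e2.

(** Joining the two trees gives an edit sequence of exactly this cost. Conversely, any sequence
    gives an alignment of the trees with their artificial root edges, and composing it with
    [align_single] on both sides removes these edges. *)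
Lemma distance_bdist (c0 c1 d0 d1 : nat -> nat) (c d : nat) :
  child_arrays (nvertices T1) par1 r1 c0 c1 -> child_arrays (nvertices T2) par2 r2 d0 d1 ->
  (c < nvertices T1)%N -> c != r1 -> par1 c = r1 ->
  (d < nvertices T2)%N -> d != r2 -> par2 d = r2 ->
  one_degree_distance T1 T2 =
    (bdist (btree_at (nvertices T1) lb1 dep1 c0 c1 c)
           (btree_at (nvertices T2) lb2 dep2 d0 d1 d) (lb1 c) (lb2 d))%:E.
Proof.
move=> ca1 ca2 cN cr pc dN dr pd.
have pt1 := numbered_parent_tree bin1 num1; have pt2 := numbered_parent_tree bin2 num2.
have uc u : (u < nvertices T1)%N -> u != r1 -> par1 u = r1 -> u = c.
  have [x [_ _ _ h]] := pt_root_child pt1.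
  by move=> uN ur pu; rewrite (h u uN ur pu) (h c cN cr pc).
have ud u : (u < nvertices T2)%N -> u != r2 -> par2 u = r2 -> u = d.
  have [x [_ _ _ h]] := pt_root_child pt2.
  by move=> uN ur pu; rewrite (h u uN ur pu) (h d dN dr pd).
set b1 := btree_at _ lb1 _ _ _ _; set b2 := btree_at _ lb2 _ _ _ _.
have p1 : positive b1 := positive_at pt1 ca1 cN cr.
have p2 : positive b2 := positive_at pt2 ca2 dN dr.
have t1 : top_len b1 = lb1 c := top_len_at pt1 ca1 cN cr.
have t2 : top_len b2 = lb2 d := top_len_at pt2 ca2 dN dr.
have seq : edit_sequence T1 (bdist b1 b2 (lb1 c) (lb2 d)) T2.
  have : joinable (set_len (top_len b1) b1) (set_len (top_len b2) b2)
      (bdist b1 b2 (lb1 c) (lb2 d)).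
    rewrite t1 t2; apply: bdist_joinable => //.
      exact: (pt_lab_gt0 pt1 cN cr).
    exact: (pt_lab_gt0 pt2 dN dr).
  rewrite !set_len_top.
  have i1 := numbered_isomorphic_to bin1 num1 ca1 cN cr pc uc.
  have i2 := numbered_isomorphic_from bin2 num2 ca2 dN dr pd ud.
  exact: (joinable_edit_sequence i1 i2).
apply/eqP; rewrite eq_le; apply/andP; split.
  by apply: ereal_inf_lbound; exists (bdist b1 b2 (lb1 c) (lb2 d)).
apply: le_ereal_inf_tmp => _ [k hk <-]; rewrite lee_fin.
have [S1 hS1 eS1] := numbered_subtrees bin1 num1 ca1 cN cr pc uc.
have [S2 hS2 eS2] := numbered_subtrees bin2 num2 ca2 dN dr pd ud.
have := edit_sequence_align hk hS1 hS2.
rewrite eS1 eS2 -/par1 -/par2 -/lb1 -/lb2 -/b1 -/b2 => h.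
have n1 := rose_of_nonneg p1; have n2 := rose_of_nonneg p2.
have n3 (t : rose R) : nonneg_labels t -> nonneg_labels (Rose 0 [:: t]).
  by move=> /= ->; rewrite lexx.
have h1 := align_trans n1 (n3 _ n1) (n3 _ n2) (align_single _) h.
have h2 := align_trans n1 (n3 _ n2) n2 h1 (align_sym (align_single _)).
rewrite add0r addr0 !rose_ofE t1 t2 in h2.
exact: bdist_le_align h2.
Qed.

End Numbered.

End Distance.

(** * Programs with bounded loops *)

(** With loops of known length the meaning of a command is a total function, [run], and its running
    time is bounded by its syntax. Correctness is proved for commands and carried over to programs
    once, in [exec_compile]. *)
Inductive cmd :=
| CSkip
| CN of nat & nexpr & nexpr
| CR of nat & nexpr & rexpr
| CSeq of cmd & cmd
| CIf of bexpr & cmd & cmd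
| CFor of nat & nat & cmd. (* counter, array holding the bound *)

Fixpoint compile (c : cmd) : program :=
  match c with
  | CSkip => Skip
  | CN a i e => NSet a i e
  | CR a i e => RSet a i e
  | CSeq c1 c2 => Seq (compile c1) (compile c2)
  | CIf b c1 c2 => If b (compile c1) (compile c2)
  | CFor i n c1 =>
    Seq (NSet i (NConst 0) (NConst 0))
      (While (BNot (BNatLe (NGet n (NConst 0)) (NGet i (NConst 0))))
         (Seq (compile c1)
            (NSet i (NConst 0) (NAdd (NGet i (NConst 0)) (NConst 1)))))
  end.

Fixpoint nmods (c : cmd) : seq nat :=
  match c with
  | CN a _ _ => [:: a]
  | CSeq c1 c2 | CIf _ c1 c2 => nmods c1 ++ nmods c2
  | CFor i _ c1 => i :: nmods c1
  | _ => [::]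
  end.

Fixpoint rmods (c : cmd) : seq nat :=
  match c with
  | CR a _ _ => [:: a]
  | CSeq c1 c2 | CIf _ c1 c2 => rmods c1 ++ rmods c2
  | CFor _ _ c1 => rmods c1
  | _ => [::]
  end.

(* Only the arrays [0] and [1], which are never written, bound loops. *)
Fixpoint admissible (c : cmd) : bool :=
  match c with
  | CN a _ _ => (1 < a)%N
  | CSeq c1 c2 | CIf _ c1 c2 => admissible c1 && admissible c2
  | CFor i n c1 => [&& (n <= 1)%N, (1 < i)%N, i \notin nmods c1 & admissible c1]
  | _ => true
  end.

(** A branching is charged with both arms. Each round of a loop adds [14]: the guard [6], the
    increment [6] and one step each for the sequence and the loop. The [11] consists of the
    initialisation [3], its sequencing [1] and the last, failing test [7]. *)
Fixpoint cost (B : nat -> nat) (c : cmd) : nat :=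
  match c with
  | CSkip => 1
  | CN _ i e => (nsteps i + nsteps e).+1
  | CR _ i e => (nsteps i + rsteps e).+1
  | CSeq c1 c2 => (cost B c1 + cost B c2).+1
  | CIf b c1 c2 => (bsteps b + (cost B c1 + cost B c2)).+1
  | CFor _ n c1 => (B n * (cost B c1 + 14) + 11)%N
  end.

Section Run.

Variable R : realType.
Implicit Type s : state R.

Definition setn s a i v : state R := State (update (nmem s) a i v) (rmem s).
Definition setr s a i v : state R := State (nmem s) (update (rmem s) a i v).

Fixpoint run (c : cmd) (s : state R) : state R :=
  match c with
  | CSkip => s
  | CN a i e => setn s a (neval s i) (neval s e)
  | CR a i e => setr s a (neval s i) (reval s e)
  | CSeq c1 c2 => run c2 (run c1 s)
  | CIf b c1 c2 => if beval s b then run c1 s else run c2 s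
  | CFor i n c1 =>
    iter (nmem s n 0) (fun s => let s' := run c1 s in setn s' i 0 (nmem s' i 0 + 1)%N)
      (setn s i 0 0%N)
  end.

Lemma nmem_run c s a k : a \notin nmods c -> nmem (run c s) a k = nmem s a k.
Proof.
elim: c s => //= [a' i e|c1 IH1 c2 IH2|b c1 IH1 c2 IH2|i n c1 IH] s.
- by rewrite inE /update => /negbTE ->.
- by rewrite mem_cat negb_or => /andP[h1 h2]; rewrite IH2 ?IH1.
- by rewrite mem_cat negb_or => /andP[h1 h2]; case: ifP => _; rewrite ?IH2 ?IH1.
- rewrite inE negb_or => /andP[ai h]; elim: (nmem s n 0) => /= [|m IHm].
    by rewrite /update (negbTE ai).
  by rewrite {1}/update (negbTE ai) /= IH.
Qed.

Lemma rmem_run c s a k : a \notin rmods c -> rmem (run c s) a k = rmem s a k.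
Proof.
elim: c s => //= [a' i e|c1 IH1 c2 IH2|b c1 IH1 c2 IH2|i n c1 IH] s.
- by rewrite inE /update => /negbTE ->.
- by rewrite mem_cat negb_or => /andP[h1 h2]; rewrite IH2 ?IH1.
- by rewrite mem_cat negb_or => /andP[h1 h2]; case: ifP => _; rewrite ?IH2 ?IH1.
- by move=> h; elim: (nmem s n 0) => //= m IHm; rewrite IH.
Qed.

Lemma admissible_bound c a : admissible c -> (a <= 1)%N -> a \notin nmods c.
Proof.
elim: c => //= [a' i e|c1 IH1 c2 IH2|b c1 IH1 c2 IH2|i n c1 IH].
- by move=> h h'; rewrite inE; lia.
- by move=> /andP[h1 h2] h; rewrite mem_cat negb_or IH1 ?IH2.
- by move=> /andP[h1 h2] h; rewrite mem_cat negb_or IH1 ?IH2.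
- by move=> /and4P[_ h1 _ h2] h; rewrite inE negb_or IH // andbT; lia.
Qed.

(** No admissible command writes the cells of the bounds and no body writes its own counter, so a
    loop makes exactly [B n] rounds. *)
Lemma exec_compile B c s : admissible c -> (forall n, (n <= 1)%N -> nmem s n 0 = B n) ->
  exists2 t, exec (compile c) s t (run c s) & (t <= cost B c)%N.
Proof.
elim: c s => /= [|a i e|a i e|c1 IH1 c2 IH2|b c1 IH1 c2 IH2|i n c1 IH] s ad hB.
- by exists 1%N => //; apply: ExecSkip.
- by eexists; [apply: ExecNSet | apply: leqnn].
- by eexists; [apply: ExecRSet | apply: leqnn].
- case/andP: ad => ad1 ad2; have [t1 e1 l1] := IH1 s ad1 hB.
  have [|t2 e2 l2] := IH2 (run c1 s) ad2.
    by move=> n n1; rewrite nmem_run ?admissible_bound // hB.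
  by exists (t1 + t2).+1; [exact: (ExecSeq e1 e2) | lia].
- case/andP: ad => ad1 ad2.
  have [t1 e1 l1] := IH1 s ad1 hB; have [t2 e2 l2] := IH2 s ad2 hB.
  exists (bsteps b + (if beval s b then t1 else t2)).+1; last by case: ifP => _; lia.
  by apply: ExecIf; case: (beval s b).
case/and4P: ad => n1 i1 iM ad1; rewrite hB //.
set body := fun s => _; set s0 := setn s i 0 0%N; set W := While _ _.
suff [t e l] : exists2 t, exec W s0 t (iter (B n) body s0) & (t <= B n * (cost B c1 + 14) + 7)%N.
  have e0 : exec (NSet i (NConst 0) (NConst 0)) s 3 s0 by exact: (ExecNSet i (NConst 0) (NConst 0) s).
  by exists (3 + t).+1; [exact: (ExecSeq e0 e) | lia].
have inv k : [/\ nmem (iter k body s0) i 0 = k &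
    forall m, (m <= 1)%N -> nmem (iter k body s0) m 0 = B m].
  elim: k => [|k [IHi IHb]] /=.
    split=> [|m m1]; first by rewrite /s0 /setn /= /update !eqxx.
    by rewrite /s0 /setn /= /update (_ : (m == i) = false) ?hB //; lia.
  split=> [|m m1].
    by rewrite /body /= /update !eqxx /= nmem_run // IHi addn1.
  rewrite /body /= /update (_ : (m == i) = false) /=; last by lia.
  by rewrite nmem_run ?admissible_bound // IHb.
have guard k : beval (iter k body s0) (BNot (BNatLe (NGet n (NConst 0)) (NGet i (NConst 0)))) = (k < B n)%N.
  by have [h1 h2] := inv k; rewrite /= h1 h2 // ltnNge.
have H m k : (k + m = B n)%N -> exists2 t,
    exec W (iter k body s0) t (iter (B n) body s0) & (t <= m * (cost B c1 + 14) + 7)%N.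
  elim: m k => [|m IHm] k ek.
    have <- : k = B n by lia.
    by eexists; [apply: ExecWhileFalse; rewrite guard; lia | move=> /=; lia].
  have [hi hb] := inv k; have [t1 e1 l1] := IH (iter k body s0) ad1 hb.
  have [|t2 e2 l2] := IHm k.+1; first by lia.
  have kB : (k < B n)%N by lia.
  rewrite -(guard k) in kB.
  have e3 := ExecNSet i (NConst 0) (NAdd (NGet i (NConst 0)) (NConst 1)) (run c1 (iter k body s0)).
  eexists; first exact: (ExecWhileTrue kB (ExecSeq e1 e3) e2).
  by move=> /=; lia.
by apply: (H (B n) 0%N).
Qed.

Lemma run_for (Inv : nat -> state R -> Prop) i n c s m : admissible (CFor i n c) ->
  nmem s n 0 = m ->
  Inv 0%N (setn s i 0 0%N) ->
  (forall j s, (j < m)%N -> nmem s i 0 = j -> nmem s n 0 = m -> Inv j s ->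
     Inv j.+1 (setn (run c s) i 0 j.+1)) ->
  Inv m (run (CFor i n c) s).
Proof.
case/and4P=> n1 i1 iM ad em I0 IS /=; rewrite em.
have ni : (n == i) = false by lia.
suff H k : (k <= m)%N -> let s' := iter k (fun s => let s' := run c s in
    setn s' i 0 (nmem s' i 0 + 1)%N) (setn s i 0 0%N) in
    [/\ nmem s' i 0 = k, nmem s' n 0 = m & Inv k s'] by have [] := H m (leqnn m).
elim: k => [_|k IH km] /=.
  by split=> //; rewrite /update ?eqxx // ni em.
have [h1 h2 h3] := IH (ltnW km); rewrite [nmem (run c _) i 0]nmem_run // h1 addn1; split.
- by rewrite /update !eqxx.
- by rewrite /update ni /= nmem_run ?h2 // admissible_bound.
- exact: IS.
Qed.

End Run.

Lemma update_eq (A : Type) (m : nat -> nat -> A) a i v j :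
  update m a i v a j = if j == i then v else m a j.
Proof. by rewrite /update eqxx. Qed.

Lemma update_ne (A : Type) (m : nat -> nat -> A) a i v b j : (b == a) = false ->
  update m a i v b j = m b j.
Proof. by rewrite /update => ->. Qed.

Ltac upd := repeat (rewrite update_eq || (rewrite update_ne; [|lia])).

Arguments update : simpl never.
Arguments run : simpl never.

(** * The algorithm *)

(* For the tree with index [t = 0, 1]: the arrays [par_arr], [fst_arr], [snd_arr],
   [ord_arr] and [root_arr] hold naturals; [lab_arr], [height_arr] and [below_arr]
   hold reals. Of the other arrays of naturals, [12] to [17] are scratch variables
   and [20] to [22] hold multiples; of those of reals, [7] is a minimum being
   computed and [8] is the table. *)
Notation par_arr t := t.+2.
Notation fst_arr t := t.+4.
Notation snd_arr t := t.+4.+2.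
Notation ord_arr t := t.+4.+4.
Notation root_arr t := t.+4.+4.+2.
Notation lab_arr t := t.
Notation height_arr t := t.+3.
Notation below_arr t := t.+4.+1.

Definition V (a : nat) : nexpr := NGet a (NConst 0).

Definition beq (e1 e2 : nexpr) : bexpr := BAnd (BNatLe e1 e2) (BNatLe e2 e1).

(** The root is recognised as its own parent. Numbers are stored increased by one because cells
    initially hold [0]. Of two children the later one overwrites the earlier, which [snd_children]
    then records. *)
Definition fst_children (t : nat) : cmd :=
  CFor 12 t
    (CIf (beq (NGet (par_arr t) (V 12)) (V 12))
       (CN (root_arr t) (NConst 0) (V 12))
       (CN (fst_arr t) (NGet (par_arr t) (V 12)) (NAdd (V 12) (NConst 1)))).

Definition snd_children (t : nat) : cmd :=
  CFor 12 t
    (CIf (beq (NGet (par_arr t) (V 12)) (V 12)) CSkip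
       (CIf (beq (NGet (fst_arr t) (NGet (par_arr t) (V 12))) (NAdd (V 12) (NConst 1)))
          CSkip
          (CN (snd_arr t) (NGet (par_arr t) (V 12)) (V 12)))).

(** The number of steps is the size of the tree, whatever the depth: at the root the pointer leads
    back to the root and the label added is [0]. *)
Definition climb (t : nat) : cmd :=
  CFor 13 t
    (CSeq
       (CR (height_arr t) (V 12)
          (RAdd (RGet (height_arr t) (V 12)) (RGet (lab_arr t) (V 14))))
       (CN 14 (NConst 0) (NGet (par_arr t) (V 14)))).

Definition heights (t : nat) : cmd :=
  CFor 12 t (CSeq (CN 14 (NConst 0) (V 12)) (climb t)).

(* Compares the vertices in the cells [13] and [12]. Sorting by decreasing distance
   from the root, with ties broken by the numbers, puts children before parents. *)
Definition is_before (t : nat) : bexpr :=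
  let h1 := RGet (height_arr t) (V 13) in
  let h2 := RGet (height_arr t) (V 12) in
  BNot (BAnd (BRealLe h1 h2)
          (BNot (BAnd (BRealLe h2 h1) (BNot (BNatLe (V 12) (V 13)))))).

(** The place of a vertex is the number of its predecessors. Counting them takes quadratic time,
    which is within the bound. *)
Definition count_before (t : nat) : cmd :=
  CFor 13 t (CIf (is_before t) (CN 15 (NConst 0) (NAdd (V 15) (NConst 1))) CSkip).

Definition sort_vertices (t : nat) : cmd :=
  CFor 12 t
    (CSeq (CN 15 (NConst 0) (NConst 0))
       (CSeq (count_before t) (CN (ord_arr t) (V 15) (V 12)))).

Definition fst_child (t a : nat) : nexpr := NSub (NGet (fst_arr t) (V a)) (NConst 1).
Definition snd_child (t a : nat) : nexpr := NGet (snd_arr t) (V a).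

Definition subtree_weight (t : nat) (e : nexpr) : rexpr :=
  RAdd (RGet (lab_arr t) e) (RGet (below_arr t) e).

Definition weights (t : nat) : cmd :=
  CFor 12 t
    (CSeq (CN 14 (NConst 0) (NGet (ord_arr t) (V 12)))
       (CIf (BNatLe (NGet (fst_arr t) (V 14)) (NConst 0)) CSkip
          (CR (below_arr t) (V 14)
             (RAdd (subtree_weight t (fst_child t 14)) (subtree_weight t (snd_child t 14)))))).

(** * Correctness of the preprocessing of one tree *)

Section Phases.

Variable R : realType.
Implicit Type s : state R.

Lemma run_seq s c1 c2 : run (CSeq c1 c2) s = run c2 (run c1 s).
Proof. by []. Qed.

Lemma run_nat s a i e : run (CN a i e) s = setn s a (neval s i) (neval s e).
Proof. by []. Qed.

Lemma run_real s a i e : run (CR a i e) s = setr s a (neval s i) (reval s e).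
Proof. by []. Qed.

Lemma run_skip s : run CSkip s = s.
Proof. by []. Qed.

Lemma run_if s b c1 c2 : run (CIf b c1 c2) s = if beval s b then run c1 s else run c2 s.
Proof. by []. Qed.

Lemma run_if_eq s e1 e2 c1 c2 : run (CIf (beq e1 e2) c1 c2) s =
  if neval s e1 == neval s e2 then run c1 s else run c2 s.
Proof. by rewrite run_if /= -eqn_leq. Qed.


Definition runE := (run_seq, run_nat, run_real, run_skip).

Section Tree.

Variables (N : nat) (par : nat -> nat) (lb : nat -> R) (r : nat) (dep : nat -> nat).
Hypothesis pt : parent_tree N par lb r dep.

Lemma par_fixed v : (v < N)%N -> (par v == v) = (v == r).
Proof.
move=> vN; apply/eqP/eqP => [pv|->]; last exact: pt_par_root pt.
by apply/eqP; apply: contraT => vr; have := pt_dep_par pt vN vr; rewrite pv; lia.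
Qed.

Lemma admissible_fst_children t : (t < 2)%N -> admissible (fst_children t).
Proof. by case: t => [|[|]]. Qed.

Lemma admissible_snd_children t : (t < 2)%N -> admissible (snd_children t).
Proof. by case: t => [|[|]]. Qed.

Lemma admissible_heights t : (t < 2)%N -> admissible (heights t).
Proof. by case: t => [|[|]]. Qed.

Lemma admissible_sort_vertices t : (t < 2)%N -> admissible (sort_vertices t).
Proof. by case: t => [|[|]]. Qed.

Lemma admissible_weights t : (t < 2)%N -> admissible (weights t).
Proof. by case: t => [|[|]]. Qed.

Lemma fst_children_spec t s : (t < 2)%N -> nmem s t 0 = N ->
  (forall v, nmem s (par_arr t) v = par v) -> (forall v, nmem s (fst_arr t) v = 0%N) ->
  let s' := run (fst_children t) s in
  [/\ forall v, (v < N)%N -> v != r -> nmem s' (fst_arr t) (par v) != 0%N,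
      forall v, nmem s' (fst_arr t) v != 0%N ->
        [/\ ((nmem s' (fst_arr t) v).-1 < N)%N, (nmem s' (fst_arr t) v).-1 != r &
            par (nmem s' (fst_arr t) v).-1 = v]
    & nmem s' (root_arr t) 0 = r].
Proof.
move=> t2 eN epar e0 s'.
pose Inv j s := [/\ forall v, nmem s (par_arr t) v = par v,
  forall v, (v < j)%N -> v != r -> nmem s (fst_arr t) (par v) != 0%N,
  forall v, nmem s (fst_arr t) v != 0%N ->
        [/\ ((nmem s (fst_arr t) v).-1 < N)%N, (nmem s (fst_arr t) v).-1 != r &
            par (nmem s (fst_arr t) v).-1 = v]
  & ((r < j)%N -> nmem s (root_arr t) 0 = r)].
suff [_ h1 h2 h3] : Inv N s' by split=> //; apply: h3; apply: (pt_root_lt pt).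
apply: run_for => //; first exact: admissible_fst_children.
  by split=> //= v; upd; rewrite ?epar // e0.
move=> j s1 jN ej _ [hp h1 h2 h3]; rewrite run_if_eq !runE /= ej hp (par_fixed jN).
case: (j =P r) => [jr|/eqP jr]; split=> /=.
- by move=> v; upd.
- move=> v; upd; rewrite ltnS leq_eqVlt => /orP[/eqP ->|]; [by rewrite jr eqxx | exact: h1].
- by move=> v; upd; apply: h2.
- by upd.
- by move=> v; upd.
- move=> v vj vr; upd; case: (par v =P par j) => [_|np]; rewrite ?addn1 //.
  move: vj; rewrite ltnS leq_eqVlt => /orP[/eqP ev|vj]; last exact: h1.
  by case: np; rewrite ev.
- move=> v; upd; case: (v =P par j) => [-> _|_]; last exact: h2.
  by rewrite addn1 /=; split.
- by upd; rewrite ltnS leq_eqVlt [r == j]eq_sym (negbTE jr); apply: h3.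
Qed.

Lemma snd_children_spec t s c0 : (t < 2)%N -> nmem s t 0 = N ->
  (forall v, nmem s (par_arr t) v = par v) -> (forall v, nmem s (fst_arr t) v = c0 v) ->
  (forall v, (v < N)%N -> v != r -> c0 (par v) != 0%N) ->
  (forall v, c0 v != 0%N -> [/\ ((c0 v).-1 < N)%N, (c0 v).-1 != r & par (c0 v).-1 = v]) ->
  child_arrays N par r c0 (nmem (run (snd_children t) s) (snd_arr t)).
Proof.
move=> t2 eN epar e0 hc0 hc; set s' := run _ _.
pose Inv j s := [/\ forall v, nmem s (par_arr t) v = par v,
  forall v, nmem s (fst_arr t) v = c0 v &
  forall v, (v < j)%N -> v != r -> c0 (par v) != v.+1 ->
    let c := nmem s (snd_arr t) (par v) in
    [/\ (c < N)%N, c != r, par c = par v & c != (c0 (par v)).-1]].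
have [_ _ h] : Inv N s'.
  apply: run_for => //; first exact: admissible_snd_children.
    by split=> //= v; upd.
  move=> j s1 jN ej _ [hp h0 h]; rewrite run_if_eq !runE /= ej hp (par_fixed jN).
  case: (j =P r) => [jr|/eqP jr].
    split=> /=; [by move=> v; upd| by move=> v; upd|].
    move=> v; upd; rewrite ltnS leq_eqVlt => /orP[/eqP ->|]; first by rewrite jr eqxx.
    exact: h.

  rewrite run_if_eq !runE /= ?ej ?hp h0 addn1; case: (c0 (par j) =P j.+1) => [cj|/eqP cj].
    split=> /=; [by move=> v; upd| by move=> v; upd|].
    move=> v; upd; rewrite ltnS leq_eqVlt => /orP[/eqP ->|]; first by rewrite cj eqxx.
    exact: h.
  split=> /=; [by move=> v; upd| by move=> v; upd|].
  move=> v vj vr cv; upd; case: (par v =P par j) => [pv|np].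
    by split=> //; rewrite pv; have := hc0 j jN jr; move: cj; clear; lia.
  move: vj; rewrite ltnS leq_eqVlt => /orP[/eqP ev|vj]; last exact: h.
  by case: np; rewrite ev.
split=> [//|v _|v vN vr n0]; first exact: hc.
have [fN fr fp] := hc v n0.
have pfr : par (c0 v).-1 != r by rewrite fp.
have [w [wN wr wf pw _]] := pt_sibling pt fN fr pfr.
have := h w wN wr; rewrite pw fp; apply.
by move: wf; clear; lia.
Qed.

Definition height v := \sum_(k < N) lb (iter k par v).

Lemma heights_spec t s : (t < 2)%N -> nmem s t 0 = N ->
  (forall v, nmem s (par_arr t) v = par v) -> (forall v, rmem s (lab_arr t) v = lb v) ->
  (forall v, rmem s (height_arr t) v = 0) ->
  forall v, (v < N)%N -> rmem (run (heights t) s) (height_arr t) v = height v.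
Proof.
move=> t2 eN epar elb e0.
pose Inv j s := [/\ forall v, nmem s (par_arr t) v = par v,
  forall v, rmem s (lab_arr t) v = lb v,
  forall v, (v < j)%N -> rmem s (height_arr t) v = height v &
  forall v, (j <= v)%N -> rmem s (height_arr t) v = 0].
suff [_ _ h _] : Inv N (run (heights t) s) by [].
have ad := admissible_heights t2.
apply: run_for => //.
  by split=> //= v; upd.
move=> j s1 jN ej eN1 [hp hl h1 h2]; rewrite !runE.
have {}ad : admissible (climb t) by case/and4P: ad => _ _ _ /andP[].
pose Inv' k s := [/\ nmem s 12 0 = j, nmem s 14 0 = iter k par j,
  [/\ forall v, nmem s (par_arr t) v = par v,
  forall v, rmem s (lab_arr t) v = lb v,
  forall v, (v < j)%N -> rmem s (height_arr t) v = height v &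
  forall v, (j < v)%N -> rmem s (height_arr t) v = 0] &
  rmem s (height_arr t) j = \sum_(i < k) lb (iter i par j)].
have [i1 i2 [i3 i4 i5 i6] i7] : Inv' N (run (climb t) (setn s1 14 0 (nmem s1 12 0))).
  apply: run_for => //.
  - by rewrite /setn /=; upd.
  - split=> /=; [by upd| by upd; rewrite ej| split=> v; upd|by rewrite big_ord0 h2].
      + exact: hp.
      + exact: hl.
      + exact: h1.
      + by move=> jv; apply: h2; apply: ltnW.
  move=> k s2 kN ek eN2 [g1 g2 [g3 g4 g5 g6] g7]; rewrite !runE; split=> /=.
  - by upd.
  - by upd; rewrite g2 g3.
  - split=> v; upd; first exact: g3.
    + exact: g4.
    + by rewrite g1; move=> vj; rewrite ltn_eqF // g5.
    + by rewrite g1; move=> vj; rewrite gtn_eqF // g6.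
  - by upd; rewrite g1 eqxx g7 g4 g2 big_ord_recr.
split=> v /=; upd; first exact: i3.
- exact: i4.
- by rewrite ltnS leq_eqVlt => /orP[/eqP ->|/i5].
- by move=> jv; apply: i6.
Qed.

Lemma iter_par_root k : iter k par r = r.
Proof. by elim: k => //= k ->; apply: pt_par_root pt. Qed.

Lemma iter_dep v k : (v < N)%N -> (dep v <= k)%N -> iter k par v = r.
Proof.
move: {2}(dep v) (erefl (dep v)) => d ed vN le.
elim: d v k ed vN le => [|d IH] v k ed vN le; have [->|vr] := eqVneq v r;
  rewrite ?iter_par_root //.
  by have := pt_dep_par pt vN vr; rewrite ed.
have := pt_dep_par pt vN vr; rewrite ed => -[ed'].
case: k le => [|k] le; first by rewrite ed in le.
by rewrite iterSr IH ?(pt_par_lt pt) // -ed' -ltnS -ed.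
Qed.

(** Apart from [lb v], the two sums of [N] terms differ in the last term at [par v]. It belongs to a
    vertex [N] steps above [v], which is the root, with label [0]. *)
Lemma height_par v : (v < N)%N -> v != r -> height v = lb v + height (par v).
Proof.
move=> vN vr; have N0 : (0 < N)%N by apply: leq_ltn_trans vN.
rewrite /height; case: N (pt_dep_lt pt vN) N0 => [//|n] dn _.
rewrite big_ord_recl /= big_ord_recr /= -!iterSr iter_dep //; last exact: ltnW dn.
rewrite (pt_lab_root pt) addr0; congr (_ + _); apply: eq_bigr => i _.
by rewrite -iterSr.
Qed.

Lemma height_root : height r = 0.
Proof. by apply: big1 => k _; rewrite iter_par_root (pt_lab_root pt). Qed.

Definition before u v := (height v < height u) || ((height v <= height u) && (u < v)%N).

Lemma before_trans : transitive before.
Proof.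
rewrite /before => v u w /orP[h1|/andP[h1 i1]] /orP[h2|/andP[h2 i2]].
- by rewrite (lt_trans h2 h1).
- by rewrite (le_lt_trans h2 h1).
- by rewrite (lt_le_trans h2 h1).
- by rewrite (le_trans h2 h1) (ltn_trans i1 i2) orbT.
Qed.

Lemma before_irr v : before v v = false.
Proof. by rewrite /before ltxx ltnn andbF. Qed.

Lemma before_total u v : u != v -> before u v || before v u.
Proof.
by rewrite /before neq_ltn; case: ltgtP => //= _; case: ltngtP.
Qed.

Definition rank v := count (fun u => before u v) (iota 0 N).

Lemma rank_lt v : (v < N)%N -> (rank v < N)%N.
Proof.
move=> vN; rewrite /rank -[X in (_ < X)%N](size_iota 0) ltn_neqAle count_size andbT.
rewrite -all_count; apply/negP => /allP /(_ v).
by rewrite mem_iota before_irr => /(_ vN).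
Qed.

Lemma rank_before u v : (u < N)%N -> before u v -> (rank u < rank v)%N.
Proof.
move=> uN uv; rewrite /rank.
have -> : count (before^~ v) (iota 0 N) = (count (before^~ u) (iota 0 N) +
    count (fun w => before w v && ~~ before w u) (iota 0 N))%N.
  rewrite -count_predUI [X in (_ + X)%N](_ : _ = 0%N) ?addn0; last first.
    by apply/eqP; rewrite -leqn0 leqNgt -has_count; apply/hasPn => w _ /=; case: before; rewrite ?andbF.
  apply: eq_count => w /=; case wu : (before w u) => /=; last by rewrite andbT.
  by rewrite (before_trans wu uv).
rewrite -[X in (X < _)%N]addn0 ltn_add2l -has_count; apply/hasP; exists u.
  by rewrite mem_iota.
by rewrite /= uv before_irr.
Qed.

Lemma rank_inj u v : (u < N)%N -> (v < N)%N -> rank u = rank v -> u = v.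
Proof.
move=> uN vN e; apply/eqP; apply: contraT => /before_total /orP[] /rank_before H.
  by have := H uN; rewrite e ltnn.
by have := H vN; rewrite e ltnn.
Qed.

Lemma rank_surj i : (i < N)%N -> exists2 v, (v < N)%N & rank v = i.
Proof.
move=> iN; pose f (v : 'I_N) : 'I_N := Ordinal (rank_lt (ltn_ord v)).
have fi : injective f.
  by move=> u v /(congr1 val) /= /rank_inj e; apply: val_inj; apply: e.
have [g _ gK] := injF_bij fi.
exists (g (Ordinal iN)) => //; exact: (congr1 val (gK (Ordinal iN))).
Qed.

Lemma rank_child v : (v < N)%N -> v != r -> (rank v < rank (par v))%N.
Proof.
move=> vN vr; apply: rank_before => //; rewrite /before (height_par vN vr).
by rewrite ltrDr (pt_lab_gt0 pt).
Qed.

Lemma beval_is_before t s : beval s (is_before t) =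
  (rmem s (height_arr t) (nmem s 12 0) < rmem s (height_arr t) (nmem s 13 0)) ||
  ((rmem s (height_arr t) (nmem s 12 0) <= rmem s (height_arr t) (nmem s 13 0)) &&
   (nmem s 13 0 < nmem s 12 0)%N).
Proof. by rewrite /= negb_and negbK -ltNge -ltnNge. Qed.

Lemma sort_vertices_spec t s : (t < 2)%N -> nmem s t 0 = N ->
  (forall v, (v < N)%N -> rmem s (height_arr t) v = height v) ->
  forall v, (v < N)%N -> nmem (run (sort_vertices t) s) (ord_arr t) (rank v) = v.
Proof.
move=> t2 eN eh.
pose Inv j s := (forall v, (v < N)%N -> rmem s (height_arr t) v = height v) /\
  forall v, (v < j)%N -> nmem s (ord_arr t) (rank v) = v.
suff [_ h] : Inv N (run (sort_vertices t) s) by [].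
have ad := admissible_sort_vertices t2.
apply: run_for => //.
move=> j s1 jN ej eN1 [hh ho]; rewrite !runE.
have {}ad : admissible (count_before t) by case/and4P: ad => _ _ _ /and3P[].
pose Inv' k s := [/\ nmem s 12 0 = j, nmem s 15 0 = count (before^~ j) (iota 0 k),
  (forall v, (v < N)%N -> rmem s (height_arr t) v = height v) &
  forall v, (v < j)%N -> nmem s (ord_arr t) (rank v) = v].
have [i1 i2 i3 i4] : Inv' N (run (count_before t) (setn s1 15 0 0%N)).
  apply: run_for => //.
  - by rewrite /setn /=; upd.
  - by split=> //= v vj; upd; exact: ho.
  move=> k s2 kN ek eN2 [g1 g2 g3 g4].
  rewrite run_if beval_is_before ek g1 !g3 // -/(before k j) !runE.
  have ct : count (before^~ j) (iota 0 k.+1) = (count (before^~ j) (iota 0 k) + before k j)%N.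
    by rewrite -addn1 iotaD count_cat /= addn0.
  rewrite /Inv' ct; case: (before k j); (split=> [| |v vN|v vj] /=; upd => //).
  - by rewrite g2.
  - exact: g3.
  - exact: g4.
  - by rewrite g2 addn0.
  - exact: g3.
  - exact: g4.
split=> /= v; first exact: i3.
upd; rewrite i1 i2 -/(rank j) ltnS leq_eqVlt.
have [->|vj] := eqVneq v j; first by rewrite eqxx.
move=> /= vj'; case: eqP => [/rank_inj e|_]; last exact: i4.
by case/eqP: vj; apply: e => //; apply: ltn_trans jN.
Qed.

Lemma weights_spec t s c0 c1 : (t < 2)%N -> nmem s t 0 = N ->
  child_arrays N par r c0 c1 ->
  (forall v, rmem s (lab_arr t) v = lb v) ->
  (forall v, nmem s (fst_arr t) v = c0 v) -> (forall v, nmem s (snd_arr t) v = c1 v) ->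
  (forall v, (v < N)%N -> nmem s (ord_arr t) (rank v) = v) ->
  (forall v, rmem s (below_arr t) v = 0) ->
  forall v, (v < N)%N -> v != r ->
    rmem (run (weights t) s) (below_arr t) v = below (btree_at N lb dep c0 c1 v).
Proof.
move=> t2 eN ca el e0 e1 eo ez; set bt := btree_at _ _ _ _ _.
(* Cells of vertices not yet reached still hold [0]. This is already the right value at a leaf, for
   which nothing is written. *)
pose Inv j s := [/\ [/\ forall v, rmem s (lab_arr t) v = lb v,
  forall v, nmem s (fst_arr t) v = c0 v, forall v, nmem s (snd_arr t) v = c1 v &
  forall v, (v < N)%N -> nmem s (ord_arr t) (rank v) = v],
  forall v, (v < N)%N -> v != r -> (rank v < j)%N -> rmem s (below_arr t) v = below (bt v) &
  forall v, (v < N)%N -> v != r -> (j <= rank v)%N -> rmem s (below_arr t) v = 0].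
suff [_ h _] : Inv N (run (weights t) s) by move=> v vN vr; apply: h => //; apply: rank_lt.
have ad := admissible_weights t2.
apply: run_for => //.
  split=> /= [|v _ _ //|v _ _ _]; last exact: ez.
  by split=> v /=; upd; first [exact: el|exact: e0|exact: e1|exact: eo].
move=> j s1 jN ej eN1 [[hl h0 h1 ho] hw hz]; have [v vN rv] := rank_surj jN.
have lt_v u : (u < N)%N -> (rank u < j.+1)%N -> u != v -> (rank u < j)%N.
  move=> uN; rewrite ltnS leq_eqVlt -rv => /orP[/eqP /rank_inj e|//].
  by rewrite e // eqxx.
have ov : nmem s1 (ord_arr t) j = v by rewrite -rv ho.
rewrite !runE run_if !runE /= ej ov; upd; rewrite h0 leqn0.
case: eqP => [c00|/eqP n0].
  split=> /=; [split=> u /=; upd; first [exact: hl|exact: h0|exact: h1|exact: ho]| |] => u uN ur le.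
    have [uv|uv] := eqVneq u v; last by apply: hw => //; apply: lt_v.
    rewrite uv hz // -?uv //; last by rewrite uv rv.
    by rewrite /bt (btree_atE pt ca uN ur) uv c00.
  by apply: hz => //; apply: ltnW.
have [fN fr fp] := ca_fst ca vN n0.
split=> /=; first by split=> u /=; upd; first [exact: hl|exact: h0|exact: h1|exact: ho].
- move=> u uN ur le; upd.
  have [uv|uv] := eqVneq u v; last by apply: hw => //; apply: lt_v.
  have vr : v != r by rewrite -uv.
  have [sN sr sp _] := ca_snd ca vN vr n0.
  rewrite ?h0 ?h1 !hl subn1 uv /bt (btree_atE pt ca vN vr) (negbTE n0) /= !bweightE.
  rewrite !(top_len_at pt ca) // !hw //.
  + by rewrite -rv -{2}sp rank_child.
  + by rewrite -rv -{2}fp rank_child.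
- move=> u uN ur le; upd.
  have uv : u != v by apply: contraTneq le => ->; rewrite rv ltnn.
  by rewrite (negbTE uv); apply: hz => //; apply: ltnW.
Qed.

End Tree.
End Phases.

(** * Addresses of the table and the recurrence as a command *)

Definition prepare (t : nat) : cmd :=
  CSeq (fst_children t) (CSeq (snd_children t)
    (CSeq (heights t) (CSeq (sort_vertices t) (weights t)))).

(* Multiplication tables for the addresses, as the machine only adds. *)
Definition multiples (a n : nat) (k : nexpr) : cmd :=
  CFor 12 n (CN a (NAdd (V 12) (NConst 1)) (NAdd (NGet a (V 12)) k)).

(** The quadruple read as digits of a number in mixed radix: the arrays [22], [21] and [20] hold the
    multiples of [N1 * (N2 * N2)], [N2 * N2] and [N2]. *)
Definition table_address (n1 p1 n2 p2 : nexpr) : nexpr :=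
  NAdd (NAdd (NGet 22 n1) (NGet 21 p1)) (NAdd (NGet 20 n2) p2).

Definition entry (n1 p1 n2 p2 : nexpr) : rexpr := RGet 8 (table_address n1 p1 n2 p2).

Definition best : rexpr := RGet 7 (NConst 0).

Definition improve (e : rexpr) : cmd :=
  CIf (BRealLe best e) (CR 7 (NConst 0) best) (CR 7 (NConst 0) e).

Definition length_difference : rexpr :=
  RAbs (RSub (RSub (RGet 3 (V 16)) (RGet 3 (V 14))) (RSub (RGet 4 (V 17)) (RGet 4 (V 15)))).

(* Cells [16] and [17] hold the lower ends, [14] and [15] the upper ends of the
   two paths. *)
Definition compute_best : cmd :=
  let n1 := V 16 in let p1 := V 14 in let n2 := V 17 in let p2 := V 15 in
  let a0 := fst_child 0 16 in let a1 := snd_child 0 16 in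
  let b0 := fst_child 1 17 in let b1 := snd_child 1 17 in
  let leaf1 := BNatLe (NGet 4 n1) (NConst 0) in
  let leaf2 := BNatLe (NGet 5 n2) (NConst 0) in
  CSeq (CR 7 (NConst 0)
          (RAdd length_difference (RAdd (RGet 5 n1) (RGet 6 n2))))
  (CSeq (CIf leaf1 CSkip
          (CSeq (improve (RAdd (entry a0 p1 n2 p2) (subtree_weight 0 a1)))
                (improve (RAdd (entry a1 p1 n2 p2) (subtree_weight 0 a0)))))
  (CSeq (CIf leaf2 CSkip
          (CSeq (improve (RAdd (entry n1 p1 b0 p2) (subtree_weight 1 b1)))
                (improve (RAdd (entry n1 p1 b1 p2) (subtree_weight 1 b0)))))
  (CIf leaf1 CSkip (CIf leaf2 CSkip
          (CSeq (improve (RAdd length_difference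
                            (RAdd (entry a0 n1 b0 n2) (entry a1 n1 b1 n2))))
                (improve (RAdd length_difference
                            (RAdd (entry a0 n1 b1 n2) (entry a1 n1 b0 n2))))))))).

Definition fill_entry : cmd :=
  CSeq compute_best (CR 8 (table_address (V 16) (V 14) (V 17) (V 15)) best).

Section Machine.

Variable R : realType.
Implicit Type s : state R.

Section Prepare.

Variables (N : nat) (par : nat -> nat) (lb : nat -> R) (r : nat) (dep : nat -> nat).
Hypothesis pt : parent_tree N par lb r dep.

Record prepared (t : nat) (s : state R) : Prop := Prepared {
  pr_size : nmem s t 0 = N;
  pr_lab : forall v, rmem s (lab_arr t) v = lb v;
  pr_children : child_arrays N par r (nmem s (fst_arr t)) (nmem s (snd_arr t));
  pr_root : nmem s (root_arr t) 0 = r;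
  pr_height : forall v, (v < N)%N -> rmem s (height_arr t) v = height N par lb v;
  pr_ord : forall v, (v < N)%N -> nmem s (ord_arr t) (rank N par lb v) = v;
  pr_below : forall v, (v < N)%N -> v != r -> rmem s (below_arr t) v =
    below (btree_at N lb dep (nmem s (fst_arr t)) (nmem s (snd_arr t)) v)
}.

(** A syntactic test, so that the survival of the preprocessed data is decided by computation. *)
Definition untouched (t : nat) (c : cmd) : bool :=
  all (fun a => a \notin nmods c) [:: t; fst_arr t; snd_arr t; root_arr t; ord_arr t] &&
  all (fun a => a \notin rmods c) [:: lab_arr t; height_arr t; below_arr t].

Lemma prepared_run t s c : untouched t c -> prepared t s -> prepared t (run c s).
Proof.
case/andP=> /and5P[u1 u2 u3 u4 /andP[u5 _]] /and4P[w1 w2 w3 _] [h1 h2 h3 h4 h5 h6 h7].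
have e0 : nmem (run c s) (fst_arr t) = nmem s (fst_arr t).
  by apply/funext => k; apply: nmem_run.
have e1 : nmem (run c s) (snd_arr t) = nmem s (snd_arr t).
  by apply/funext => k; apply: nmem_run.
split; rewrite ?e0 ?e1 ?nmem_run //.
- by move=> v; rewrite rmem_run.
- by move=> v vN; rewrite rmem_run ?h5.
- by move=> v vN; rewrite nmem_run ?h6.
- by move=> v vN vr; rewrite rmem_run ?h7.
Qed.

Lemma prepare_spec t s : (t < 2)%N -> nmem s t 0 = N ->
  (forall v, nmem s (par_arr t) v = par v) -> (forall v, rmem s (lab_arr t) v = lb v) ->
  (forall v, nmem s (fst_arr t) v = 0%N) -> (forall v, rmem s (height_arr t) v = 0) ->
  (forall v, rmem s (below_arr t) v = 0) ->
  prepared t (run (prepare t) s).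
Proof.
move=> t2 eN ep el e0 eh eb; rewrite /prepare !run_seq.
have T : t = 0%N \/ t = 1%N by lia.
set s1 := run (fst_children t) s; set s2 := run (snd_children t) s1.
set s3 := run (heights t) s2; set s4 := run (sort_vertices t) s3.
have fr a c : (a \notin nmods c) -> forall s', nmem (run c s') a = nmem s' a.
  by move=> h s'; apply/funext => k; apply: nmem_run.
have fr' a c : (a \notin rmods c) -> forall s', rmem (run c s') a = rmem s' a.
  by move=> h s'; apply/funext => k; apply: rmem_run.
have [h1 h2 h3] := fst_children_spec pt t2 eN ep e0.
have N1 : nmem s1 t 0 = N by rewrite fr //; case: T => ->.
have N2 : nmem s2 t 0 = N by rewrite fr ?N1 //; case: T => ->.
have N3 : nmem s3 t 0 = N by rewrite fr ?N2 //; case: T => ->.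
have N4 : nmem s4 t 0 = N by rewrite fr ?N3 //; case: T => ->.
have P1 v : nmem s1 (par_arr t) v = par v by rewrite fr ?ep //; case: T => ->.
have P2 v : nmem s2 (par_arr t) v = par v by rewrite fr ?P1 //; case: T => ->.
have L2 v : rmem s2 (lab_arr t) v = lb v by rewrite /s2 /s1 !fr' ?el //; case: T => ->.
have L4 v : rmem s4 (lab_arr t) v = lb v by rewrite /s4 /s3 !fr' ?L2 //; case: T => ->.
have ca := snd_children_spec pt t2 N1 P1 (fun=> erefl) h1 h2.
have H2 v : rmem s2 (height_arr t) v = 0 by rewrite /s2 /s1 !fr' ?eh //; case: T => ->.
have H3 := heights_spec t2 N2 P2 L2 H2.
have O4 := sort_vertices_spec t2 N3 H3.
have F4 : nmem s4 (fst_arr t) = nmem s1 (fst_arr t).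
  by rewrite /s4 /s3 /s2 (fr _ (sort_vertices t)) ?(fr _ (heights t))
    ?(fr _ (snd_children t)) //; case: T => ->.
have S4 : nmem s4 (snd_arr t) = nmem s2 (snd_arr t).
  by rewrite /s4 /s3 (fr _ (sort_vertices t)) ?(fr _ (heights t)) //; case: T => ->.
have B4 v : rmem s4 (below_arr t) v = 0.
  by rewrite /s4 /s3 /s2 /s1 !fr' ?eb //; case: T => ->.
rewrite -F4 -S4 in ca.
have W5 := weights_spec pt t2 N4 ca L4 (fun=> erefl) (fun=> erefl) O4 B4.
have F5 : nmem (run (weights t) s4) (fst_arr t) = nmem s4 (fst_arr t).
  by rewrite fr //; case: T => ->.
have S5 : nmem (run (weights t) s4) (snd_arr t) = nmem s4 (snd_arr t).
  by rewrite fr //; case: T => ->.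
split; rewrite ?F5 ?S5 //.
- by rewrite fr ?N4 //; case: T => ->.
- by move=> v; rewrite fr' ?L4 //; case: T => ->.
- by rewrite (fr _ (weights t)) /s4 /s3 /s2 ?(fr _ (sort_vertices t)) ?(fr _ (heights t))
    ?(fr _ (snd_children t)) //; case: T => ->.
- by move=> v vN; rewrite (fr' _ (weights t)) /s4 ?(fr' _ (sort_vertices t)) ?H3 //; case: T => ->.
- by move=> v vN; rewrite fr ?O4 //; case: T => ->.
Qed.

End Prepare.

(** The expression [k] is evaluated anew in each round; hence it must have the same value in all
    states that differ only in the counter and in the array being filled. *)
Lemma multiples_spec a n k m x s : (12 < a)%N -> (n <= 1)%N -> nmem s n 0 = m ->
  (forall s', (forall b j, b != a -> b != 12 -> nmem s' b j = nmem s b j) -> neval s' k = x) ->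
  nmem s a 0 = 0%N ->
  forall j, (j <= m)%N -> nmem (run (multiples a n k) s) a j = (j * x)%N.
Proof.
move=> a12 n1 em hk e0.
pose Inv j s' := (forall b j, b != a -> b != 12 -> nmem s' b j = nmem s b j) /\
  forall i, (i <= j)%N -> nmem s' a i = (i * x)%N.
suff [_ h] : Inv m (run (multiples a n k) s) by [].
apply: run_for => //.
- by rewrite /= inE n1 /=; lia.
- split=> /= [b j ba b12|i]; first by upd.
  by rewrite leqn0 => /eqP ->; upd.
move=> j s1 jm ej _ [h1 h2]; rewrite runE; split=> /= [b i ba b12|i ij].
  by rewrite !update_ne ?(negbTE ba) ?(negbTE b12) // h1.
upd; rewrite ej addn1; case: (i =P j.+1) => [->|/eqP ne].
  by rewrite h2 // (hk _ h1) mulSnr.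
by apply: h2; rewrite -ltnS ltn_neqAle ne.
Qed.

Lemma run_improve s e : run (improve e) s =
  setr s 7 0 (Num.min (reval s e) (rmem s 7 0)).
Proof.
by rewrite /improve run_if !runE /= minC minEle; case: ifP.
Qed.

End Machine.

Fixpoint rarrays (e : rexpr) : seq nat :=
  match e with
  | RGet a _ => [:: a]
  | RAdd e1 e2 | RSub e1 e2 => rarrays e1 ++ rarrays e2
  | RAbs e1 => rarrays e1
  end.

(** * Correctness of a single entry *)

Section Cell.

Variable R : realType.
Implicit Type s : state R.

(** Only the cell of the running minimum changes while an entry is computed, and no candidate reads
    it, so every candidate can be evaluated in the initial state. *)
Definition same_but_best s s' (x : R) := [/\ nmem s' = nmem s,
  forall b j, b != 7 -> rmem s' b j = rmem s b j & rmem s' 7 0 = x].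

Lemma neval_same s s' e : nmem s' = nmem s -> neval s' e = neval s e.
Proof. by move=> h; elim: e => //= [a i ->|e1 -> e2 ->|e1 -> e2 ->] //; rewrite h. Qed.

Lemma reval_same s s' x e : same_but_best s s' x -> 7 \notin rarrays e -> reval s' e = reval s e.
Proof.
case=> h1 h2 _; elim: e => //= [a i|e1 IH1 e2 IH2|e1 IH1 e2 IH2|e1 IH].
- by rewrite inE => a7; rewrite h2 1?eq_sym // (neval_same _ h1).
- by rewrite mem_cat negb_or => /andP[/IH1 -> /IH2 ->].
- by rewrite mem_cat negb_or => /andP[/IH1 -> /IH2 ->].
- by move=> /IH ->.
Qed.

Lemma revalD s e1 e2 : reval s (RAdd e1 e2) = reval s e1 + reval s e2.
Proof. by []. Qed.

Lemma improve_same s s' x e : same_but_best s s' x -> 7 \notin rarrays e ->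
  same_but_best s (run (improve e) s') (Num.min (reval s e) x).
Proof.
move=> h e7; have er := reval_same h e7; case: h => h1 h2 h3; rewrite run_improve.
split=> //= [b j b7|]; last by upd; rewrite er h3.
by rewrite update_ne ?h2 // (negbTE b7).
Qed.

Section Table.

Variables (N1 : nat) (par1 : nat -> nat) (lb1 : nat -> R) (r1 : nat) (dep1 : nat -> nat).
Variables (N2 : nat) (par2 : nat -> nat) (lb2 : nat -> R) (r2 : nat) (dep2 : nat -> nat).
Hypothesis pt1 : parent_tree N1 par1 lb1 r1 dep1.
Hypothesis pt2 : parent_tree N2 par2 lb2 r2 dep2.
Variables (c0 c1 d0 d1 : nat -> nat).

Definition ready s := [/\
  [/\ prepared N1 par1 lb1 r1 dep1 0 s, nmem s 4 = c0 & nmem s 6 = c1],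
  [/\ prepared N2 par2 lb2 r2 dep2 1 s, nmem s 5 = d0 & nmem s 7 = d1],
  forall j, (j <= N2)%N -> nmem s 20 j = (j * N2)%N,
  forall j, (j <= N1)%N -> nmem s 21 j = (j * (N2 * N2))%N &
  forall j, (j <= N1)%N -> nmem s 22 j = (j * (N1 * (N2 * N2)))%N].

Definition keeps_ready (c : cmd) := [&& untouched 0 c, untouched 1 c &
  all (fun a => a \notin nmods c) [:: 20; 21; 22]].

Lemma ready_run s c : keeps_ready c -> ready s -> ready (run c s).
Proof.
case/and3P=> u0 u1 /and4P[u20 u21 u22 _] [[p0 e4 e6] [p1 e5 e7] h20 h21 h22].
have fr a : a \notin nmods c -> nmem (run c s) a = nmem s a.
  by move=> h; apply/funext => k; apply: nmem_run.
have q0 := prepared_run u0 p0; have q1 := prepared_run u1 p1.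
case/andP: u0 => /and4P[_ v1 v2 _] _; case/andP: u1 => /and4P[_ w1 w2 _] _.
split; [split=> // | split=> // | | |]; rewrite fr //.
Qed.

Definition table_index a b c d := (a * (N1 * (N2 * N2)) + b * (N2 * N2) + (c * N2 + d))%N.

Lemma neval_table_address s e1 e2 e3 e4 : ready s -> (neval s e1 <= N1)%N ->
  (neval s e2 <= N1)%N -> (neval s e3 <= N2)%N ->
  neval s (table_address e1 e2 e3 e4) =
    table_index (neval s e1) (neval s e2) (neval s e3) (neval s e4).
Proof. by case=> _ _ h20 h21 h22 l1 l2 l3; rewrite /= h20 // h21 // h22. Qed.

(** The upper ends enter through their heights only. The recurrence therefore holds for all
    quadruples, even if [x1] or [x2] is not an ancestor and a length is negative, and neither
    program nor proof has to single out the genuine paths. *)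
Definition entry_value v1 x1 v2 x2 : R :=
  bdist (btree_at N1 lb1 dep1 c0 c1 v1) (btree_at N2 lb2 dep2 d0 d1 v2)
    (height N1 par1 lb1 v1 - height N1 par1 lb1 x1)
    (height N2 par2 lb2 v2 - height N2 par2 lb2 x2).

(** The last three hypotheses are the entries consulted: prolonging one path keeps its upper end,
    whereas after matching the branchings the old lower ends become the new upper ends. *)
Lemma run_compute_best s n1 p1 n2 p2 : ready s ->
  nmem s 16 0 = n1 -> nmem s 14 0 = p1 -> nmem s 17 0 = n2 -> nmem s 15 0 = p2 ->
  (n1 < N1)%N -> (p1 < N1)%N -> (n2 < N2)%N -> (p2 < N2)%N -> n1 != r1 -> n2 != r2 ->
  (forall c, (c < N1)%N -> c != r1 -> par1 c = n1 ->
     rmem s 8 (table_index c p1 n2 p2) = entry_value c p1 n2 p2) ->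
  (forall d, (d < N2)%N -> d != r2 -> par2 d = n2 ->
     rmem s 8 (table_index n1 p1 d p2) = entry_value n1 p1 d p2) ->
  (forall c d, (c < N1)%N -> c != r1 -> par1 c = n1 ->
     (d < N2)%N -> d != r2 -> par2 d = n2 ->
     rmem s 8 (table_index c n1 d n2) = entry_value c n1 d n2) ->
  rmem (run compute_best s) 7 0 = entry_value n1 p1 n2 p2.
Proof.
move=> rd e16 e14 e17 e15 n1N p1N n2N p2N n1r n2r HL HR HM.
have [[pr1 ec0 ec1] [pr2 ed0 ed1] _ _ _] := rd.
have ca1 := pr_children pr1; have ca2 := pr_children pr2.
rewrite ec0 ec1 in ca1; rewrite ed0 ed1 in ca2.
have hl1 := pr_lab pr1; have hl2 := pr_lab pr2.
have hh1 := pr_height pr1; have hh2 := pr_height pr2.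
have hb1 := pr_below pr1; have hb2 := pr_below pr2.
rewrite /= ec0 ec1 in hb1; rewrite /= ed0 ed1 in hb2; rewrite /= in hl1 hl2 hh1 hh2.
set H1 := height N1 par1 lb1 in hh1; set H2 := height N2 par2 lb2 in hh2.
set L := `|(H1 n1 - H1 p1) - (H2 n2 - H2 p2)|.
have eL : reval s length_difference = L.
  by rewrite /= e16 e14 e17 e15 !hh1 // !hh2.
pose bt1 := btree_at N1 lb1 dep1 c0 c1; pose bt2 := btree_at N2 lb2 dep2 d0 d1.
rewrite /compute_best run_seq; set s1 := run (CR 7 _ _) s.
have sb1 : same_but_best s s1 (L + (below (bt1 n1) + below (bt2 n2))).
  split=> //= [b j b7|]; first by rewrite update_ne // (negbTE b7).
  by upd; rewrite -eL /= e16 e17 hb1 // hb2.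
have ent e1 e2 e3 e4 : (neval s e1 < N1)%N -> (neval s e2 < N1)%N -> (neval s e3 < N2)%N ->
    reval s (entry e1 e2 e3 e4) =
      rmem s 8 (table_index (neval s e1) (neval s e2) (neval s e3) (neval s e4)).
  move=> l1 l2 l3; rewrite -(neval_table_address e4 rd) //; exact: ltnW.
have w1 e : (neval s e < N1)%N -> neval s e != r1 ->
    reval s (subtree_weight 0 e) = bweight (bt1 (neval s e)).
  by move=> l n; rewrite bweightE (top_len_at pt1 ca1) // -hb1 //= hl1.
have w2 e : (neval s e < N2)%N -> neval s e != r2 ->
    reval s (subtree_weight 1 e) = bweight (bt2 (neval s e)).
  by move=> l n; rewrite bweightE (top_len_at pt2 ca2) // -hb2 //= hl2.
(* Heights telescope: prolonging a path from [n1] into a child adds the length of the child's edge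
   to the difference of heights. *)
have up1 c : (c < N1)%N -> c != r1 -> par1 c = n1 -> H1 c - H1 n1 = top_len (bt1 c).
  by move=> cN cr pc; rewrite (top_len_at pt1 ca1) // /H1 (height_par pt1 cN cr) pc addrK.
have up2 c : (c < N2)%N -> c != r2 -> par2 c = n2 -> H2 c - H2 n2 = top_len (bt2 c).
  by move=> cN cr pc; rewrite (top_len_at pt2 ca2) // /H2 (height_par pt2 cN cr) pc addrK.
have rE : entry_value n1 p1 n2 p2 =
    bdist_step (@bdist R) (bt1 n1) (bt2 n2) (H1 n1 - H1 p1) (H2 n2 - H2 p2).
  by rewrite /entry_value bdistE.
rewrite rE.
have HL' c : (c < N1)%N -> c != r1 -> par1 c = n1 -> rmem s 8 (table_index c p1 n2 p2) =
    bdist (bt1 c) (bt2 n2) (H1 n1 - H1 p1 + top_len (bt1 c)) (H2 n2 - H2 p2).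
  by move=> cN cr pc; rewrite HL // -up1 // /entry_value; congr (bdist _ _ _ _); rewrite -/H1; lra.
have HR' d : (d < N2)%N -> d != r2 -> par2 d = n2 -> rmem s 8 (table_index n1 p1 d p2) =
    bdist (bt1 n1) (bt2 d) (H1 n1 - H1 p1) (H2 n2 - H2 p2 + top_len (bt2 d)).
  by move=> dN dr pd; rewrite HR // -up2 // /entry_value; congr (bdist _ _ _ _); rewrite -/H2; lra.
have HM' c d : (c < N1)%N -> c != r1 -> par1 c = n1 -> (d < N2)%N -> d != r2 -> par2 d = n2 ->
    rmem s 8 (table_index c n1 d n2) = bdist (bt1 c) (bt2 d) (top_len (bt1 c)) (top_len (bt2 d)).
  by move=> cN cr pc dN dr pd; rewrite HM // -up1 // -up2.
have E1 := btree_atE pt1 ca1 n1N n1r; have E2 := btree_atE pt2 ca2 n2N n2r.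
rewrite -/(bt1 _) -/(bt1 _) -/(bt1 _) in E1; rewrite -/(bt2 _) -/(bt2 _) -/(bt2 _) in E2.
have leafE1 s' x : same_but_best s s' x -> beval s' (BNatLe (NGet 4 (V 16)) (NConst 0)) = (c0 n1 == 0%N).
  by case=> h _ _; rewrite /= h e16 ec0 leqn0.
have leafE2 s' x : same_but_best s s' x -> beval s' (BNatLe (NGet 5 (V 17)) (NConst 0)) = (d0 n2 == 0%N).
  by case=> h _ _; rewrite /= h e17 ed0 leqn0.
set a0 := fst_child 0 16; set a1 := snd_child 0 16; set b0 := fst_child 1 17; set b1 := snd_child 1 17.
have va0 : neval s a0 = (c0 n1).-1 by rewrite /= e16 ec0 subn1.
have va1 : neval s a1 = c1 n1 by rewrite /= e16 ec1.
have vb0 : neval s b0 = (d0 n2).-1 by rewrite /= e17 ed0 subn1.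
have vb1 : neval s b1 = d1 n2 by rewrite /= e17 ed1.
have v16 : neval s (V 16) = n1 by []. have v14 : neval s (V 14) = p1 by [].
have v17 : neval s (V 17) = n2 by []. have v15 : neval s (V 15) = p2 by [].
rewrite run_seq run_if (leafE1 _ _ sb1) run_seq; set s2 := (if _ then _ else _).
(* [x2] and [x3] are the partial minima of [bdist_step], nested in the order in which the command
   takes them. *)
pose x2 := if c0 n1 == 0%N then L + (below (bt1 n1) + below (bt2 n2)) else
  Num.min (bdist (bt1 (c1 n1)) (bt2 n2) (H1 n1 - H1 p1 + top_len (bt1 (c1 n1))) (H2 n2 - H2 p2)
             + bweight (bt1 (c0 n1).-1))
    (Num.min (bdist (bt1 (c0 n1).-1) (bt2 n2) (H1 n1 - H1 p1 + top_len (bt1 (c0 n1).-1)) (H2 n2 - H2 p2)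
             + bweight (bt1 (c1 n1))) (L + (below (bt1 n1) + below (bt2 n2)))).
have sb2 : same_but_best s s2 x2.
  rewrite /s2 /x2; case: eqP => [//|/eqP n0].
  have [fN fr fp] := ca_fst ca1 n1N n0; have [sN sr sp _] := ca_snd ca1 n1N n1r n0.
  have h1 := improve_same sb1 (e := RAdd (entry a0 (V 14) (V 17) (V 15)) (subtree_weight 0 a1)) isT.
  have h2 := improve_same h1 (e := RAdd (entry a1 (V 14) (V 17) (V 15)) (subtree_weight 0 a0)) isT.
  move: h2; rewrite !(revalD _ (entry _ _ _ _)) !w1 ?va0 ?va1 // !ent ?va0 ?va1 ?v14 ?v15 ?v17 //.
  by rewrite !HL'.
rewrite [in X in run _ X]run_if (leafE2 _ _ sb2); set s3 := (if _ then _ else _).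
pose x3 := if d0 n2 == 0%N then x2 else
  Num.min (bdist (bt1 n1) (bt2 (d1 n2)) (H1 n1 - H1 p1) (H2 n2 - H2 p2 + top_len (bt2 (d1 n2)))
             + bweight (bt2 (d0 n2).-1))
    (Num.min (bdist (bt1 n1) (bt2 (d0 n2).-1) (H1 n1 - H1 p1) (H2 n2 - H2 p2 + top_len (bt2 (d0 n2).-1))
             + bweight (bt2 (d1 n2))) x2).
have sb3 : same_but_best s s3 x3.
  rewrite /s3 /x3; case: eqP => [//|/eqP n0].
  have [fN fr fp] := ca_fst ca2 n2N n0; have [sN sr sp _] := ca_snd ca2 n2N n2r n0.
  have h1 := improve_same sb2 (e := RAdd (entry (V 16) (V 14) b0 (V 15)) (subtree_weight 1 b1)) isT.
  have h2 := improve_same h1 (e := RAdd (entry (V 16) (V 14) b1 (V 15)) (subtree_weight 1 b0)) isT.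
  move: h2; rewrite !(revalD _ (entry _ _ _ _)) !w2 ?vb0 ?vb1 // !ent ?vb0 ?vb1 ?v14 ?v15 ?v16 //.
  by rewrite !HR'.
rewrite run_if (leafE1 _ _ sb3) run_if (leafE2 _ _ sb3) run_seq !run_skip.
have fin s' x : same_but_best s s' x -> rmem s' 7 0 = x by case.
rewrite /bdist_step E1 E2.
case z1 : (c0 n1 == 0%N); last case z2 : (d0 n2 == 0%N).
- rewrite (fin _ _ sb3) /x3 /x2 z1; case z2 : (d0 n2 == 0%N); by rewrite E1 E2 z1 z2.
- by rewrite (fin _ _ sb3) /x3 /x2 z1 z2 E1 E2 z1 z2.
have n0 := negbT z1; have m0 := negbT z2.
have [fN fr fp] := ca_fst ca1 n1N n0; have [sN sr sp _] := ca_snd ca1 n1N n1r n0.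
have [fN' fr' fp'] := ca_fst ca2 n2N m0; have [sN' sr' sp' _] := ca_snd ca2 n2N n2r m0.
have h1 := improve_same sb3 (e := RAdd length_difference
  (RAdd (entry a0 (V 16) b0 (V 17)) (entry a1 (V 16) b1 (V 17)))) isT.
have h2 := improve_same h1 (e := RAdd length_difference
  (RAdd (entry a0 (V 16) b1 (V 17)) (entry a1 (V 16) b0 (V 17)))) isT.
rewrite (fin _ _ h2) !revalD eL !ent ?va0 ?va1 ?vb0 ?vb1 ?v16 ?v17 // !HM' //.
by rewrite /x3 /x2 z1 z2 E1 E2 z1 z2.
Qed.

End Table.

End Cell.

(** * Filling the table *)

Definition fill_p2 : cmd := CFor 15 1 fill_entry.
Definition fill_p1 : cmd := CFor 14 0 fill_p2.
Definition fill_n2 : cmd := CFor 13 1 (CSeq (CN 17 (NConst 0) (NGet 9 (V 13))) fill_p1).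
Definition fill_table : cmd := CFor 12 0 (CSeq (CN 16 (NConst 0) (NGet 8 (V 12))) fill_n2).

(** The order of the four loops. Every entry consulted has a lower end of smaller rank in one tree
    without being later in the other. After a matching the upper ends may be any vertices, so the
    loops over lower ends must be the outer ones. *)
Definition lex4 (a b c d i j k l : nat) : bool :=
  (a < i)%N || ((a == i) && ((b < j)%N || ((b == j) && ((c < k)%N || ((c == k) && (d < l)%N))))).

Lemma mul_add_inj K a b a' b' : (b < K)%N -> (b' < K)%N ->
  (a * K + b = a' * K + b')%N -> a = a' /\ b = b'.
Proof.
move=> bK bK' e; have K0 : (0 < K)%N by apply: leq_ltn_trans bK.
have ea : a = a' by have := congr1 (divn^~ K) e; rewrite !divnMDl // !divn_small // !addn0.
by split=> //; move: e; rewrite ea => /addnI.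
Qed.

Lemma address_lt a b K L : (a < L)%N -> (b < K)%N -> (a * K + b < L * K)%N.
Proof.
move=> aL bK; apply: leq_trans (_ : a.+1 * K <= _)%N; last by rewrite leq_mul2r aL orbT.
by rewrite mulSn addnC ltn_add2r.
Qed.

Section Fill.

Variable R : realType.
Implicit Type s : state R.

Variables (N1 : nat) (par1 : nat -> nat) (lb1 : nat -> R) (r1 : nat) (dep1 : nat -> nat).
Variables (N2 : nat) (par2 : nat -> nat) (lb2 : nat -> R) (r2 : nat) (dep2 : nat -> nat).
Hypothesis pt1 : parent_tree N1 par1 lb1 r1 dep1.
Hypothesis pt2 : parent_tree N2 par2 lb2 r2 dep2.
Variables (c0 c1 d0 d1 : nat -> nat).

Let ready := ready N1 par1 lb1 r1 dep1 N2 par2 lb2 r2 dep2 c0 c1 d0 d1.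
Let address := table_index N1 N2.
Let entry_value := entry_value N1 par1 lb1 dep1 N2 par2 lb2 dep2 c0 c1 d0 d1.
Let rank1 := rank N1 par1 lb1.
Let rank2 := rank N2 par2 lb2.

Lemma address_inj a b c d a' b' c' d' :
  (b < N1)%N -> (c < N2)%N -> (d < N2)%N -> (b' < N1)%N -> (c' < N2)%N -> (d' < N2)%N ->
  address a b c d = address a' b' c' d' -> [/\ a = a', b = b', c = c' & d = d'].
Proof.
move=> bN cN dN bN' cN' dN'; rewrite /address /table_index -!addnA.
have l := address_lt cN dN; have l' := address_lt cN' dN'.
case/mul_add_inj; [exact: address_lt|exact: address_lt|] => ->.
by case/mul_add_inj => // -> /mul_add_inj[] // -> ->.
Qed.

(** The loops also visit the roots as lower ends. Nothing is claimed of those entries; by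
    [address_inj] writing them leaves all others intact. *)
Definition done s i1 i2 k1 k2 := forall v1 x1 v2 x2,
  (v1 < N1)%N -> (x1 < N1)%N -> (v2 < N2)%N -> (x2 < N2)%N -> v1 != r1 -> v2 != r2 ->
  lex4 (rank1 v1) (rank2 v2) x1 x2 i1 i2 k1 k2 ->
  rmem s 8 (address v1 x1 v2 x2) = entry_value v1 x1 v2 x2.

Lemma ready_setn s a v : (11 < a)%N -> (a < 20)%N -> ready s -> ready (setn s a 0 v).
Proof.
move=> a11 a20; apply: (ready_run (c := CN a (NConst 0) (NConst v))).
by rewrite /keeps_ready /untouched /= !inE; lia.
Qed.

Lemma run_fill_entry s n1 p1 n2 p2 k : ready s ->
  nmem s 16 0 = n1 -> nmem s 14 0 = p1 -> nmem s 17 0 = n2 -> nmem s 15 0 = p2 ->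
  (n1 < N1)%N -> (p1 < N1)%N -> (n2 < N2)%N ->
  rmem (run fill_entry s) 8 k =
    if k == address n1 p1 n2 p2 then rmem (run compute_best s) 7 0 else rmem s 8 k.
Proof.
move=> rd e16 e14 e17 e15 n1N p1N n2N; rewrite /fill_entry run_seq run_real.
have nm a : nmem (run compute_best s) a = nmem s a.
  by apply/funext => j; apply: nmem_run.
have -> : neval (run compute_best s) (table_address (V 16) (V 14) (V 17) (V 15)) =
    address n1 p1 n2 p2.
  rewrite (@neval_same _ s); last by apply/funext.
  have := neval_table_address (e1 := V 16) (e2 := V 14) (e3 := V 17) (V 15) rd.
  by rewrite [neval s (V 16)]e16 [neval s (V 14)]e14 [neval s (V 17)]e17
    [neval s (V 15)]e15; apply; apply: ltnW.
rewrite /=; upd; case: eqP => // _; exact: rmem_run.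
Qed.

Lemma fill_entry_done s n1 p1 n2 p2 : ready s ->
  nmem s 16 0 = n1 -> nmem s 14 0 = p1 -> nmem s 17 0 = n2 -> nmem s 15 0 = p2 ->
  (n1 < N1)%N -> (p1 < N1)%N -> (n2 < N2)%N -> (p2 < N2)%N ->
  done s (rank1 n1) (rank2 n2) p1 p2 -> done (run fill_entry s) (rank1 n1) (rank2 n2) p1 p2.+1.
Proof.
move=> rd e16 e14 e17 e15 n1N p1N n2N p2N dn v1 x1 v2 x2 v1N x1N v2N x2N v1r v2r lx.
rewrite (run_fill_entry _ rd e16 e14 e17 e15) //; case: eqP => [/address_inj e|ne].
  have [] := e x1N v2N x2N p1N n2N p2N => *; subst v1 x1 v2 x2.
  apply: (run_compute_best pt1 pt2 rd e16 e14 e17 e15) => //.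
  - move=> c cN cr pc; apply: dn => //.
    by have := rank_child pt1 cN cr; rewrite pc /lex4 => ->.
  - move=> d dN dr pd; apply: dn => //.
    by have := rank_child pt2 dN dr; rewrite pd /lex4 eqxx => ->; rewrite orbT.
  - move=> c d cN cr pc dN dr pd; apply: dn => //.
    by have := rank_child pt1 cN cr; rewrite pc /lex4 => ->.
apply: dn => //.
have H : [&& v1 == n1, x1 == p1, v2 == n2 & x2 == p2] = false.
  by apply/negP => /and4P[/eqP e1 /eqP e2 /eqP e3 /eqP e4]; case: ne; rewrite e1 e2 e3 e4.
move: lx; rewrite /lex4; have [e1|] := eqVneq (rank1 v1) (rank1 n1); last by move=> _; rewrite !orbF.
have [e2|] := eqVneq (rank2 v2) (rank2 n2); last by move=> _; rewrite !orbF.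
move: H; rewrite (rank_inj v1N n1N e1) (rank_inj v2N n2N e2) !eqxx /= !ltnn /= ltnS.
by case: (x1 =P p1) => //= _; case: (x2 =P p2) => //= ne2 _; move: ne2; clear; lia.
Qed.

Lemma admissible_fill_p2 : admissible fill_p2. Proof. by []. Qed.
Lemma admissible_fill_p1 : admissible fill_p1. Proof. by []. Qed.
Lemma admissible_fill_n2 : admissible fill_n2. Proof. by []. Qed.
Lemma admissible_fill_table : admissible fill_table. Proof. by []. Qed.

Lemma ready_sizes s : ready s -> nmem s 0 0 = N1 /\ nmem s 1 0 = N2.
Proof. by case=> [[/pr_size -> _ _] [/pr_size -> _ _] _ _ _]. Qed.

Lemma fill_p2_done s n1 p1 n2 : ready s ->
  nmem s 16 0 = n1 -> nmem s 14 0 = p1 -> nmem s 17 0 = n2 ->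
  (n1 < N1)%N -> (p1 < N1)%N -> (n2 < N2)%N ->
  done s (rank1 n1) (rank2 n2) p1 0 ->
  ready (run fill_p2 s) /\ done (run fill_p2 s) (rank1 n1) (rank2 n2) p1.+1 0.
Proof.
move=> rd e16 e14 e17 n1N p1N n2N dn; have [s0 s1] := ready_sizes rd.
pose Inv j s := [/\ ready s, nmem s 16 0 = n1, nmem s 14 0 = p1, nmem s 17 0 = n2 &
  done s (rank1 n1) (rank2 n2) p1 j].
have [i1 _ _ _ i5] : Inv N2 (run fill_p2 s).
  apply: run_for admissible_fill_p2 s1 _ _.
    by split=> //=; apply: ready_setn.
  move=> j s2 jN ej _ [g1 g2 g3 g4 g5].
  split; try by rewrite /=; upd; rewrite nmem_run.
    by apply: ready_setn => //; apply: ready_run g1.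
  exact: (fill_entry_done g1 g2 g3 g4 ej).
(* Every upper end in the second tree is below [N2], so exhausting this loop amounts to one round of
   the enclosing one. *)
split=> // v1 x1 v2 x2 v1N x1N v2N x2N v1r v2r lx; apply: i5 => //.
by move: lx; rewrite /lex4; lia.
Qed.

Lemma fill_p1_done s n1 n2 : ready s ->
  nmem s 16 0 = n1 -> nmem s 17 0 = n2 -> (n1 < N1)%N -> (n2 < N2)%N ->
  done s (rank1 n1) (rank2 n2) 0 0 ->
  ready (run fill_p1 s) /\ done (run fill_p1 s) (rank1 n1) (rank2 n2).+1 0 0.
Proof.
move=> rd e16 e17 n1N n2N dn; have [s0 s1] := ready_sizes rd.
pose Inv j s := [/\ ready s, nmem s 16 0 = n1, nmem s 17 0 = n2 &
  done s (rank1 n1) (rank2 n2) j 0].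
have [i1 _ _ i5] : Inv N1 (run fill_p1 s).
  apply: run_for admissible_fill_p1 s0 _ _.
    by split=> //=; apply: ready_setn.
  move=> j s2 jN ej _ [g1 g2 g3 g4].
  have [h1 h2] := fill_p2_done g1 g2 ej g3 n1N jN n2N g4.
  split=> //; try by rewrite /=; upd; rewrite nmem_run.
  exact: ready_setn.
split=> // v1 x1 v2 x2 v1N x1N v2N x2N v1r v2r lx; apply: i5 => //.
by move: lx; rewrite /lex4; lia.
Qed.

Lemma fill_n2_done s n1 : ready s -> nmem s 16 0 = n1 -> (n1 < N1)%N ->
  done s (rank1 n1) 0 0 0 ->
  ready (run fill_n2 s) /\ done (run fill_n2 s) (rank1 n1).+1 0 0 0.
Proof.
move=> rd e16 n1N dn; have [s0 s1] := ready_sizes rd.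
pose Inv j s := [/\ ready s, nmem s 16 0 = n1 & done s (rank1 n1) j 0 0].
have [i1 _ i5] : Inv N2 (run fill_n2 s).
  apply: run_for admissible_fill_n2 s1 _ _.
    by split=> //=; apply: ready_setn.
  move=> j s2 jN ej _ [g1 g2 g3]; rewrite run_seq run_nat.
  have [v vN rv] := rank_surj par2 lb2 jN.
  have ov : neval s2 (NGet 9 (V 13)) = v.
    by have [_ [/pr_ord o _ _] _ _ _] := g1; rewrite /= ej -rv; apply: o.
  rewrite ov; set s3 := setn s2 17 _ v.
  have r3 : ready s3 by apply: ready_setn.
  have e3 : nmem s3 16 0 = n1 by rewrite /s3 /=; upd.
  have f3 : nmem s3 17 0 = v by rewrite /s3 /=; upd.
  have [] := fill_p1_done r3 e3 f3 n1N vN; first by rewrite /rank2 rv.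
  rewrite /rank2 rv => h1 h2; split=> //; first exact: ready_setn.
  by rewrite /=; upd; rewrite nmem_run.
split=> // v1 x1 v2 x2 v1N x1N v2N x2N v1r v2r lx; apply: i5 => //.
by move: lx; rewrite /lex4; have := rank_lt par2 lb2 v2N; rewrite -/(rank2 v2); lia.
Qed.

Lemma fill_table_done s : ready s ->
  ready (run fill_table s) /\ forall v1 x1 v2 x2, (v1 < N1)%N -> (x1 < N1)%N ->
    (v2 < N2)%N -> (x2 < N2)%N -> v1 != r1 -> v2 != r2 ->
    rmem (run fill_table s) 8 (address v1 x1 v2 x2) = entry_value v1 x1 v2 x2.
Proof.
move=> rd; have [s0 s1] := ready_sizes rd.
pose Inv j s := ready s /\ done s j 0 0 0.
have [i1 i5] : Inv N1 (run fill_table s).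
  apply: run_for admissible_fill_table s0 _ _.
    split; first exact: ready_setn.
    by move=> v1 x1 v2 x2 _ _ _ _ _ _; rewrite /lex4; lia.
  move=> j s2 jN ej _ [g1 g2]; rewrite run_seq run_nat.
  have [v vN rv] := rank_surj par1 lb1 jN.
  have ov : neval s2 (NGet 8 (V 12)) = v.
    by have [[/pr_ord o _ _] _ _ _ _] := g1; rewrite /= ej -rv; apply: o.
  rewrite ov; set s3 := setn s2 16 _ v.
  have r3 : ready s3 by apply: ready_setn.
  have e3 : nmem s3 16 0 = v by rewrite /s3 /=; upd.
  have [] := fill_n2_done r3 e3 vN; first by rewrite /rank1 rv.
  by rewrite /rank1 rv => h1 h2; split=> //; apply: ready_setn.
split=> // v1 x1 v2 x2 v1N x1N v2N x2N v1r v2r; apply: i5 => //.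
by rewrite /lex4 (rank_lt par1 lb1 v1N).
Qed.

End Fill.

(** * The whole program and its running time *)

Definition emit : cmd :=
  CR 2 (NConst 0) (entry (NSub (NGet 4 (V 10)) (NConst 1)) (V 10)
                         (NSub (NGet 5 (V 11)) (NConst 1)) (V 11)).

Definition main_cmd : cmd :=
  CSeq (prepare 0) (CSeq (prepare 1)
    (CSeq (multiples 20 1 (V 1)) (CSeq (multiples 21 0 (NGet 20 (V 1)))
      (CSeq (multiples 22 0 (NGet 21 (V 0))) (CSeq fill_table emit))))).

Fixpoint loop_depth (c : cmd) (n : nat) : nat :=
  match c with
  | CSeq c1 c2 | CIf _ c1 c2 => maxn (loop_depth c1 n) (loop_depth c2 n)
  | CFor _ n' c1 => ((n == n') + loop_depth c1 n)%N
  | _ => 0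
  end.

(** Each enclosing loop over a tree contributes a factor of its size. Since sizes are positive,
    parts nested less deeply are dominated by the deepest ones, and what remains is the cost with
    all bounds set to [1]. *)
Lemma cost_le (B : nat -> nat) c : (0 < B 0)%N -> (0 < B 1)%N -> admissible c ->
  (cost B c <= cost (fun=> 1) c * (B 0 ^ loop_depth c 0 * B 1 ^ loop_depth c 1))%N.
Proof.
move=> b0 b1; have pos i j : (0 < B 0 ^ i * B 1 ^ j)%N by rewrite muln_gt0 !expn_gt0 b0 b1.
have mono i j i' j' : (i <= i')%N -> (j <= j')%N ->
    (B 0 ^ i * B 1 ^ j <= B 0 ^ i' * B 1 ^ j')%N.
  by move=> ii jj; apply: leq_mul; rewrite leq_pexp2l.
have both c1 c2 k k1 k2 : (k1 <= cost (fun=> 1) c1 * (B 0 ^ loop_depth c1 0 * B 1 ^ loop_depth c1 1))%N ->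
    (k2 <= cost (fun=> 1) c2 * (B 0 ^ loop_depth c2 0 * B 1 ^ loop_depth c2 1))%N ->
    ((k + (k1 + k2)).+1 <= (k + (cost (fun=> 1) c1 + cost (fun=> 1) c2)).+1 *
      (B 0 ^ maxn (loop_depth c1 0) (loop_depth c2 0) *
       B 1 ^ maxn (loop_depth c1 1) (loop_depth c2 1)))%N.
  move=> h1 h2; set Z := (X in (_ <= _ * X)%N); have Z0 : (0 < Z)%N by apply: pos.
  have l1 := leq_trans h1 (leq_mul (leqnn _)
    (mono _ _ _ _ (leq_maxl _ (loop_depth c2 0)) (leq_maxl _ (loop_depth c2 1)))).
  have l2 := leq_trans h2 (leq_mul (leqnn _)
    (mono _ _ _ _ (leq_maxr (loop_depth c1 0) _) (leq_maxr (loop_depth c1 1) _))).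
  rewrite -/Z in l1 l2; rewrite -addn1 -[(k + _).+1]addn1 !mulnDl mul1n.
  by apply: leq_add => //; apply: leq_add; [apply: leq_pmulr | apply: leq_add].
elim: c => [|a i e|a i e|c1 IH1 c2 IH2|b c1 IH1 c2 IH2|i n c1 IH].
- by rewrite /= mul1n.
- by rewrite /= muln1.
- by rewrite /= muln1.
- by case/andP=> /IH1 h1 /IH2 h2; apply: (both c1 c2 0%N).
- by case/andP=> /IH1 h1 /IH2 h2; apply: both.
case/and4P=> n1 _ _ /IH h.
have -> : (B 0 ^ loop_depth (CFor i n c1) 0 * B 1 ^ loop_depth (CFor i n c1) 1 =
    B n * (B 0 ^ loop_depth c1 0 * B 1 ^ loop_depth c1 1))%N.
  case: n n1 => [|[|//]] _ /=; rewrite ?add0n ?add1n expnS; first by rewrite mulnA.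
  by rewrite mulnCA.
have bn : (0 < B n)%N by case: n n1 => [|[|//]].
move: h => /=; set X := (B 0 ^ _ * _)%N; have X0 : (0 < X)%N by apply: pos.
clearbody X; move: (cost B c1) (cost (fun=> 1%N) c1) (B n) bn => k k1 b b_gt0 h.
have h1 : (b * k <= b * (k1 * X))%N by rewrite leq_mul2l h orbT.
have h2 : (b <= b * X)%N by rewrite leq_pmulr.
have h3 : (0 < b * X)%N by rewrite muln_gt0 b_gt0.
by rewrite mul1n; move: h1 h2 h3; clear; nia.
Qed.

Section Main.

Variable R : realType.

Variables (T1 T2 : merge_tree R) (e1 : seq T1) (e2 : seq T2).
Hypotheses (bin1 : binary T1) (bin2 : binary T2) (num1 : numbering e1) (num2 : numbering e2).

Lemma output_main_cmd :
  ((output (run main_cmd (input_state e1 e2)))%:E = one_degree_distance T1 T2)%E.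
Proof.
have pt1 := numbered_parent_tree bin1 num1; have pt2 := numbered_parent_tree bin2 num2.
set N1 := nvertices T1 in pt1; set N2 := nvertices T2 in pt2.
set par1 := (fun n => nth 0%N (parent_array e1) n) in pt1.
set par2 := (fun n => nth 0%N (parent_array e2) n) in pt2.
set lb1 := (fun n => nth 0 (label_array e1) n) in pt1.
set lb2 := (fun n => nth 0 (label_array e2) n) in pt2.
set r1 := index _ e1 in pt1; set r2 := index _ e2 in pt2.
set dep1 := (fun n => depth (nth (Defs.root T1) e1 n)) in pt1.
set dep2 := (fun n => depth (nth (Defs.root T2) e2 n)) in pt2.
set s0 := input_state e1 e2.
have nz a v : (3 < a)%N -> nmem s0 a v = 0%N.
  by move=> a3; rewrite /s0 /= (nth_default [::]) ?nth_nil.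
have rz a v : (1 < a)%N -> rmem s0 a v = 0.
  by move=> a1; rewrite /s0 /= (nth_default [::]) ?nth_nil.
have fr a c : (a \notin nmods c) -> forall s' : state R, nmem (run c s') a = nmem s' a.
  by move=> h s'; apply/funext => k; apply: nmem_run.
have fr' a c : (a \notin rmods c) -> forall s' : state R, rmem (run c s') a = rmem s' a.
  by move=> h s'; apply/funext => k; apply: rmem_run.
rewrite /main_cmd 6!run_seq; set s1 := run (prepare 0) s0; set s2 := run (prepare 1) s1.
set s3 := run (multiples 20 _ _) s2; set s4 := run (multiples 21 _ _) s3.
set s5 := run (multiples 22 _ _) s4; set s6 := run fill_table s5.
have p1 : prepared N1 par1 lb1 r1 dep1 0 s1.
  by apply: (prepare_spec pt1) => // v; rewrite ?nz ?rz.
have p2 : prepared N2 par2 lb2 r2 dep2 1 s2.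
  by apply: (prepare_spec pt2) => //; rewrite /s1 ?fr ?fr' // => v; rewrite ?fr ?fr' ?nz ?rz.
have q1 : prepared N1 par1 lb1 r1 dep1 0 s2 by apply: prepared_run p1.
have x3 j : (j <= N2)%N -> nmem s3 20 j = (j * N2)%N.
  apply: multiples_spec => //; first exact: (pr_size p2).
    by move=> s' h; rewrite /= h // (pr_size p2).
  by rewrite /s2 /s1 !fr // nz.
have q1_3 : prepared N1 par1 lb1 r1 dep1 0 s3 by apply: prepared_run q1.
have q2_3 : prepared N2 par2 lb2 r2 dep2 1 s3 by apply: prepared_run p2.
have x4 j : (j <= N1)%N -> nmem s4 21 j = (j * (N2 * N2))%N.
  apply: multiples_spec => //; first exact: (pr_size q1_3).
    by move=> s' h; rewrite /= !h // (pr_size q2_3) x3.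
  by rewrite /s3 /s2 /s1 !fr // nz.
have q1_4 : prepared N1 par1 lb1 r1 dep1 0 s4 by apply: prepared_run q1_3.
have q2_4 : prepared N2 par2 lb2 r2 dep2 1 s4 by apply: prepared_run q2_3.
have x5 j : (j <= N1)%N -> nmem s5 22 j = (j * (N1 * (N2 * N2)))%N.
  apply: multiples_spec => //; first exact: (pr_size q1_4).
    by move=> s' h; rewrite /= !h // (pr_size q1_4) x4.
  by rewrite /s4 /s3 /s2 /s1 !fr // nz.
have q1_5 : prepared N1 par1 lb1 r1 dep1 0 s5 by apply: prepared_run q1_4.
have q2_5 : prepared N2 par2 lb2 r2 dep2 1 s5 by apply: prepared_run q2_4.
have rd : ready N1 par1 lb1 r1 dep1 N2 par2 lb2 r2 dep2
    (nmem s5 4) (nmem s5 6) (nmem s5 5) (nmem s5 7) s5.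
  split=> // [j jN|j jN]; first by rewrite /s5 (fr _ (multiples 22 _ _)) // /s4 (fr _ (multiples 21 _ _)) // x3.
  by rewrite /s5 (fr _ (multiples 22 _ _)) // x4.
have [rd6 tab] := fill_table_done pt1 pt2 rd.
rewrite -/s6 in rd6 tab; clearbody s6; clearbody s5.
have ca1 := pr_children q1_5; have ca2 := pr_children q2_5.
have [u [uN ur pu _]] := pt_root_child pt1; have [w [wN wr pw _]] := pt_root_child pt2.
have n1 := ca_inner ca1 uN ur; have n2 := ca_inner ca2 wN wr; rewrite pu in n1; rewrite pw in n2.
have [cN cr pc] := ca_fst ca1 (pt_root_lt pt1) n1.
have [dN dr pd] := ca_fst ca2 (pt_root_lt pt2) n2.
rewrite (distance_bdist bin1 bin2 num1 num2 ca1 ca2 cN cr pc dN dr pd); congr (_%:E).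
have [[g1 g4 g6] [g2 g5 g7] _ _ _] := rd6.
have h10 : nmem s6 10 0 = r1 := pr_root g1; have h11 : nmem s6 11 0 = r2 := pr_root g2.
have v10 : neval s6 (V 10) = r1 by []. have v11 : neval s6 (V 11) = r2 by [].
set x1 := NSub (NGet 4 (V 10)) (NConst 1); set x2 := NSub (NGet 5 (V 11)) (NConst 1).
have vx1 : neval s6 x1 = (nmem s5 4 r1).-1 by rewrite /= h10 g4 subn1.
have vx2 : neval s6 x2 = (nmem s5 5 r2).-1 by rewrite /= h11 g5 subn1.
have ea := neval_table_address (e1 := x1) (e2 := V 10) (e3 := x2) (V 11) rd6.
rewrite vx1 vx2 v10 v11 in ea.
have {}ea := ea (ltnW cN) (ltnW (pt_root_lt pt1)) (ltnW dN).
have -> : output (run emit s6) = reval s6 (entry x1 (V 10) x2 (V 11)).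
  by rewrite /output run_real /=; upd.
transitivity (rmem s6 8 (table_index N1 N2 (nmem s5 4 r1).-1 r1 (nmem s5 5 r2).-1 r2)).
  by rewrite -ea.
rewrite tab ?(pt_root_lt pt1) ?(pt_root_lt pt2) // /entry_value.
(* The entry read belongs to the two edges at the roots. Roots have height [0], so the lengths of
   these paths are the labels. *)
rewrite (height_par pt1 cN cr) (height_par pt2 dN dr) pc pd.
by rewrite (height_root pt1) (height_root pt2) !subr0 !addr0.
Qed.

End Main.

Theorem mainTheorem3 (R : realType) :
  exists (P : program) (C : nat),
    forall T1 T2 : merge_tree R, binary T1 -> binary T2 ->
    forall (e1 : seq T1) (e2 : seq T2), numbering e1 -> numbering e2 ->
    exists (t : nat) (s : state R),
      [/\ exec P (input_state e1 e2) t s,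
          ((output s)%:E = one_degree_distance T1 T2)%E,
          (t <= C * (nvertices T1 ^ 2 * nvertices T2 ^ 2))%N
        & forall n : nat, (nvertices T1 <= n)%N -> (nvertices T2 <= n)%N ->
            (t <= C * n ^ 4)%N].
Proof.
(* The constant is the cost with all loop bounds equal to [1]. The loops of [main_cmd] are nested at
   most twice over each tree, in the preprocessing as well as in [fill_table], whence the two
   squares. *)
exists (compile main_cmd), (cost (fun=> 1%N) main_cmd).
move=> T1 T2 bin1 bin2 e1 e2 num1 num2.
pose B n := if n == 0%N then nvertices T1 else nvertices T2.
have admissible_main : admissible main_cmd by [].
have [|t ex le] := @exec_compile R B main_cmd (input_state e1 e2) admissible_main.
  by case=> [|[|//]].
have pos (T : merge_tree R) : (0 < nvertices T)%N by apply/card_gt0P; exists (Defs.root T).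
have le' : (t <= cost (fun=> 1%N) main_cmd * (nvertices T1 ^ 2 * nvertices T2 ^ 2))%N.
  exact: leq_trans le (cost_le (pos T1 : (0 < B 0)%N) (pos T2 : (0 < B 1)%N) admissible_main).
exists t, (run main_cmd (input_state e1 e2)); split=> //; first exact: output_main_cmd.
move=> n l1 l2; apply: leq_trans le' _; apply: leq_mul => //.
by rewrite -[4%N]/(2 + 2)%N expnD; apply: leq_mul; rewrite leq_exp2r.
Qed.
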